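(* Let $u$ be a non-constant inner function and $\zeta\in\mathbb{T}\setminus \sigma(u)$. Then \[ \|\mathrm{Q}_\zeta^u\| \geq \frac{|u''(\zeta)|}{2|u'(\zeta)|}. \]
   Context: $\mathbb{D}$ is the open unit disk, $\mathbb{T}=\partial\mathbb{D}$, $H^2=H^2(\mathbb{D})$ is the Hardy space. An inner function $u$ is a bounded holomorphic function on $\mathbb{D}$ with $\lim_{r\to1}|u(r\xi)|=1$ for almost every $\xi\in\mathbb{T}$. Its model space is $K_u := H^2 \ominus uH^2$, with the $H^2$-norm. The spectrum of $u$ is $\sigma(u) := \{\lambda\in\overline{\mathbb{D}} : \liminf_{z\to\lambda,\ z\in\mathbb{D}}|u(z)|=0\}$. For $\zeta\in\mathbb{T}\setminus\sigma(u)$, $u$ and every $f\in K_u$ extend analytically to a neighbourhood of $\zeta$; $u'(\zeta)$, $u''(\zeta)$, $f(\zeta)$ are understood via these extensions (and $u'(\zeta)\neq0$ when $u$ is non-constant). The difference quotient operator $\mathrm{Q}_\zeta^u$ is the bounded operator on $K_u$ given by $(\mathrm{Q}_\zeta^u f)(z) = \frac{f(z)-f(\zeta)}{z-\zeta}$, $z\in\mathbb{D}$; equivalently $\mathrm{Q}_\zeta^u = (\mathrm{I}-\zeta X_u)^{-1}X_u$, where $X_u$ is the restriction to $K_u$ of the backward shift $S^*f(z)=(f(z)-f(0))/z$. $\|\mathrm{Q}_\zeta^u\|$ is its operator norm on $K_u$. *)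

(* Defs.v *)
From HB Require Import structures.
From mathcomp Require Import all_boot all_order all_algebra.
From mathcomp Require Import all_classical all_reals all_analysis.
From mathcomp Require Import complex.

Set Implicit Arguments.
Unset Strict Implicit.
Unset Printing Implicit Defensive.

Import Order.TTheory GRing.Theory Num.Theory.
Import numFieldNormedType.Exports.

Local Open Scope classical_set_scope.
Local Open Scope ring_scope.

(* Typing the complex numbers as a numClosedFieldType gives them the topology
   and the normed space structure (over themselves) that MathComp-Analysis puts
   on every such field, so [derivable f z 1] is complex differentiability and
   [derive1 f z] the complex derivative. *)
Definition Cplx (R : realType) : numClosedFieldType := R[i].

(* The norm `|z| of z : Cplx R lies in Cplx R; cmod is the real-valued modulus. *)
Definition cmod (R : realType) (z : Cplx R) : R := ComplexField.Normc.normc z.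

Definition polar (R : realType) (r t : R) : Cplx R :=
  ((r * cos t) +i* (r * sin t))%C.

Definition unit_disk (R : realType) : set (Cplx R) := [set z | cmod z < 1].
Definition closed_disk (R : realType) : set (Cplx R) := [set z | cmod z <= 1].
Definition unit_circle (R : realType) : set (Cplx R) := [set z | cmod z = 1].

(* A function on the disk is represented by any total function with the given
   values on the disk; nothing below depends on the values elsewhere. *)

Definition holomorphic_on (R : realType) (V : set (Cplx R))
    (f : Cplx R -> Cplx R) : Prop :=
  forall z, V z -> derivable f z 1.

(* Almost every point of the circle, through t |-> exp(it) on [0, 2 pi]. *)
Definition inner_function (R : realType) (u : Cplx R -> Cplx R) : Prop :=
  [/\ holomorphic_on (@unit_disk R) u,
      exists M : R, forall z, unit_disk z -> cmod (u z) <= M &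
      {ae lebesgue_measure, forall t : R, 0 <= t <= 2 * pi ->
        cmod (u (polar r t)) @[r --> 1^'-] --> (1 : R)}].

Definition nonconstant_on_disk (R : realType) (u : Cplx R -> Cplx R) : Prop :=
  ~ exists c : Cplx R, forall z, unit_disk z -> u z = c.

Definition taylor_coef (R : realType) (f : Cplx R -> Cplx R) (n : nat) : Cplx R :=
  derive1n n f 0 / n`!%:R.

(* The Hardy space norm and inner product are those of the square-summable
   sequences of Taylor coefficients at 0. *)
Definition hardy_norm (R : realType) (f : Cplx R -> Cplx R) : \bar R :=
  sqrte (\sum_(0 <= n <oo) ((cmod (taylor_coef f n)) ^+ 2)%:E)%E.

Definition hardy_space (R : realType) : set (Cplx R -> Cplx R) :=
  [set f | holomorphic_on (@unit_disk R) f /\ (hardy_norm f < +oo)%E].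

Definition hardy_dot (R : realType) (f g : Cplx R -> Cplx R) : Cplx R :=
  limn (series (fun n => taylor_coef f n * (taylor_coef g n)^*)).

Definition model_space (R : realType) (u : Cplx R -> Cplx R) :
    set (Cplx R -> Cplx R) :=
  [set f | hardy_space f /\
           forall h, hardy_space h -> hardy_dot f (fun z => u z * h z) = 0].

Definition spectrum (R : realType) (u : Cplx R -> Cplx R) : set (Cplx R) :=
  [set l | closed_disk l /\
           limf_einf (fun z : Cplx R => (cmod (u z))%:E)
                     (within (@unit_disk R) (nbhs l)) = 0%E].

Definition analytic_extension (R : realType) (f : Cplx R -> Cplx R)
    (zeta : Cplx R) (g : Cplx R -> Cplx R) : Prop :=
  exists V : set (Cplx R),
    [/\ open V, V zeta, holomorphic_on V g &
        forall z, V z -> unit_disk z -> g z = f z].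

(* Extensions across a point zeta of the circle have the same value and the same
   derivatives at zeta, so it does not matter which one [xget] picks (it returns
   f itself if there is none). *)
Definition extension_at (R : realType) (f : Cplx R -> Cplx R) (zeta : Cplx R) :
    Cplx R -> Cplx R :=
  xget f [set g | analytic_extension f zeta g].

Definition diff_quotient (R : realType) (zeta : Cplx R) (f : Cplx R -> Cplx R) :
    Cplx R -> Cplx R :=
  fun z => (f z - extension_at f zeta zeta) / (z - zeta).

Definition model_opnorm (R : realType) (u : Cplx R -> Cplx R)
    (T : (Cplx R -> Cplx R) -> (Cplx R -> Cplx R)) : \bar R :=
  ereal_sup [set hardy_norm (T f) | f in
               [set f | model_space u f /\ (hardy_norm f <= 1)%E]].

(* Main.v *)
Require Import Defs.
From HB Require Import structures.
From mathcomp Require Import all_boot all_order all_algebra.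
From mathcomp Require Import all_classical all_reals all_analysis.
From mathcomp Require Import measurable_realfun complex ring lra.

Set Implicit Arguments.
Unset Strict Implicit.
Unset Printing Implicit Defensive.

Import Order.TTheory GRing.Theory Num.Theory.
Import numFieldNormedType.Exports.

Local Open Scope classical_set_scope.
Local Open Scope ring_scope.

(* Let c = u(zeta), k(z) = (u(z) - c) / (z - zeta) and Q = Q_zeta. Up to a
   unimodular factor k is the reproducing kernel of K_u at zeta: the means of
   f conj(k) over circles |z| = r tend to zeta conj(c) f(zeta) as r -> 1, for
   f = k and f = Q k. Hence k has squared norm |u'(zeta)|, while <Q k, k> has
   modulus |(Q k)(zeta)| = |u''(zeta)| / 2, and Cauchy-Schwarz applied to
   k / |k| gives the bound.

   A bounded f is in K_u as soon as f conj(u) = conj(f') almost everywhere on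
   the circle for some bounded holomorphic f' with f'(0) = 0. Such a partner is
   inherited by difference quotients, starting from the partner 1 of u, so k,
   Q k and Q (Q k) all have one. The continuation of u across zeta is obtained
   by reflection, from Cauchy integrals over polar rectangles. *)

(** The inner function is given only through radial limits of |u| at almost every angle, so boundary
    functions are never formed: a boundary identity is a difference that tends to 0 along radii r_n
    -> 1 for almost every angle, which is the form that dominated convergence takes. The same
    obstacle rules out reflection by pasting, since u is not known to be continuous up to the
    circle; the integrals that replace it only need the identity almost everywhere. Polar rectangles
    suit this because their outer sides are the arcs along which radial limits are taken; with inner
    radius 0 and a full turn they also give disks.

    The mean of f conj(k) reduces to the values at 0 of the partners of f and of Q f. Applying this
    to f = Q k is what calls for the partner of Q (Q k).

    The factor 1/2 is that of a second Taylor coefficient: the derivative at zeta of the difference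
    quotient of u is u''(zeta) / 2. Hardy norms are sums of coefficients, so Cauchy-Schwarz is
    proved for means over |z| = r_n, with a free weight, and then passed to the limit. *)

Section Modulus.
Variable R : realType.
Implicit Types (x y z w : Cplx R) (a b r t : R).

Lemma cmodE z : (cmod z)%:C%C = `|z| :> Cplx R. Proof. by []. Qed.
Lemma sqr_cmod z : cmod z ^+ 2 = complex.Re z ^+ 2 + complex.Im z ^+ 2.
Proof. by case: z => a b /=; rewrite sqr_sqrtr // addr_ge0 // sqr_ge0. Qed.
Lemma cmod_ge0 z : 0 <= cmod z. Proof. by case: z => a b; exact: sqrtr_ge0. Qed.
Lemma cmodD x y : cmod (x + y) <= cmod x + cmod y.
Proof. by move: (ler_normD x y); rewrite -!cmodE -rmorphD lecR. Qed.
Lemma cmodN x : cmod (- x) = cmod x. Proof. by have := normrN x; rewrite -!cmodE => -[]. Qed.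
Lemma cmodB x y : cmod (x - y) <= cmod x + cmod y.
Proof. by rewrite -(cmodN y); exact: cmodD. Qed.
Lemma cmodBC x y : cmod (x - y) = cmod (y - x). Proof. by rewrite -cmodN opprB. Qed.
Lemma cmodM x y : cmod (x * y) = cmod x * cmod y.
Proof. exact: ComplexField.Normc.normcM. Qed.
Lemma cmodV x : cmod x^-1 = (cmod x)^-1. Proof. exact: ComplexField.Normc.normcV. Qed.
Lemma cmod0 : cmod (0 : Cplx R) = 0. Proof. exact: ComplexField.Normc.normc0. Qed.
Lemma cmod1 : cmod (1 : Cplx R) = 1. Proof. exact: ComplexField.Normc.normc1. Qed.
Lemma cmodX x n : cmod (x ^+ n) = cmod x ^+ n.
Proof. by elim: n => [|n IH]; rewrite ?expr0 ?cmod1 // !exprS cmodM IH. Qed.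
Lemma cmod_eq0 x : (cmod x == 0) = (x == 0).
Proof.
apply/eqP/eqP => [|->]; last exact: cmod0.
exact: ComplexField.Normc.eq0_normc.
Qed.
Lemma cmod_gt0 x : (0 < cmod x) = (x != 0).
Proof. by rewrite lt_neqAle cmod_ge0 andbT eq_sym cmod_eq0. Qed.
Lemma cmodJ x : cmod x^* = cmod x.
Proof. by case: x => a b; rewrite /cmod/= sqrrN. Qed.
Lemma cmodC a : cmod (a%:C%C : Cplx R) = `|a|.
Proof. by rewrite /cmod/= expr0n addr0 sqrtr_sqr. Qed.
Lemma cmod_Re z : `|complex.Re z| <= cmod z.
Proof.
by rewrite -(ler_pXn2r (_ : 0 < 2)%N) ?nnegrE ?cmod_ge0// sqr_cmod real_normK ?num_real// lerDl sqr_ge0.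
Qed.
Lemma cmod_Im z : `|complex.Im z| <= cmod z.
Proof.
by rewrite -(ler_pXn2r (_ : 0 < 2)%N) ?nnegrE ?cmod_ge0// sqr_cmod real_normK ?num_real// lerDr sqr_ge0.
Qed.
Lemma cmod_ReIm z : cmod z <= `|complex.Re z| + `|complex.Im z|.
Proof.
rewrite -(ler_pXn2r (_ : 0 < 2)%N) ?nnegrE ?cmod_ge0// ?addr_ge0// sqr_cmod.
rewrite sqrrD !real_normK ?num_real// lerD2r lerDl.
by rewrite mulrn_wge0 // mulr_ge0.
Qed.
Lemma mulJ_cmod z : z * z^* = (cmod z ^+ 2)%:C%C.
Proof. by rewrite -normCK -cmodE rmorphXn. Qed.
Lemma cmod_ge_sub x y : cmod x - cmod y <= cmod (x - y).
Proof. by rewrite lerBlDr; apply: le_trans (cmodD _ _); rewrite subrK. Qed.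
Lemma cmod_dist x y : `|cmod x - cmod y| <= cmod (x - y).
Proof.
rewrite ler_norml cmod_ge_sub andbT lerNl opprB cmodBC; exact: cmod_ge_sub.
Qed.
Lemma cmod_sum (I : Type) (s : seq I) (F : I -> Cplx R) :
  cmod (\sum_(i <- s) F i) <= \sum_(i <- s) cmod (F i).
Proof.
elim/big_rec2: _ => [|i a x _ h]; first by rewrite cmod0.
by apply: le_trans (cmodD _ _) _; rewrite lerD2l.
Qed.

Lemma cReD x y : complex.Re (x + y) = complex.Re x + complex.Re y.
Proof. by case: x y => ? ? []. Qed.
Lemma cImD x y : complex.Im (x + y) = complex.Im x + complex.Im y.
Proof. by case: x y => ? ? []. Qed.
Lemma cReN x : complex.Re (- x) = - complex.Re x. Proof. by case: x. Qed.
Lemma cImN x : complex.Im (- x) = - complex.Im x. Proof. by case: x. Qed.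
Lemma cReB x y : complex.Re (x - y) = complex.Re x - complex.Re y.
Proof. by rewrite cReD cReN. Qed.
Lemma cImB x y : complex.Im (x - y) = complex.Im x - complex.Im y.
Proof. by rewrite cImD cImN. Qed.
Lemma cReM x y : complex.Re (x * y) = complex.Re x * complex.Re y - complex.Im x * complex.Im y.
Proof. by case: x y => ? ? []. Qed.
Lemma cImM x y : complex.Im (x * y) = complex.Re x * complex.Im y + complex.Im x * complex.Re y.
Proof. by case: x y => ? ? []. Qed.
Lemma cReJ x : complex.Re x^* = complex.Re x. Proof. by case: x. Qed.
Lemma cImJ x : complex.Im x^* = - complex.Im x. Proof. by case: x. Qed.
Lemma cplx_eq x y : complex.Re x = complex.Re y -> complex.Im x = complex.Im y -> x = y.
Proof. by case: x y => ? ? [? ?] /= -> ->. Qed.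

(** In the order of R[i] the positive elements are the positive reals: the complex epsilons of the
    topology of [Cplx R] can be traded for real ones, as in [near_cplxP] and [cvg_cplxP]. *)
Lemma cgt0P z : 0 < z -> 0 < complex.Re z /\ z = (complex.Re z)%:C%C.
Proof.
by case: z => a b; rewrite ltcE/= => /andP[/eqP -> h].
Qed.

Lemma near_cplxP z (P : set (Cplx R)) :
  (\forall w \near z, P w) <-> exists2 d : R, 0 < d & forall w, cmod (w - z) < d -> P w.
Proof.
split.
  move/nbhs_ballP => [e /= /cgt0P[e0 ee] he]; exists (complex.Re e) => // w hw.
  by apply: he; rewrite /ball/= ee distrC -cmodE ltcR.
move=> [d d0 hd]; apply/nbhs_ballP; exists (d%:C%C : Cplx R) => /=; first by rewrite ltcR.
by move=> w; rewrite /ball/= distrC -cmodE ltcR => /hd.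
Qed.

Lemma cvg_cplxP (T : Type) (F : set_system T) (FF : Filter F) (f : T -> Cplx R) (l : Cplx R) :
  f @ F --> l <-> forall e : R, 0 < e -> \forall t \near F, cmod (f t - l) <= e.
Proof.
split.
  move/cvgrPdist_le => H e e0; have := H (e%:C%C : Cplx R); rewrite ltcR => /(_ e0).
  by apply: filterS => t; rewrite distrC -cmodE lecR.
move=> H; apply/cvgrPdist_le => e /cgt0P[e0 ->]; apply: filterS (H _ e0) => t.
by rewrite distrC -cmodE lecR.
Qed.

Lemma cvg_cmod (T : Type) (F : set_system T) (FF : Filter F) (f : T -> Cplx R) (l : Cplx R) :
  f @ F --> l -> cmod (f t) @[t --> F] --> cmod l.
Proof.
move/cvg_cplxP => H; apply/cvgrPdist_le => e e0; apply: filterS (H _ e0) => t ht.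
by apply: le_trans ht; rewrite cmodBC; exact: cmod_dist.
Qed.

Lemma cvg_Re (T : Type) (F : set_system T) (FF : Filter F) (f : T -> Cplx R) (l : Cplx R) :
  f @ F --> l -> complex.Re (f t) @[t --> F] --> complex.Re l.
Proof.
move/cvg_cplxP => H; apply/cvgrPdist_le => e e0; apply: filterS (H _ e0) => t.
by apply: le_trans; rewrite cmodBC -cReB; exact: cmod_Re.
Qed.

Lemma cvg_Im (T : Type) (F : set_system T) (FF : Filter F) (f : T -> Cplx R) (l : Cplx R) :
  f @ F --> l -> complex.Im (f t) @[t --> F] --> complex.Im l.
Proof.
move/cvg_cplxP => H; apply/cvgrPdist_le => e e0; apply: filterS (H _ e0) => t.
by apply: le_trans; rewrite cmodBC -cImB; exact: cmod_Im.
Qed.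

Lemma cvg_ReIm (T : Type) (F : set_system T) (FF : Filter F) (f : T -> Cplx R) (l : Cplx R) :
  complex.Re (f t) @[t --> F] --> complex.Re l ->
  complex.Im (f t) @[t --> F] --> complex.Im l -> f @ F --> l.
Proof.
move=> /cvgrPdist_le H1 /cvgrPdist_le H2; apply/cvg_cplxP => e e0.
have e2 : 0 < e / 2 by rewrite divr_gt0.
near=> t; apply: le_trans (cmod_ReIm _) _; rewrite [leRHS]splitr.
rewrite cReB cImB lerD// distrC.
  by near: t; exact: H1.
by near: t; exact: H2.
Unshelve. all: by end_near. Qed.

Lemma cvgJ (T : Type) (F : set_system T) (FF : Filter F) (f : T -> Cplx R) (l : Cplx R) :
  f @ F --> l -> (f t)^* @[t --> F] --> l^*.
Proof.
move/cvg_cplxP => H; apply/cvg_cplxP => e e0; apply: filterS (H _ e0) => t.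
by rewrite -rmorphB cmodJ.
Qed.

End Modulus.

(** * Complex derivatives as first-order expansions *)

Section Deriv.
Variable R : realType.
Implicit Types (f g : Cplx R -> Cplx R) (z w d : Cplx R).

(** No division by h occurs, so that an estimate of the remainder can be fed in directly. *)
Definition cderiv f z d := forall e : R, 0 < e -> exists2 de : R, 0 < de &
  forall h, cmod h < de -> cmod (f (z + h) - f z - d * h) <= e * cmod h.

Lemma cderiv_cvg f z d : cderiv f z d ->
  h^-1 *: ((f \o shift z) (h *: (1 : Cplx R)) - f z) @[h --> 0^'] --> d.
Proof.
move=> H; apply/cvg_cplxP => e e0; have [de de0 hde] := H _ e0.
apply/near_cplxP; exists de => // h; rewrite subr0 => /hde hh h0.
have ch : 0 < cmod h by rewrite cmod_gt0.
rewrite -(ler_pM2r ch) -cmodM; apply: le_trans hh.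
rewrite /= [z + h]addrC [h *: 1]mulr1 /GRing.scale/= mulrBl mulrAC mulVf // mul1r.
by rewrite le_eqVlt eqxx.
Qed.

Lemma cderiv_derive1 f z d : cderiv f z d -> derive1 f z = d.
Proof.
move/cderiv_cvg => H; rewrite derive1E; apply: cvg_lim => //.
Qed.

Lemma cderiv_derivable f z d : cderiv f z d -> derivable f z 1.
Proof. by move/cderiv_cvg => H; apply/cvg_ex; exists d. Qed.

Lemma derivable_cderiv f z : derivable f z 1 -> cderiv f z (derive1 f z).
Proof.
move=> /cvg_ex[d H]; rewrite derive1E.
have -> : 'D_1 f z = d by exact: cvg_lim.
move: H => /cvg_cplxP H e e0; have [de de0 hde] := (near_cplxP _ _).1 (H _ e0).
exists de => // h hh.
have [->|h0] := eqVneq h 0; first by rewrite addr0 subrr mulr0 subr0 cmod0 mulr0.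
have := hde h; rewrite subr0 => /(_ hh h0) /=.
have ch : 0 < cmod h by rewrite cmod_gt0.
rewrite -(ler_pM2r ch) -cmodM; apply: le_trans.
rewrite [z + h]addrC [h *: 1]mulr1 /GRing.scale/= mulrBl mulrAC mulVf // mul1r.
by rewrite le_eqVlt eqxx.
Qed.

Lemma derivable_continuous f z : derivable f z 1 -> {for z, continuous f}.
Proof. by move=> /derivable1_diffP/differentiable_continuous. Qed.

End Deriv.

Section Continuity.
Variables (R : realType) (T : topologicalType).
Implicit Types (f g : T -> Cplx R) (x : T).

Lemma cont_cst (c : Cplx R) x : {for x, continuous (fun _ : T => c)}.
Proof. exact: cvg_cst. Qed.
Lemma contD f g x : {for x, continuous f} -> {for x, continuous g} ->
  {for x, continuous (fun t => f t + g t)}.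
Proof. by move=> cf cg; exact: (cvgD cf cg). Qed.
Lemma contB f g x : {for x, continuous f} -> {for x, continuous g} ->
  {for x, continuous (fun t => f t - g t)}.
Proof. by move=> cf cg; exact: (cvgB cf cg). Qed.
Lemma contM f g x : {for x, continuous f} -> {for x, continuous g} ->
  {for x, continuous (fun t => f t * g t)}.
Proof. by move=> cf cg; exact: (cvgM cf cg). Qed.
Lemma contV f x : f x != 0 -> {for x, continuous f} -> {for x, continuous (fun t => (f t)^-1)}.
Proof. by move=> fx cf; exact: (cvgV fx cf). Qed.
Lemma contJ f x : {for x, continuous f} -> {for x, continuous (fun t => (f t)^*)}.
Proof. by move=> cf; apply: cvgJ. Qed.
End Continuity.

(** * Integrals of complex functions over an interval *)

Section RealIntegral.
Variable R : realType.
Notation mu := (@lebesgue_measure R).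
Implicit Types (a b c : R) (g h : R -> R).

(** Boundedness with measurability gives integrability on a compact interval and, unlike
    integrability, survives products; it is the standing side condition of the integrals below. *)
Definition rbm a b g := measurable_fun (`[a, b]%classic : set R) g /\
  exists B, forall t, a <= t <= b -> `|g t| <= B.

Definition rint a b g : R := \int[mu]_(t in `[a, b]) g t.

Lemma rbm_integrable a b g : rbm a b g -> mu.-integrable `[a, b] (EFin \o g).
Proof.
move=> [mg [B hB]]; apply: measurable_bounded_integrable => //.
  by rewrite /= lebesgue_measure_itv/=; case: ifP => _ //; rewrite ltry.
exists B; split; first exact: num_real.
move=> M BM t /=; rewrite in_itv/= => tab; apply: le_trans (ltW BM); exact: hB.
Qed.

Lemma rbmD a b g h : rbm a b g -> rbm a b h -> rbm a b (fun t => g t + h t).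
Proof.
move=> [mg [B hB]] [mh [B' hB']]; split; first exact: measurable_funD.
by exists (B + B') => t tab; apply: le_trans (ler_normD _ _) _; rewrite lerD// ?hB ?hB'.
Qed.

Lemma rbmM a b g h : rbm a b g -> rbm a b h -> rbm a b (fun t => g t * h t).
Proof.
move=> [mg [B hB]] [mh [B' hB']]; split; first exact: measurable_funM.
by exists (B * B') => t tab; rewrite normrM ler_pM// ?hB ?hB'.
Qed.

Lemma rbm_cst a b c : rbm a b (fun=> c).
Proof. by split; [exact: measurable_cst|exists `|c|]. Qed.

Lemma rbmN a b g : rbm a b g -> rbm a b (fun t => - g t).
Proof.
move=> [mg [B hB]]; split; first exact: measurableT_comp.
by exists B => t tab; rewrite normrN hB.
Qed.

Lemma rbm_ext a b g h : (forall t, a <= t <= b -> g t = h t) -> rbm a b g -> rbm a b h.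
Proof.
move=> E [mg [B hB]]; split.
  by apply: eq_measurable_fun mg => t; rewrite inE/= in_itv/= => /E ->.
by exists B => t tab; rewrite -E// hB.
Qed.

Lemma rbm_sub a b a' b' g : a <= a' -> b' <= b -> rbm a b g -> rbm a' b' g.
Proof.
move=> aa bb [mg [B hB]]; split.
  apply: measurable_funS mg => //; apply: subset_itv; rewrite leBSide//.
exists B => t /andP[h1 h2]; apply: hB; rewrite (le_trans aa)//=; exact: le_trans bb.
Qed.

Lemma rbm_sqrt a b g : rbm a b g -> rbm a b (fun t => Num.sqrt (g t)).
Proof.
move=> [mg [B hB]]; split.
  apply: (measurableT_comp _ mg); apply: continuous_measurable_fun; exact: sqrt_continuous.
exists (Num.sqrt B) => t tab; rewrite ger0_norm ?sqrtr_ge0//.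
by rewrite ler_wsqrtr// (le_trans (ler_norm _)) ?hB.
Qed.

Lemma rbm_cont a b g : (forall t, a <= t <= b -> {for t, continuous g}) -> rbm a b g.
Proof.
move=> cg; have W : {within `[a, b], continuous g}.
  by apply: continuous_in_subspaceT => t; rewrite inE/= in_itv/= => /cg.
split; first exact: subspace_continuous_measurable_fun.
have [ab|ba] := leP a b; last first.
  by exists 0 => t /andP[h1 h2]; move: (le_lt_trans (le_trans h1 h2) ba); rewrite ltxx.
have : {within `[a, b], continuous (fun t => `|g t|)}.
  apply: continuous_in_subspaceT => t; rewrite inE/= in_itv/= => /cg cgt.
  by apply: continuous_comp => //; exact: norm_continuous.
move/(EVT_max ab) => [c _ hc]; exists `|g c| => t tab; apply: hc.
by rewrite in_itv.
Qed.

Lemma rbm_cmod a b (g : R -> Cplx R) : rbm a b (fun t => complex.Re (g t)) ->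
  rbm a b (fun t => complex.Im (g t)) -> rbm a b (fun t => cmod (g t)).
Proof.
move=> h1 h2; have : rbm a b (fun t => Num.sqrt (complex.Re (g t) * complex.Re (g t) + complex.Im (g t) * complex.Im (g t))).
  by apply: rbm_sqrt; apply: rbmD; apply: rbmM.
by apply: rbm_ext => t _; rewrite -!expr2 -sqr_cmod sqrtr_sqr ger0_norm ?cmod_ge0.
Qed.

Lemma rint_ext a b g h : (forall t, a <= t <= b -> g t = h t) -> rint a b g = rint a b h.
Proof.
by move=> E; apply: eq_Rintegral => t; rewrite inE/= in_itv/= => /E.
Qed.

Lemma rintD a b g h : rbm a b g -> rbm a b h ->
  rint a b (fun t => g t + h t) = rint a b g + rint a b h.
Proof. by move=> /rbm_integrable ig /rbm_integrable ih; exact: RintegralD. Qed.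

Lemma rintZ a b c g : rbm a b g -> rint a b (fun t => c * g t) = c * rint a b g.
Proof. by move=> /rbm_integrable ig; exact: RintegralZl. Qed.

Lemma rintN a b g : rbm a b g -> rint a b (fun t => - g t) = - rint a b g.
Proof.
move=> h; rewrite -mulN1r -rintZ//; apply: rint_ext => t _; by rewrite mulN1r.
Qed.

Lemma rint_cst a b c : a <= b -> rint a b (fun=> c) = c * (b - a).
Proof.
move=> ab; rewrite /rint Rintegral_cst//; congr (_ * _).
have E : mu `[a, b]%classic = ((b - a)%:E)%E; last by rewrite [X in fine X]E.
rewrite lebesgue_measure_itv/=; case: ifP => h /=; first by rewrite EFinB.
move/negbT: h; rewrite lte_fin -leNgt => ba; have -> : a = b by apply/eqP; rewrite eq_le ab ba.
by rewrite subrr.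
Qed.

Lemma rint_ge0 a b g : (forall t, a <= t <= b -> 0 <= g t) -> 0 <= rint a b g.
Proof. by move=> h; apply: Rintegral_ge0 => t; rewrite /= in_itv/= => /h. Qed.

Lemma rint_le a b g h : rbm a b g -> rbm a b h ->
  (forall t, a <= t <= b -> g t <= h t) -> rint a b g <= rint a b h.
Proof.
move=> ig ih H; rewrite -subr_ge0 -rintN// -rintD//; last exact: rbmN.
by apply: rint_ge0 => t /H; rewrite subr_ge0.
Qed.

Lemma rint_pt a g : rint a a g = 0.
Proof. by rewrite /rint set_itv1 Rintegral_set1. Qed.

Lemma rint_split a b c g : a <= c -> c <= b -> rbm a b g ->
  rint a b g = rint a c g + rint c b g.
Proof.
move=> ac cb ig; have := rbm_integrable ig => ii.
have := Rintegral_itvB ii (x := c); rewrite !bnd_simp => /(_ ac cb) E.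
have -> : rint c b g = \int[mu]_(t in `]c, b]) g t.
  rewrite /rint Rintegral_itv_obnd_cbnd//; apply: integrableS ii => //.
  by apply: subset_itv; rewrite bnd_simp.
by rewrite -E addrC subrK.
Qed.

Lemma rint_FTC a b g G : a <= b -> (forall t, a <= t <= b -> {for t, continuous g}) ->
  (forall t, is_derive t (1:R) G (g t)) -> rint a b g = G b - G a.
Proof.
rewrite le_eqVlt => /predU1P[<-|ab] cg dG; first by rewrite rint_pt subrr.
have cG : continuous G.
  by move=> t; apply: differentiable_continuous; apply/derivable1_diffP; case: (dG t).
rewrite /rint /Rintegral (continuous_FTC2 (F := G) ab) //.
- by apply: continuous_in_subspaceT => t; rewrite inE/= in_itv/= => /cg.
- split; first by move=> t _; case: (dG t).
    by apply: cvg_at_right_filter; exact: cG.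
  by apply: cvg_at_left_filter; exact: cG.
- by move=> t _; rewrite derive1E; case: (dG t).
Qed.

Lemma rint_dct a b (g : nat -> R -> R) B : a <= b -> (forall n, rbm a b (g n)) ->
  (forall n t, a <= t <= b -> `|g n t| <= B) ->
  {ae mu, forall t, a <= t <= b -> g n t @[n --> \oo] --> (0 : R)} ->
  rint a b (g n) @[n --> \oo] --> (0 : R).
Proof.
move=> ab bg hB hae.
have [] := @dominated_convergence _ _ R mu `[a, b] (measurable_itv _) (fun n => EFin \o g n) (cst 0%E) (cst B%:E).
- by move=> n; apply/measurable_EFinP; case: (bg n).
- exact: measurable_cst.
- move: hae; apply: (@filterS _ (almost_everywhere mu)) => t H /=; rewrite in_itv/= => /H.
  by move=> ?; apply: cvg_EFin => //; exact: nearW.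
- by apply: (rbm_integrable (g := cst B)); exact: rbm_cst.
- by apply: aeW => t n /=; rewrite in_itv/= lee_fin => /hB.
move=> _ _; rewrite integral0 => H; have := fine_cvg H; apply.
Qed.

End RealIntegral.

Section ComplexIntegral.
Variable R : realType.
Notation mu := (@lebesgue_measure R).
Implicit Types (a b c : R) (g h : R -> Cplx R).

Definition bm a b g := rbm a b (fun t => complex.Re (g t)) /\ rbm a b (fun t => complex.Im (g t)).

Definition cint a b g : Cplx R :=
  Complex (rint a b (fun t => complex.Re (g t))) (rint a b (fun t => complex.Im (g t))).

Lemma bmD a b g h : bm a b g -> bm a b h -> bm a b (fun t => g t + h t).
Proof.
move=> [g1 g2] [h1 h2]; split.
  by apply: (rbm_ext _ (rbmD g1 h1)) => t _; rewrite cReD.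
by apply: (rbm_ext _ (rbmD g2 h2)) => t _; rewrite cImD.
Qed.

Lemma bmN a b g : bm a b g -> bm a b (fun t => - g t).
Proof.
move=> [g1 g2]; split.
  by apply: (rbm_ext _ (rbmN g1)) => t _; rewrite cReN.
by apply: (rbm_ext _ (rbmN g2)) => t _; rewrite cImN.
Qed.

Lemma bmB a b g h : bm a b g -> bm a b h -> bm a b (fun t => g t - h t).
Proof. by move=> *; apply: bmD => //; exact: bmN. Qed.

Lemma bmJ a b g : bm a b g -> bm a b (fun t => (g t)^*).
Proof.
move=> [g1 g2]; split; first by apply: (rbm_ext _ g1) => t _; rewrite cReJ.
by apply: (rbm_ext _ (rbmN g2)) => t _; rewrite cImJ.
Qed.

Lemma bmM a b g h : bm a b g -> bm a b h -> bm a b (fun t => g t * h t).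
Proof.
move=> [g1 g2] [h1 h2]; split.
  by apply: (rbm_ext _ (rbmD (rbmM g1 h1) (rbmN (rbmM g2 h2)))) => t _; rewrite cReM.
by apply: (rbm_ext _ (rbmD (rbmM g1 h2) (rbmM g2 h1))) => t _; rewrite cImM.
Qed.

Lemma bm_cst a b (c : Cplx R) : bm a b (fun=> c).
Proof. by split; exact: rbm_cst. Qed.

Lemma bm_cont a b g : (forall t, a <= t <= b -> {for t, continuous g}) -> bm a b g.
Proof.
by move=> H; split; apply: rbm_cont => t /H; [apply: cvg_Re|apply: cvg_Im].
Qed.

Lemma bm_ext a b g h : (forall t, a <= t <= b -> g t = h t) -> bm a b g -> bm a b h.
Proof. by move=> E [g1 g2]; split; [apply: (rbm_ext _ g1)|apply: (rbm_ext _ g2)] => t /E ->. Qed.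

Lemma bm_sub a b a' b' g : a <= a' -> b' <= b -> bm a b g -> bm a' b' g.
Proof. by move=> aa bb [g1 g2]; split; [exact: rbm_sub g1|exact: rbm_sub g2]. Qed.

Lemma bm_cmod a b g : bm a b g -> rbm a b (fun t => cmod (g t)).
Proof. by move=> [? ?]; exact: rbm_cmod. Qed.

Lemma bm_bound a b g : bm a b g -> exists2 B : R, 0 < B & forall t, a <= t <= b -> cmod (g t) <= B.
Proof.
move=> /bm_cmod[_ [B hB]]; exists (`|B| + 1); first by rewrite ltr_wpDl.
move=> t /hB h; apply: le_trans (_ : `|B| <= _); last by rewrite lerDl.
by apply: le_trans (ler_norm B); apply: le_trans h; exact: ler_norm.
Qed.

Lemma bm_sum a b (I : Type) (s : seq I) (F : I -> R -> Cplx R) :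
  (forall i, bm a b (F i)) -> bm a b (fun t => \sum_(i <- s) F i t).
Proof.
move=> H; elim: s => [|i s IH]; first by apply: (bm_ext _ (bm_cst a b 0)) => t _; rewrite big_nil.
by apply: (bm_ext _ (bmD (H i) IH)) => t _; rewrite big_cons.
Qed.

Lemma cint_ext a b g h : (forall t, a <= t <= b -> g t = h t) -> cint a b g = cint a b h.
Proof. by move=> E; congr Complex; apply: rint_ext => t /E ->. Qed.

Lemma cintD a b g h : bm a b g -> bm a b h ->
  cint a b (fun t => g t + h t) = cint a b g + cint a b h.
Proof.
move=> [? ?] [? ?]; apply: cplx_eq; rewrite ?cReD ?cImD /= -rintD//; apply: rint_ext => t _.
  by rewrite cReD.
by rewrite cImD.
Qed.

Lemma cintZ a b (c : Cplx R) g : bm a b g -> cint a b (fun t => c * g t) = c * cint a b g.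
Proof.
move=> [g1 g2]; apply: cplx_eq; rewrite ?cReM ?cImM /= -!rintZ//.
  rewrite -rintN -?rintD.
  - by apply: rint_ext => t _; rewrite cReM.
  - exact: rbmM (rbm_cst _ _ _) g1.
  - exact: rbmN (rbmM (rbm_cst _ _ _) g2).
  - exact: rbmM (rbm_cst _ _ _) g2.
rewrite -rintD.
- by apply: rint_ext => t _; rewrite cImM.
- exact: rbmM (rbm_cst _ _ _) g2.
- exact: rbmM (rbm_cst _ _ _) g1.
Qed.

Lemma cintN a b g : bm a b g -> cint a b (fun t => - g t) = - cint a b g.
Proof. by move=> H; rewrite -mulN1r -cintZ//; apply: cint_ext => t _; rewrite mulN1r. Qed.

Lemma cintB a b g h : bm a b g -> bm a b h ->
  cint a b (fun t => g t - h t) = cint a b g - cint a b h.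
Proof. by move=> H1 H2; rewrite cintD ?cintN//; exact: bmN. Qed.

Lemma cintJ a b g : bm a b g -> cint a b (fun t => (g t)^*) = (cint a b g)^*.
Proof.
move=> [? ?]; apply: cplx_eq; rewrite ?cReJ ?cImJ /= -?rintN//; apply: rint_ext => t _.
  by rewrite cReJ.
by rewrite cImJ.
Qed.

Lemma cint_sum a b (I : Type) (s : seq I) (F : I -> R -> Cplx R) :
  (forall i, bm a b (F i)) ->
  cint a b (fun t => \sum_(i <- s) F i t) = \sum_(i <- s) cint a b (F i).
Proof.
move=> H; elim: s => [|i s IH].
  have := cintZ 0 (bm_cst a b 0); rewrite big_nil => H0.
  transitivity (0 * cint a b (fun=> (0 : Cplx R))); last exact: mul0r.
  by rewrite -H0; apply: cint_ext => t _; rewrite big_nil mul0r.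
rewrite big_cons -IH -cintD//; last exact: bm_sum.
by apply: cint_ext => t _; rewrite big_cons.
Qed.

Lemma cint_cst a b (c : Cplx R) : a <= b -> cint a b (fun=> c) = c * (b - a)%:C%C.
Proof.
by move=> ab; apply: cplx_eq; rewrite ?cReM ?cImM /= !rint_cst// ?mulr0 ?subr0 ?add0r.
Qed.

(* Rotating the integral to the positive axis reduces the bound to the real part. *)
Lemma cint_norm a b g : bm a b g -> cmod (cint a b g) <= rint a b (fun t => cmod (g t)).
Proof.
move=> bg; set I := cint a b g.
have [->|I0] := eqVneq I 0; first by rewrite cmod0; apply: rint_ge0 => t _; exact: cmod_ge0.
pose w : Cplx R := (cmod I)%:C%C / I.
have cI : 0 < cmod I by rewrite cmod_gt0.
have w1 : cmod w = 1 by rewrite /w cmodM cmodV cmodC gtr0_norm// divff ?gt_eqF.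
have -> : cmod I = complex.Re (cint a b (fun t => w * g t)).
  by rewrite cintZ// -/I /w divfK.
apply: rint_le; [|exact: bm_cmod|].
  by case: (bmM (bm_cst a b w) bg).
move=> t _; apply: le_trans (ler_norm _) _; apply: le_trans (cmod_Re _) _.
by rewrite cmodM w1 mul1r.
Qed.

Lemma cint_bound a b g (B : R) : a <= b -> bm a b g ->
  (forall t, a <= t <= b -> cmod (g t) <= B) -> cmod (cint a b g) <= B * (b - a).
Proof.
move=> ab bg H; apply: le_trans (cint_norm bg) _; rewrite -rint_cst//.
by apply: rint_le => //; [exact: bm_cmod|exact: rbm_cst].
Qed.

Lemma cint_pt a g : cint a a g = 0.
Proof. by rewrite /cint !rint_pt. Qed.

Lemma cint_split a b c g : a <= c -> c <= b -> bm a b g ->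
  cint a b g = cint a c g + cint c b g.
Proof. by move=> ac cb [? ?]; apply: cplx_eq; rewrite ?cReD ?cImD /=; exact: rint_split. Qed.

Lemma cint_FTC a b g G : a <= b -> (forall t, a <= t <= b -> {for t, continuous g}) ->
  (forall t, is_derive t (1:R) (fun t => complex.Re (G t)) (complex.Re (g t))) ->
  (forall t, is_derive t (1:R) (fun t => complex.Im (G t)) (complex.Im (g t))) ->
  cint a b g = G b - G a.
Proof.
move=> ab cg d1 d2; apply: cplx_eq; rewrite ?cReB ?cImB /=.
  by rewrite (rint_FTC ab _ d1)// => t /cg; exact: cvg_Re.
by rewrite (rint_FTC ab _ d2)// => t /cg; exact: cvg_Im.
Qed.

Lemma cint_dct0 a b (g : nat -> R -> Cplx R) B : a <= b -> (forall n, bm a b (g n)) ->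
  (forall n t, a <= t <= b -> cmod (g n t) <= B) ->
  {ae mu, forall t, a <= t <= b -> cmod (g n t) @[n --> \oo] --> (0 : R)} ->
  cint a b (g n) @[n --> \oo] --> (0 : Cplx R).
Proof.
move=> ab bg hB hae.
have H : rint a b (fun t => cmod (g n t)) @[n --> \oo] --> (0 : R).
  apply: (rint_dct (B := B) ab) => [n|n t /hB h|//]; first exact: bm_cmod.
  by rewrite ger0_norm ?cmod_ge0.
apply/cvg_cplxP => e e0; move/cvgrPdist_le: H => /(_ _ e0); apply: filterS => n.
rewrite sub0r normrN subr0; apply: le_trans; apply: le_trans (ler_norm _).
exact: cint_norm.
Qed.

End ComplexIntegral.

(** * Polar coordinates *)

Section Polar.
Variable R : realType.
Implicit Types (r t : R).

Lemma polarE r t : polar r t = r%:C%C * polar 1 t.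
Proof. by apply: cplx_eq; rewrite ?cReM ?cImM/= !mul1r mul0r ?subr0 ?addr0. Qed.
Lemma cmod_polar1 t : cmod (polar 1 t) = 1.
Proof. by rewrite /cmod/= !mul1r addrC sin2cos2 subrK sqrtr1. Qed.
Lemma cmod_polar r t : cmod (polar r t) = `|r|.
Proof. by rewrite polarE cmodM cmod_polar1 mulr1 cmodC. Qed.
Lemma polar_cont_t r t : {for t, continuous (polar r)}.
Proof.
apply: cvg_ReIm => /=.
  by apply: cvgM; [exact: cvg_cst|exact: continuous_cos].
by apply: cvgM; [exact: cvg_cst|exact: continuous_sin].
Qed.
Lemma polar_cont_r r t : {for r, continuous (fun r => polar r t)}.
Proof.
by apply: cvg_ReIm => /=; apply: cvgM => //; exact: cvg_cst.
Qed.
Lemma polar_2pi r : polar r (2 * pi) = polar r 0.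
Proof. by rewrite /polar mulr_natl cos2pi sin2pi cos0 sin0. Qed.
Lemma polar_periodic r t : polar r (t + 2 * pi) = polar r t.
Proof.
rewrite /polar; have -> : 2 * pi = pi *+ 2 :> R by rewrite mulr_natl.
by rewrite cosD sinD cos2pi sin2pi !mulr0 !mulr1 subr0 addr0.
Qed.
Lemma polarD t s : polar 1 (t + s) = polar 1 t * polar 1 s :> Cplx R.
Proof. by apply: cplx_eq; rewrite ?cReM ?cImM/= !mul1r ?cosD ?sinD // addrC. Qed.
Lemma polarJ r t : (polar r t)^* = polar r (- t) :> Cplx R.
Proof. by apply: cplx_eq; rewrite ?cReJ ?cImJ/= ?cosN ?sinN ?mulrN. Qed.
Lemma polar1_neq0 t : polar 1 t != 0 :> Cplx R.
Proof. by rewrite -cmod_gt0 cmod_polar1. Qed.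
Lemma polarJV r t : (polar r t)^* = (r ^+ 2)%:C%C / polar r t :> Cplx R.
Proof.
have [->|r0] := eqVneq r 0; first by rewrite polarE mul0r rmorph0 expr0n mul0r.
have p0 : polar r t != 0 by rewrite -cmod_gt0 cmod_polar normr_gt0.
by apply: (mulfI p0); rewrite mulrCA divff// mulr1 mulJ_cmod cmod_polar real_normK ?num_real.
Qed.
Lemma polar_dist r s t : cmod (polar r t - polar s t) = `|r - s|.
Proof. by rewrite polarE [polar s t]polarE -mulrBl -rmorphB cmodM cmodC cmod_polar1 mulr1. Qed.
End Polar.

(** * Goursat on polar rectangles *)

Section RectInduction.
Variable R : realType.

(** Bisection: if the property failed, one quarter would fail at each stage, and the nested bad
    rectangles would shrink to a point where the local hypothesis contradicts them. That hypothesis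
    only concerns rectangles with sides (b - a) / 2^k and (d - c) / 2^k: their fixed proportions
    make the square of the perimeter comparable to the area, as Goursat's argument requires. *)
Lemma rect_induction (P : R -> R -> R -> R -> Prop) (a b c d : R) : a <= b -> c <= d ->
  (forall r1 r2 t1 t2, a <= r1 -> r1 <= r2 -> r2 <= b -> c <= t1 -> t1 <= t2 -> t2 <= d ->
    P r1 ((r1 + r2) / 2) t1 ((t1 + t2) / 2) -> P ((r1 + r2) / 2) r2 t1 ((t1 + t2) / 2) ->
    P r1 ((r1 + r2) / 2) ((t1 + t2) / 2) t2 -> P ((r1 + r2) / 2) r2 ((t1 + t2) / 2) t2 ->
    P r1 r2 t1 t2) ->
  (forall r0 t0, a <= r0 <= b -> c <= t0 <= d -> exists2 de : R, 0 < de &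
    forall k r t, let L := (b - a) / 2 ^+ k in let M := (d - c) / 2 ^+ k in
      a <= r -> r <= r0 -> r0 <= r + L -> r + L <= b ->
      c <= t -> t <= t0 -> t0 <= t + M -> t + M <= d -> L < de -> M < de ->
      P r (r + L) t (t + M)) ->
  P a b c d.
Proof.
move=> ab cd split loc; apply: contrapT => nP.
pose L k := (b - a) / 2 ^+ k; pose M k := (d - c) / 2 ^+ k.
have L0 k : 0 <= L k by rewrite divr_ge0 ?subr_ge0// exprn_ge0.
have M0 k : 0 <= M k by rewrite divr_ge0 ?subr_ge0// exprn_ge0.
have LS k : L k = L k.+1 + L k.+1.
  by rewrite /L exprS; field; rewrite expf_neq0// pnatr_eq0.
have MS k : M k = M k.+1 + M k.+1.
  by rewrite /M exprS; field; rewrite expf_neq0// pnatr_eq0.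
pose bad k (p : R * R) := [/\ a <= p.1, p.1 + L k <= b, c <= p.2, p.2 + M k <= d &
  ~ P p.1 (p.1 + L k) p.2 (p.2 + M k)].
have step (x : nat * (R * R)) : exists q, bad x.1 x.2 ->
    bad x.1.+1 q /\ [/\ x.2.1 <= q.1, x.2.2 <= q.2, q.1 + L x.1.+1 <= x.2.1 + L x.1 &
      q.2 + M x.1.+1 <= x.2.2 + M x.1].
  case: x => k [r t] /=; have [B|nB] := pselect (bad k (r, t)); last by exists (0, 0).
  case: B => /= ar rb ct td nPk.
  have Lk := LS k; have Mk := MS k; have l0 := L0 k.+1; have m0 := M0 k.+1.
  have E1 : (r + (r + L k)) / 2 = r + L k.+1 by rewrite Lk; lra.
  have E2 : (t + (t + M k)) / 2 = t + M k.+1 by rewrite Mk; lra.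
  have F1 : r + L k = r + L k.+1 + L k.+1 by rewrite Lk addrA.
  have F2 : t + M k = t + M k.+1 + M k.+1 by rewrite Mk addrA.
  apply: contrapT => nq; apply: nPk; apply: split; rewrite ?E1 ?E2 ?lerDl//.
  - apply: contrapT => nPq; apply: nq; exists (r, t) => _; split; split => //=; lra.
  - rewrite F1; apply: contrapT => nPq; apply: nq; exists (r + L k.+1, t) => _.
    by split; split => //=; lra.
  - rewrite F2; apply: contrapT => nPq; apply: nq; exists (r, t + M k.+1) => _.
    by split; split => //=; lra.
  - rewrite F1 F2; apply: contrapT => nPq; apply: nq; exists (r + L k.+1, t + M k.+1) => _.
    by split; split => //=; lra.
have [nx hnx] := choice step.
pose s := fix s k := if k is k'.+1 then nx (k', s k') else (a, c).
have bs k : bad k (s k).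
  elim: k => [|k IH]; last by case: (hnx (k, s k) IH).
  by split; rewrite /= ?/L ?/M ?expr0 ?divr1 ?[a + _]addrC ?[c + _]addrC ?subrK.
have ss k := (hnx (k, s k) (bs k)).2.
(* Nested intervals in one variable, with the supremum of the left ends as common point. *)
have nest (u l : nat -> R) : (forall k, u k <= u k.+1) -> (forall k, 0 <= l k) ->
    (forall k, u k.+1 + l k.+1 <= u k + l k) -> exists x, forall k, u k <= x <= u k + l k.
  move=> iu l0 hu.
  have mon k j : (k <= j)%N -> u k <= u j.
    by move=> /subnK <-; elim: (j - k)%N => // n IH; rewrite addSn; exact: le_trans (iu _).
  have mon' k j : (k <= j)%N -> u j + l j <= u k + l k.
    by move=> /subnK <-; elim: (j - k)%N => // n IH; rewrite addSn; exact: le_trans (hu _) _.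
  have hub k j : u j <= u k + l k.
    have [kj|jk] := leqP k j; first by apply: le_trans (mon' _ _ kj); rewrite lerDl.
    by apply: le_trans (mon _ _ (ltnW jk)) _; rewrite lerDl.
  have hs : has_sup (range u).
    split; first by exists (u 0%N), 0%N.
    by exists (u 0%N + l 0%N) => _ [k _ <-].
  exists (sup (range u)) => k; apply/andP; split; first by apply: sup_upper_bound => //; exists k.
  by apply: sup_le_ub => [|_ [j _ <-]]; [exists (u 0%N), 0%N|].
have [r0 hr0] : exists x, forall k, (s k).1 <= x <= (s k).1 + L k.
  by apply: nest => // k; case: (ss k).
have [t0 ht0] : exists x, forall k, (s k).2 <= x <= (s k).2 + M k.
  by apply: nest => // k; case: (ss k).
have [] := loc r0 t0.
- by have := hr0 0%N; have := bs 0%N; case => /= *; lra.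
- by have := ht0 0%N; have := bs 0%N; case => /= *; lra.
move=> de de0 hde.
(* [S] dominates both sides, so one k makes both shorter than [de]; the summand 1 keeps it positive
   for a degenerate rectangle. *)
pose S := (b - a) + (d - c) + 1.
have S0 : 0 < S by rewrite /S; move: ab cd; lra.
have [k hk] : exists k : nat, S / de < 2 ^+ k.
  have /archi_boundP : 0 <= S / de by rewrite divr_ge0// ltW.
  set n := Num.bound _ => hn; exists n; apply: lt_trans hn _.
  by rewrite -natrX ltr_nat ltn_expl.
have p0 : (0 : R) < 2 ^+ k by rewrite exprn_gt0.
have hk2 : S < de * 2 ^+ k by rewrite mulrC -ltr_pdivrMr.
have [h1 h2 h3 h4] := bs k; apply.
have /andP[r1 r2] := hr0 k; have /andP[t1 t2] := ht0 k.
by apply: hde => //; rewrite ltr_pdivrMr//; apply: le_lt_trans hk2; rewrite /S; lra.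
Qed.
End RectInduction.

(** * Derivatives and Lipschitz bounds of polar paths *)

Section PathDerivative.
Variable R : realType.
Implicit Types (F G : R -> Cplx R) (t r : R).

Definition cder F t (d : Cplx R) :=
  is_derive t (1 : R) (fun t => complex.Re (F t)) (complex.Re d) /\
  is_derive t (1 : R) (fun t => complex.Im (F t)) (complex.Im d).

Lemma cder_cst (c : Cplx R) t : cder (fun=> c) t 0.
Proof. by split; exact: is_derive_cst. Qed.

Lemma cderD F G t dF dG : cder F t dF -> cder G t dG -> cder (fun t => F t + G t) t (dF + dG).
Proof.
move=> [F1 F2] [G1 G2]; split.
  have -> : (fun t => complex.Re (F t + G t)) = (fun t => complex.Re (F t)) + (fun t => complex.Re (G t)).
    by apply/funext => s; rewrite cReD.
  by rewrite cReD; exact: is_deriveD.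
have -> : (fun t => complex.Im (F t + G t)) = (fun t => complex.Im (F t)) + (fun t => complex.Im (G t)).
  by apply/funext => s; rewrite cImD.
by rewrite cImD; exact: is_deriveD.
Qed.

Lemma cderM F G t dF dG : cder F t dF -> cder G t dG ->
  cder (fun t => F t * G t) t (F t * dG + G t * dF).
Proof.
move=> [F1 F2] [G1 G2]; split.
  have -> : (fun t => complex.Re (F t * G t)) = (fun t => complex.Re (F t)) * (fun t => complex.Re (G t)) -
      (fun t => complex.Im (F t)) * (fun t => complex.Im (G t)).
    by apply/funext => s; rewrite cReM.
  apply: is_derive_eq (is_deriveB (is_deriveM F1 G1) (is_deriveM F2 G2)) _.
  by rewrite cReD !cReM /GRing.scale/=; ring.
have -> : (fun t => complex.Im (F t * G t)) = (fun t => complex.Re (F t)) * (fun t => complex.Im (G t)) +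
      (fun t => complex.Im (F t)) * (fun t => complex.Re (G t)).
  by apply/funext => s; rewrite cImM.
apply: is_derive_eq (is_deriveD (is_deriveM F1 G2) (is_deriveM F2 G1)) _.
by rewrite cImD !cImM /GRing.scale/=; ring.
Qed.

Definition ci : Cplx R := Complex 0 1.

Lemma cmod_ci : cmod ci = 1.
Proof. by rewrite /cmod/= expr0n expr1n add0r sqrtr1. Qed.

Lemma cder_polar r t : cder (polar r) t (ci * polar r t).
Proof.
split; rewrite ?cReM ?cImM /=.
  apply: is_derive_eq (is_deriveM (is_derive_cst r t (1:R)) (is_derive_cos t)) _.
  by rewrite /GRing.scale/=; ring.
apply: is_derive_eq (is_deriveM (is_derive_cst r t (1:R)) (is_derive_sin t)) _.
by rewrite /GRing.scale/=; ring.
Qed.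

Lemma cder_polar_r r t : cder (fun r => polar r t) r (polar 1 t).
Proof.
split; rewrite /=.
  apply: is_derive_eq (is_deriveM (is_derive_id r (1:R)) (is_derive_cst (cos t) r (1:R))) _.
  by rewrite /GRing.scale/=; ring.
apply: is_derive_eq (is_deriveM (is_derive_id r (1:R)) (is_derive_cst (sin t) r (1:R))) _.
by rewrite /GRing.scale/=; ring.
Qed.

Lemma cder_cint (a b : R) g G : a <= b -> (forall t, a <= t <= b -> {for t, continuous g}) ->
  (forall t, cder G t (g t)) -> cint a b g = G b - G a.
Proof. by move=> ab cg dG; apply: cint_FTC => // t; case: (dG t). Qed.

Lemma cder_linear F t dF (al be : Cplx R) : cder F t dF ->
  cder (fun t => al * F t + be / 2 * (F t * F t)) t ((al + be * F t) * dF).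
Proof.
move=> dF'; have H := cderD (cderM (cder_cst al t) dF') (cderM (cder_cst (be / 2) t) (cderM dF' dF')).
rewrite [X in cder _ _ X](_ : _ = al * dF + F t * 0 + (be / 2 * (F t * dF + F t * dF) + F t * F t * 0)) //.
by field.
Qed.

Lemma polar_lip (r s t : R) : s <= t -> cmod (polar r t - polar r s) <= `|r| * (t - s).
Proof.
move=> st; have -> : polar r t - polar r s = cint s t (fun t => ci * polar r t).
  apply/esym; apply: (@cder_cint s t _ (polar r) st) => x; last exact: cder_polar.
  move=> _; apply: cvgM; [exact: cvg_cst|exact: polar_cont_t].
apply: cint_bound => //.
  by apply: bm_cont => x _; apply: cvgM; [exact: cvg_cst|exact: polar_cont_t].
by move=> x _; rewrite cmodM cmod_ci mul1r cmod_polar.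
Qed.

Lemma polar_lip2 (r s t q : R) : cmod (polar r t - polar q s) <= `|r| * `|t - s| + `|r - q|.
Proof.
have -> : polar r t - polar q s = (polar r t - polar r s) + (polar r s - polar q s).
  by rewrite addrA subrK.
apply: le_trans (cmodD _ _) _; rewrite polar_dist lerD2r.
have [h|/ltW h] := leP s t.
  by rewrite (ger0_norm (_ : 0 <= t - s)) ?subr_ge0//; exact: polar_lip.
by rewrite cmodBC distrC (ger0_norm (_ : 0 <= s - t)) ?subr_ge0//; exact: polar_lip.
Qed.

End PathDerivative.

(** * Contour integrals over polar rectangles and Goursat's theorem *)

Section Box.
Variable R : realType.
Implicit Types (f g : Cplx R -> Cplx R) (r t a b c d : R).

(** Integrals of f dz: dz is [ci R * polar r t] dt on an arc and [polar 1 t] dr on a ray. [box] is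
    the counterclockwise integral around the polar rectangle, whose angular range may be a full
    turn. *)
Definition arc f r t1 t2 := cint t1 t2 (fun t => f (polar r t) * (ci R * polar r t)).
Definition ray f t r1 r2 := cint r1 r2 (fun r => f (polar r t) * polar 1 t).
Definition box f r1 r2 t1 t2 :=
  arc f r2 t1 t2 - arc f r1 t1 t2 - (ray f t2 r1 r2 - ray f t1 r1 r2).

Lemma linear_continuous (al be z : Cplx R) : {for z, continuous (fun z : Cplx R => al + be * z)}.
Proof.
apply: derivable_continuous; apply: (@cderiv_derivable _ _ _ be) => e e0; exists 1 => // h _.
rewrite (_ : _ - _ = 0) ?cmod0 ?mulr_ge0 ?cmod_ge0 ?(ltW e0)//; ring.
Qed.

Lemma cont_arc f r t : {for polar r t, continuous f} -> {for t, continuous (fun t => f (polar r t))}.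
Proof. by move=> H; exact: (cvg_comp (polar r) f (@polar_cont_t R r t) H). Qed.
Lemma cont_ray f r t : {for polar r t, continuous f} -> {for r, continuous (fun r => f (polar r t))}.
Proof. by move=> H; exact: (cvg_comp (fun r => polar r t) f (@polar_cont_r R r t) H). Qed.

Lemma bm_arc f r t1 t2 : (forall t, t1 <= t <= t2 -> {for polar r t, continuous f}) ->
  bm t1 t2 (fun t => f (polar r t) * (ci R * polar r t)).
Proof.
move=> H; apply: bm_cont => t /H h; apply: cvgM; first exact: cont_arc.
by apply: cvgM; [exact: cvg_cst|exact: polar_cont_t].
Qed.
Lemma bm_ray f t r1 r2 : (forall r, r1 <= r <= r2 -> {for polar r t, continuous f}) ->
  bm r1 r2 (fun r => f (polar r t) * polar 1 t).
Proof.
move=> H; apply: bm_cont => r /H h; apply: cvgM; first exact: cont_ray.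
exact: cvg_cst.
Qed.

Definition ctn f a b c d := forall r t, a <= r <= b -> c <= t <= d -> {for polar r t, continuous f}.

Lemma box_linear (al be : Cplx R) r1 r2 t1 t2 : r1 <= r2 -> t1 <= t2 ->
  box (fun z => al + be * z) r1 r2 t1 t2 = 0.
Proof.
move=> r12 t12; pose L z : Cplx R := al * z + be / 2 * (z * z).
have A r : arc (fun z => al + be * z) r t1 t2 = L (polar r t2) - L (polar r t1).
  apply: (@cder_cint _ _ _ _ (fun t => L (polar r t)) t12) => t.
    move=> _; apply: cvgM; last by apply: cvgM; [exact: cvg_cst|exact: polar_cont_t].
    by apply: cvgD; [exact: cvg_cst|apply: cvgM; [exact: cvg_cst|exact: polar_cont_t]].
  exact: cder_linear (cder_polar r t).
have B t : ray (fun z => al + be * z) t r1 r2 = L (polar r2 t) - L (polar r1 t).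
  apply: (@cder_cint _ _ _ _ (fun r => L (polar r t)) r12) => r.
    move=> _; apply: cvgM; last exact: cvg_cst.
    by apply: cvgD; [exact: cvg_cst|apply: cvgM; [exact: cvg_cst|exact: polar_cont_r]].
  exact: cder_linear (cder_polar_r r t).
by rewrite /box !A !B; ring.
Qed.

Lemma boxB f g r1 r2 t1 t2 : r1 <= r2 -> t1 <= t2 -> ctn f r1 r2 t1 t2 -> ctn g r1 r2 t1 t2 ->
  box (fun z => f z - g z) r1 r2 t1 t2 = box f r1 r2 t1 t2 - box g r1 r2 t1 t2.
Proof.
move=> r12 t12 cf cg.
have A r : r1 <= r <= r2 -> arc (fun z => f z - g z) r t1 t2 = arc f r t1 t2 - arc g r t1 t2.
  move=> hr; rewrite /arc -cintB; try by apply: bm_arc => t ht; [exact: cf|exact: cg].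
  - by apply: cint_ext => t _; rewrite mulrBl.
  - by apply: bm_arc => t ht; exact: cf.
  - by apply: bm_arc => t ht; exact: cg.
have B t : t1 <= t <= t2 -> ray (fun z => f z - g z) t r1 r2 = ray f t r1 r2 - ray g t r1 r2.
  move=> ht; rewrite /ray -cintB.
  - by apply: cint_ext => r _; rewrite mulrBl.
  - by apply: bm_ray => r hr; exact: cf.
  - by apply: bm_ray => r hr; exact: cg.
rewrite /box !A ?B ?lexx ?r12 ?t12//; ring.
Qed.

Lemma box_split_r f r1 m r2 t1 t2 : r1 <= m -> m <= r2 -> t1 <= t2 -> ctn f r1 r2 t1 t2 ->
  box f r1 r2 t1 t2 = box f r1 m t1 t2 + box f m r2 t1 t2.
Proof.
move=> h1 h2 h3 cf.
have B t : t1 <= t <= t2 -> ray f t r1 r2 = ray f t r1 m + ray f t m r2.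
  by move=> ht; apply: cint_split => //; apply: bm_ray => r hr; exact: cf.
by rewrite /box !B ?lexx ?h3//; ring.
Qed.

Lemma box_split_t f r1 r2 t1 m t2 : t1 <= m -> m <= t2 -> r1 <= r2 -> ctn f r1 r2 t1 t2 ->
  box f r1 r2 t1 t2 = box f r1 r2 t1 m + box f r1 r2 m t2.
Proof.
move=> h1 h2 h3 cf.
have B r : r1 <= r <= r2 -> arc f r t1 t2 = arc f r t1 m + arc f r m t2.
  by move=> hr; apply: cint_split => //; apply: bm_arc => t ht; exact: cf.
by rewrite /box !B ?lexx ?h3//; ring.
Qed.

Lemma ctn_sub f a b c d a' b' c' d' : a <= a' -> b' <= b -> c <= c' -> d' <= d ->
  ctn f a b c d -> ctn f a' b' c' d'.
Proof.
move=> ? ? ? ? H r t /andP[? ?] /andP[? ?]; apply: H; apply/andP; split; lra.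
Qed.

Lemma box_bound f r1 r2 t1 t2 (e K : R) : r1 <= r2 -> t1 <= t2 -> ctn f r1 r2 t1 t2 ->
  (forall r, r1 <= r <= r2 -> `|r| <= K) ->
  (forall r t, r1 <= r <= r2 -> t1 <= t <= t2 -> cmod (f (polar r t)) <= e) ->
  cmod (box f r1 r2 t1 t2) <= 2 * (e * (K * (t2 - t1) + (r2 - r1))).
Proof.
move=> r12 t12 cf hK he.
have A r : r1 <= r <= r2 -> cmod (arc f r t1 t2) <= e * K * (t2 - t1).
  move=> hr; apply: cint_bound => //; first by apply: bm_arc => t ht; exact: cf.
  move=> t ht; rewrite !cmodM cmod_ci mul1r cmod_polar ler_pM// ?cmod_ge0//; first exact: he.
  exact: hK.
have B t : t1 <= t <= t2 -> cmod (ray f t r1 r2) <= e * (r2 - r1).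
  move=> ht; apply: cint_bound => //; first by apply: bm_ray => r hr; exact: cf.
  by move=> r hr; rewrite !cmodM cmod_polar1 mulr1; exact: he.
have H : cmod (box f r1 r2 t1 t2) <= cmod (arc f r2 t1 t2) + cmod (arc f r1 t1 t2) +
    (cmod (ray f t2 r1 r2) + cmod (ray f t1 r1 r2)).
  by apply: le_trans (cmodB _ _) _; rewrite lerD// cmodB.
apply: le_trans H _.
have := A r2; have := A r1; have := B t1; have := B t2.
rewrite !lexx r12 t12 /= => /(_ isT) h1 /(_ isT) h2 /(_ isT) h3 /(_ isT) h4.
move: h1 h2 h3 h4; set x := e * K * _; set y := e * _; rewrite mulrDr mulrA -/x -/y => h1 h2 h3 h4.
by apply: le_trans (lerD (lerD h4 h3) (lerD h1 h2)) _; rewrite -!mulr2n mulr_natl mulrnDl.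
Qed.

(** Near a point f is affine up to a small multiple of the distance. The affine part integrates to
    0, and the remainder contributes at most that multiple of diameter times perimeter, which on
    dyadic rectangles is proportional to the area; areas add up under quartering. Degenerate
    rectangles are settled first, as the bound is relative to the total area. *)
Lemma goursat f a b c d : a <= b -> c <= d ->
  (forall r t, a <= r <= b -> c <= t <= d -> derivable f (polar r t) 1) -> box f a b c d = 0.
Proof.
move=> ab cd df.
have cf : ctn f a b c d by move=> r t hr ht; apply: derivable_continuous; exact: df.
move: ab cd; rewrite le_eqVlt => /predU1P[<-|ab] cd.
  by rewrite /box /ray !cint_pt !subrr.
move: cd; rewrite le_eqVlt => /predU1P[<-|cd].
  by rewrite /box /arc !cint_pt !subrr.
pose K := `|a| + `|b| + 1.
have K1 : 1 <= K by rewrite /K lerDr addr_ge0.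
have hK r : a <= r <= b -> `|r| <= K.
  move=> /andP[h1 h2]; rewrite ler_norml; apply/andP; rewrite /K.
  by split; [move: (ler_norm (- a)); rewrite normrN|move: (ler_norm b)]; move: (normr_ge0 a) (normr_ge0 b); lra.
suff H e : 0 < e -> cmod (box f a b c d) <= e * ((b - a) * (d - c)).
  apply/eqP; rewrite -cmod_eq0 eq_le cmod_ge0 andbT.
  apply/ler_addgt0Pl => e e0; rewrite addr0.
  have p0 : 0 < (b - a) * (d - c) by rewrite mulr_gt0 ?subr_gt0.
  by apply: le_trans (H (e / ((b - a) * (d - c))) _) _; rewrite ?divr_gt0// divfK ?gt_eqF.
move=> e0; apply: (@rect_induction R (fun r1 r2 t1 t2 =>
  cmod (box f r1 r2 t1 t2) <= e * ((r2 - r1) * (t2 - t1)))); rewrite ?ltW//.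
  move=> r1 r2 t1 t2 h1 h2 h3 h4 h5 h6.
  set m := (r1 + r2) / 2; set n := (t1 + t2) / 2.
  have m1 : r1 <= m by rewrite /m; lra.
  have m2 : m <= r2 by rewrite /m; lra.
  have n1 : t1 <= n by rewrite /n; lra.
  have n2 : n <= t2 by rewrite /n; lra.
  move=> H1 H2 H3 H4.
  rewrite (@box_split_r f r1 m r2)//; last by apply: ctn_sub cf.
  rewrite (@box_split_t f r1 m t1 n t2)//; last exact: (ctn_sub h1 (le_trans m2 h3) h4 h6 cf).
  rewrite (@box_split_t f m r2 t1 n t2)//; last exact: (ctn_sub (le_trans h1 m1) h3 h4 h6 cf).
  apply: le_trans (cmodD _ _) _; apply: le_trans (lerD (cmodD _ _) (cmodD _ _)) _.
  apply: le_trans (lerD (lerD H1 H3) (lerD H2 H4)) _.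
  by rewrite le_eqVlt; apply/orP; left; apply/eqP; ring.
move=> r0 t0 hr0 ht0.
pose S := K * (d - c) + (b - a).
have S0 : 0 < S by rewrite /S addr_gt0// ?mulr_gt0 ?subr_gt0//; lra.
pose A := (b - a) * (d - c).
have A0 : 0 < A by rewrite mulr_gt0 ?subr_gt0.
(* With K M + L = S / 2^k and L M = A / 4^k, this value makes 2 e' (K M + L)^2 equal to e L M. *)
pose e' := e * A / (2 * S ^+ 2).
have e'0 : 0 < e' by apply: divr_gt0; [exact: mulr_gt0|apply: mulr_gt0 => //; exact: exprn_gt0].
have [de de0 hde] := derivable_cderiv (df _ _ hr0 ht0) e'0.
(* Two points of a rectangle with radial side L and angular side M are within K M + L <= (K + 1)
   max(L, M) of each other. *)
exists (de / (K + 1)); first by rewrite divr_gt0//; lra.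
move=> k r t L M ar rr0 r0r rb ct tt0 t0t td; rewrite !ltr_pdivlMr; try lra.
move=> hL hM.
set P0 := polar r0 t0 in hde *; set D := derive1 f P0 in hde.
have L0 : 0 <= L by lra.
have M0 : 0 <= M by lra.
have E : box f r (r + L) t (t + M) =
    box (fun z => f z - ((f P0 - D * P0) + D * z)) r (r + L) t (t + M).
  rewrite (@boxB f (fun z => (f P0 - D * P0) + D * z)) ?box_linear ?subr0 ?lerDl//.
  - exact: (ctn_sub ar rb ct td cf).
  - by move=> x y _ _; exact: linear_continuous.
have SE : K * M + L = S / 2 ^+ k by rewrite /S /L /M [RHS]mulrDl mulrA.
rewrite E; apply: le_trans (@box_bound _ _ _ _ _ (e' * (K * M + L)) K _ _ _ _ _) _.
- by rewrite lerDl.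
- by rewrite lerDl.
- apply: (ctn_sub ar rb ct td) => x y hx hy.
  apply: contB; first exact: cf.
  exact: linear_continuous.
- by move=> x /andP[hx1 hx2]; apply: hK; rewrite (le_trans ar hx1) (le_trans hx2 rb).
- move=> x y /andP[hx1 hx2] /andP[hy1 hy2]; set z := polar x y.
  have hz : cmod (z - P0) <= K * M + L.
    have nr (u v w l : R) : u <= v -> v <= u + l -> u <= w -> w <= u + l -> `|w - v| <= l.
      by clear => *; rewrite ler_norml; apply/andP; split; lra.
    apply: le_trans (polar_lip2 _ _ _ _) _; apply: lerD; last exact: (nr r).
    apply: ler_pM => //; last exact: (nr t).
    by apply: hK; rewrite (le_trans ar hx1) (le_trans hx2 rb).
  have -> : f z - (f P0 - D * P0 + D * z) = f (P0 + (z - P0)) - f P0 - D * (z - P0).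
    by rewrite [P0 + _]addrC subrK; ring.
  apply: le_trans (hde _ _) _; last by rewrite ler_pM2l.
  apply: le_lt_trans hz _.
  rewrite mulrDr mulr1 [L * K]mulrC in hL; rewrite mulrDr mulr1 [M * K]mulrC in hM.
  have [LM|/ltW ML] := leP L M; first by apply: le_lt_trans hM; rewrite lerD2l.
  apply: le_lt_trans hL; rewrite lerD2r ler_pM2l//; lra.
rewrite ![_ + _ - _]addrAC !subrr !add0r SE.
rewrite le_eqVlt; apply/orP; left; apply/eqP; rewrite /e' /L /M /A.
have S1 : S != 0 by rewrite gt_eqF.
have k1 : (2 : R) ^+ k != 0 by rewrite expf_neq0// pnatr_eq0.
by field; rewrite ?S1 ?k1.
Qed.
End Box.

(** * Limits of boxes and an exceptional circle *)

Section Exceptional.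
Variable R : realType.
Implicit Types (f g : Cplx R -> Cplx R) (r t a b c d : R).

Lemma cont_cplxP f z : {for z, continuous f} <->
  forall e : R, 0 < e -> exists2 de : R, 0 < de & forall w, cmod (w - z) < de -> cmod (f w - f z) <= e.
Proof.
split => [/cvg_cplxP H e e0|H]; first exact: (near_cplxP z _).1 (H e e0).
apply: (cvg_cplxP (nbhs_filter z) f (f z)).2 => e e0; exact: (near_cplxP z _).2 (H e e0).
Qed.

Lemma cplx_sub_cvg0 (T : Type) (F : set_system T) (FF : Filter F) (h : T -> Cplx R) (l : Cplx R) :
  (h t - l) @[t --> F] --> (0 : Cplx R) -> h @ F --> l.
Proof.
move/cvg_cplxP => H; apply/cvg_cplxP => e e0; apply: filterS (H _ e0) => t.
by rewrite subr0.
Qed.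

Lemma ccvgB (T : Type) (F : set_system T) (FF : Filter F) (h k : T -> Cplx R) (l m : Cplx R) :
  h @ F --> l -> k @ F --> m -> (h t - k t) @[t --> F] --> (l - m).
Proof. by move=> H K; exact: (cvgB H K). Qed.

(** Bisection plays the role of compactness: local bounds combine through the maximum over the four
    quarters. *)
Lemma ctn_bounded f a b c d : a <= b -> c <= d -> ctn f a b c d ->
  exists B : R, forall r t, a <= r <= b -> c <= t <= d -> cmod (f (polar r t)) <= B.
Proof.
move=> ab cd cf.
apply: (@rect_induction R (fun r1 r2 t1 t2 => exists B : R,
  forall r t, r1 <= r <= r2 -> t1 <= t <= t2 -> cmod (f (polar r t)) <= B)) => //.
  move=> r1 r2 t1 t2 _ _ _ _ _ _ [B1 h1] [B2 h2] [B3 h3] [B4 h4].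
  exists (Num.max (Num.max B1 B2) (Num.max B3 B4)) => r t /andP[ra rb] /andP[ta tb].
  rewrite !le_max; have [rm|/ltW rm] := leP r ((r1 + r2) / 2); have [tm|/ltW tm] := leP t ((t1 + t2) / 2).
  - by rewrite h1// ?ra ?ta.
  - by rewrite h3 ?orbT// ?ra ?tm.
  - by rewrite h2 ?orbT// ?rm ?ta.
  - by rewrite h4 ?orbT// ?rm ?tm.
move=> r0 t0 hr0 ht0.
have /cont_cplxP/(_ _ ltr01)[de de0 hde] := cf _ _ hr0 ht0.
pose K := `|a| + `|b| + 1.
have K1 : 1 <= K by rewrite /K lerDr addr_ge0.
have hK r : a <= r <= b -> `|r| <= K.
  move=> /andP[h1 h2]; rewrite ler_norml; apply/andP; rewrite /K.
  by split; [move: (ler_norm (- a)); rewrite normrN|move: (ler_norm b)]; move: (normr_ge0 a) (normr_ge0 b); lra.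
exists (de / (K + 1)); first by rewrite divr_gt0//; lra.
move=> k r t L M ar rr0 r0r rb ct tt0 t0t td; rewrite !ltr_pdivlMr; try lra.
move=> hL hM; exists (1 + cmod (f (polar r0 t0))) => x y hx hy.
suff hz : cmod (polar x y - polar r0 t0) < de.
  by rewrite -lerBlDr; apply: le_trans (cmod_ge_sub _ _) _; exact: hde.
have nr (u v w l : R) : u <= v -> v <= u + l -> u <= w <= u + l -> `|w - v| <= l.
  by clear => ? ? /andP[? ?]; rewrite ler_norml; apply/andP; split; lra.
apply: le_lt_trans (polar_lip2 _ _ _ _) _.
have h1 : `|x - r0| <= L by apply: (nr r).
have h2 : `|y - t0| <= M by apply: (nr t).
have h3 : `|x| <= K.
  by apply: hK; case/andP: hx => x1 x2; rewrite (le_trans ar x1) (le_trans x2 rb).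
apply: le_lt_trans (lerD (ler_pM (normr_ge0 _) (normr_ge0 _) h3 h2) h1) _.
rewrite mulrDr mulr1 [L * K]mulrC in hL; rewrite mulrDr mulr1 [M * K]mulrC in hM.
have [LM|/ltW ML] := leP L M; first by apply: le_lt_trans hM; rewrite lerD2l.
by apply: le_lt_trans hL; rewrite lerD2r ler_wpM2l//; apply: le_trans K1.
Qed.

Lemma arc_cvg f a b c d (m : nat -> R) m0 : a <= b -> c <= d -> ctn f a b c d ->
  (forall n, a <= m n <= b) -> a <= m0 <= b -> m n @[n --> \oo] --> m0 ->
  arc f (m n) c d @[n --> \oo] --> arc f m0 c d.
Proof.
move=> ab cd cf hm hm0 cm.
have [B hB] := ctn_bounded ab cd cf.
pose g r t := f (polar r t) * (ci R * polar r t).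
pose K := `|a| + `|b|.
have hK r : a <= r <= b -> `|r| <= K.
  move=> /andP[h1 h2]; rewrite ler_norml; apply/andP; rewrite /K.
  by split; [move: (ler_norm (- a)); rewrite normrN|move: (ler_norm b)]; move: (normr_ge0 a) (normr_ge0 b); lra.
have hg r t : a <= r <= b -> c <= t <= d -> cmod (g r t) <= B * K.
  move=> hr ht; rewrite /g !cmodM cmod_ci mul1r cmod_polar.
  by apply: ler_pM => //; [exact: cmod_ge0|exact: hB|exact: hK].
have bg r : a <= r <= b -> bm c d (g r) by move=> hr; apply: bm_arc => t ht; exact: cf.
apply: cplx_sub_cvg0.
have E n : arc f (m n) c d - arc f m0 c d = cint c d (fun t => g (m n) t - g m0 t).
  by rewrite (@cintB R c d (g (m n)) (g m0) (bg _ (hm n)) (bg _ hm0)).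
rewrite (funext E).
apply: (@cint_dct0 _ _ _ _ (B * K + B * K)) => //.
- by move=> n; apply: bmB; exact: bg.
- by move=> n t ht; apply: le_trans (cmodB _ _) _; apply: lerD; exact: hg.
apply: aeW => t ht.
have H : {for m0, continuous (fun r => g r t)}.
  apply: contM; first by apply: cont_ray; exact: cf.
  by apply: contM; [exact: cont_cst|exact: polar_cont_r].
rewrite -[0](cmod0 R); apply: cvg_cmod; rewrite -[X in _ --> X](subrr (g m0 t)).
by apply: cvgB; [exact: (cvg_comp _ _ cm H)|exact: cvg_cst].
Qed.

(** Both arcs tend to the same arc, and the rays have length [m' n - m n], which tends to 0. *)
Lemma box_shrink f a b c d (m m' : nat -> R) : a <= b -> c <= d -> ctn f a b c d ->
  (forall n, a <= m n) -> (forall n, m n <= m' n) -> (forall n, m' n <= b) ->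
  (exists2 m0, a <= m0 <= b & m n @[n --> \oo] --> m0 /\ m' n @[n --> \oo] --> m0) ->
  box f (m n) (m' n) c d @[n --> \oo] --> (0 : Cplx R).
Proof.
move=> ab cd cf h1 h2 h3 [m0 hm0 [cm cm']].
have [B hB] := ctn_bounded ab cd cf.
pose V t n := ray f t (m n) (m' n).
have ray0 t : c <= t <= d -> V t @ \oo --> (0 : Cplx R).
  move=> ht; apply/cvg_cplxP => e e0.
  have : (B * (m' n - m n)) @[n --> \oo] --> B * (m0 - m0).
    by apply: cvgM; [exact: cvg_cst|exact: cvgB].
  rewrite subrr mulr0 => /cvgrPdist_le/(_ _ e0); apply: filterS => n.
  rewrite sub0r normrN subr0 => hn; apply: le_trans hn; apply: le_trans (ler_norm _).
  apply: cint_bound => //.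
    apply: bm_ray => r /andP[r1 r2]; apply: cf => //.
    by rewrite (le_trans (h1 n) r1) (le_trans r2 (h3 n)).
  move=> r /andP[r1 r2]; rewrite cmodM cmod_polar1 mulr1; apply: hB => //.
  by rewrite (le_trans (h1 n) r1) (le_trans r2 (h3 n)).
have A1 : arc f (m n) c d @[n --> \oo] --> arc f m0 c d.
  by apply: (arc_cvg ab cd) => // n; rewrite h1 (le_trans (h2 n)).
have A2 : arc f (m' n) c d @[n --> \oo] --> arc f m0 c d.
  by apply: (arc_cvg ab cd) => // n; rewrite h3 (le_trans (h1 n)).
have R1 := ray0 c; have R2 := ray0 d.
rewrite !lexx cd /= in R1 R2.
have := ccvgB _ (ccvgB _ A2 A1) (ccvgB _ (R2 isT) (R1 isT)).
have -> : arc f m0 c d - arc f m0 c d - (0 - 0) = 0 :> Cplx R by rewrite subrr subr0 subr0.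
have E n : box f (m n) (m' n) c d = arc f (m' n) c d - arc f (m n) c d - (V d n - V c n) by [].
by rewrite (funext E) => H; exact: H.
Qed.

Lemma cplx_const_cvg0 (u : nat -> Cplx R) (l : Cplx R) :
  u @ \oo --> (0 : Cplx R) -> (forall n, u n = l) -> l = 0.
Proof.
move=> /cvg_cplxP u0 ul; apply/eqP; rewrite -cmod_eq0 eq_le cmod_ge0 andbT.
apply/ler_addgt0Pl => e e0; rewrite addr0; have [N _ hN] := u0 e e0.
by have := hN N (leqnn N); rewrite /= ul subr0.
Qed.

Lemma harmonic_itv (n : nat) : 0 <= (harmonic n : R) <= 1.
Proof. by rewrite /harmonic /= invr_ge0 ler0n invf_le1 ?ler1n. Qed.

Lemma cvg_lin_harmonic (x y : R) : x + y * harmonic n @[n --> \oo] --> x.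
Proof.
suff : x + y * harmonic n @[n --> \oo] --> x + y * 0 by rewrite mulr0 addr0.
by apply: cvgD; [exact: cvg_cst|apply: cvgM; [exact: cvg_cst|exact: cvg_harmonic]].
Qed.

(* Holomorphy may fail on the circle |z| = rho as long as f is continuous there. *)
Lemma goursat_circle f a b c d rho : a <= b -> c <= d -> ctn f a b c d ->
  (forall r t, a <= r <= b -> r != rho -> c <= t <= d -> derivable f (polar r t) 1) ->
  box f a b c d = 0.
Proof.
move=> ab cd cf df.
have [hr|hr] := boolP (a <= rho <= b); last first.
  apply: (goursat ab cd) => r t hr' ht; apply: (df _ _ hr' _ ht).
  by apply/eqP => E; move: hr; rewrite -E hr'.
have /andP[ar rb] := hr.
have U := @cplx_const_cvg0.
have h0 n : (0 : R) < harmonic n by rewrite /harmonic invr_gt0 ltr0n.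
rewrite (@box_split_r _ f a rho b)//.
have -> : box f a rho c d = 0.
  move: ar; rewrite le_eqVlt => /predU1P[->|ar]; first by rewrite /box /ray !cint_pt !subrr.
  (* Radii tending to [rho] from below. Up to [m n] the box vanishes by [goursat], so the box up to
     [rho] equals the thin remainder for every n, and the remainders tend to 0. The outer side is
     treated symmetrically. *)
  pose m n := rho + (a - rho) * harmonic n.
  have am n : a <= m n by have := harmonic_itv n; rewrite /m => /andP[? ?]; nra.
  have mr n : m n < rho by have := h0 n; rewrite /m => ?; nra.
  apply: (U (fun n => box f (m n) rho c d)).
    apply: (@box_shrink f a b c d m (fun=> rho)) => //.
    - by move=> n; exact: ltW.
    - by exists rho => //; split; [exact: cvg_lin_harmonic|exact: cvg_cst].
  move=> n; rewrite [RHS](@box_split_r _ f a (m n) rho)//; last 2 first.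
  - exact: ltW.
  - exact: (ctn_sub (lexx a) rb (lexx c) (lexx d) cf).
  have -> : box f a (m n) c d = 0; last by rewrite add0r.
  apply: (goursat (am n) cd) => r t /andP[r1 r2] ht.
  have h : r < rho by exact: le_lt_trans r2 (mr n).
  by apply: (df _ _ _ _ ht); rewrite ?r1 ?(ltW (lt_le_trans h rb))// lt_eqF.
rewrite add0r.
move: rb; rewrite le_eqVlt => /predU1P[->|rb]; first by rewrite /box /ray !cint_pt !subrr.
pose m n := rho + (b - rho) * harmonic n.
have am n : m n <= b by have := harmonic_itv n; rewrite /m => /andP[? ?]; nra.
have mr n : rho < m n by have := h0 n; rewrite /m => ?; nra.
apply: (U (fun n => box f rho (m n) c d)).
  apply: (@box_shrink f a b c d (fun=> rho) m) => //.
  - by move=> n; exact: ltW.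
  - by exists rho => //; split; [exact: cvg_cst|exact: cvg_lin_harmonic].
move=> n; rewrite [RHS](@box_split_r _ f rho (m n) b)//; last 2 first.
- exact: ltW.
- exact: (ctn_sub ar (lexx b) (lexx c) (lexx d) cf).
have -> : box f (m n) b c d = 0; last by rewrite addr0.
apply: (goursat (am n) cd) => r t /andP[r1 r2] ht.
have h : rho < r by exact: lt_le_trans (mr n) r1.
by apply: (df _ _ _ _ ht); rewrite ?r2 ?(ltW (le_lt_trans ar h))// gt_eqF.
Qed.

End Exceptional.

(** * Cauchy formulas *)

Section Local.
Variable R : realType.
Implicit Types (f g : Cplx R -> Cplx R) (z w p : Cplx R).

Lemma cderiv_near f g z d : (exists2 de : R, 0 < de & forall w, cmod (w - z) < de -> f w = g w) ->
  cderiv f z d -> cderiv g z d.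
Proof.
move=> [e e0 he] df e' e'0; have [de de0 hde] := df e' e'0.
exists (Num.min e de); first by rewrite lt_min e0 de0.
move=> h; rewrite lt_min => /andP[h1 h2]; rewrite -!he ?subrr ?cmod0//; first exact: hde.
by rewrite addrAC subrr add0r.
Qed.

Lemma derivable_near f g z : (exists2 de : R, 0 < de & forall w, cmod (w - z) < de -> f w = g w) ->
  derivable f z 1 -> derivable g z 1.
Proof. by move=> H /derivable_cderiv/(cderiv_near H)/cderiv_derivable. Qed.

Lemma derD f g z : derivable f z 1 -> derivable g z 1 -> derivable (fun z => f z + g z) z 1.
Proof. by move=> df dg; exact: (derivableD df dg). Qed.
Lemma derB f g z : derivable f z 1 -> derivable g z 1 -> derivable (fun z => f z - g z) z 1.
Proof. by move=> df dg; exact: (derivableB df dg). Qed.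
Lemma derM f g z : derivable f z 1 -> derivable g z 1 -> derivable (fun z => f z * g z) z 1.
Proof. by move=> df dg; exact: (derivableM df dg). Qed.
Lemma derV f z : f z != 0 -> derivable f z 1 -> derivable (fun z => (f z)^-1) z 1.
Proof. by move=> fz df; exact: (derivableV fz df). Qed.
Lemma der_cst (c : Cplx R) z : derivable (fun _ : Cplx R => c) z 1.
Proof. exact: derivable_cst. Qed.
Lemma der_id z : derivable (fun z : Cplx R => z) z 1.
Proof. exact: derivable_id. Qed.

Lemma cderiv_shift f p z d : cderiv f (p + z) d -> cderiv (fun z => f (p + z)) z d.
Proof.
by move=> H e e0; have [de de0 hde] := H e e0; exists de => // h /hde; rewrite addrA.
Qed.

Lemma der_shift f p z : derivable f (p + z) 1 -> derivable (fun z => f (p + z)) z 1.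
Proof. by move=> /derivable_cderiv/cderiv_shift/cderiv_derivable. Qed.

(** The singularity at w is filled in by the derivative: the result is continuous, which is all that
    [goursat_circle] asks on the circle through w. At a boundary point it represents the operator Q
    on the continued function. *)
Definition dq f w z : Cplx R := if z == w then derive1 f w else (f z - f w) / (z - w).

Lemma dqE f w z : z != w -> dq f w z = (f z - f w) / (z - w).
Proof. by rewrite /dq => /negbTE ->. Qed.

Lemma dq_mul f w z : (z - w) * dq f w z = f z - f w.
Proof.
have [->|zw] := eqVneq z w; first by rewrite !subrr mul0r.
by rewrite dqE// mulrC divfK// subr_eq0.
Qed.

Lemma der_dq f w z : z != w -> derivable f z 1 -> derivable (dq f w) z 1.
Proof.
move=> zw df; apply: (@derivable_near (fun z => (f z - f w) * (z - w)^-1)).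
  exists (cmod (z - w)); first by rewrite cmod_gt0 subr_eq0.
  move=> x hx; rewrite dqE//; apply: contraTneq hx => ->.
  by rewrite cmodBC ltxx.
apply: (@derM (fun z => f z - f w) (fun z => (z - w)^-1)).
  by apply: derB; [exact: df|exact: der_cst].
apply: (@derV (fun z => z - w)); first by rewrite subr_eq0.
by apply: derB; [exact: der_id|exact: der_cst].
Qed.

Lemma cont_dq f w z : derivable f z 1 -> {for z, continuous (dq f w)}.
Proof.
move=> df; have [zw|zw] := eqVneq z w; last by apply: derivable_continuous; exact: der_dq.
subst z; apply/cont_cplxP => e e0; have [de de0 hde] := derivable_cderiv df e0.
exists de => // x hx; rewrite /dq eqxx; have [_|xw] := eqVneq x w.
  by rewrite subrr cmod0 ltW.
have c0 : 0 < cmod (x - w) by rewrite cmod_gt0 subr_eq0.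
have H := hde (x - w) hx; rewrite [w + _]addrC subrK in H.
by rewrite -(ler_pM2r c0) -cmodM mulrBl divfK ?subr_eq0.
Qed.

End Local.

Section Cauchy.
Variable R : realType.
Implicit Types (f g : Cplx R -> Cplx R) (z w p : Cplx R) (r t rho : R).

Definition twopi : R := 2 * pi.
Lemma twopi_gt0 : 0 < twopi. Proof. by rewrite /twopi mulr_gt0 ?pi_gt0. Qed.
Lemma twopi_neq0 : (twopi%:C%C : Cplx R) != 0.
Proof. by rewrite -cmod_gt0 cmodC gtr0_norm twopi_gt0. Qed.

(** The disk is a polar rectangle with inner radius 0 and a full turn: its inner arc is a point and
    its two rays cancel by periodicity. The circle through w is the exceptional one. *)
Lemma circle_dq f w r rho : (forall z, cmod z < rho -> derivable f z 1) -> cmod w < r -> r < rho ->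
  cint 0 twopi (fun t => dq f w (polar r t) * polar r t) = 0.
Proof.
move=> df wr rr; have r0 : 0 <= r by apply: le_trans (ltW wr); exact: cmod_ge0.
have inr s t : 0 <= s <= r -> cmod (polar s t) < rho.
  by move=> /andP[s0 sr]; rewrite cmod_polar ger0_norm//; exact: le_lt_trans rr.
have cf : ctn (dq f w) 0 r 0 twopi.
  by move=> s t hs _; apply: cont_dq; apply: df; exact: inr.
have B0 : box (dq f w) 0 r 0 twopi = 0.
  apply: (@goursat_circle _ _ _ _ _ _ (cmod w)) => //; first exact: ltW twopi_gt0.
  move=> s t hs sw _; apply: der_dq; last by apply: df; exact: inr.
  apply: contraNneq sw => <-; rewrite cmod_polar ger0_norm//; by case/andP: hs.
have A0 : arc (dq f w) 0 0 twopi = 0.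
  have := cintZ 0 (bm_cst 0 twopi (0 : Cplx R)); rewrite [RHS]mul0r => E; rewrite -[RHS]E.
  by apply: cint_ext => t _; rewrite polarE mul0r mulr0 mulr0 mulr0.
have R0 : ray (dq f w) twopi 0 r = ray (dq f w) 0 0 r.
  by apply: cint_ext => s _; rewrite /twopi !polar_2pi.
move: B0; rewrite /box A0 R0 subrr !subr0 /arc => E.
have ci0 : ci R != 0 by rewrite -cmod_gt0 cmod_ci.
apply: (mulfI ci0); rewrite mulr0 -cintZ.
  by rewrite -[RHS]E; apply: cint_ext => t _; rewrite mulrCA.
apply: bm_cont => t ht; apply: contM; last exact: polar_cont_t.
by apply: cont_arc; apply: cf => //; rewrite r0 lexx.
Qed.

Lemma cont_circle f r rho t : (forall z, cmod z < rho -> derivable f z 1) -> 0 <= r -> r < rho ->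
  {for t, continuous (fun t => f (polar r t))}.
Proof.
move=> df r0 rr; apply: cont_arc; apply: derivable_continuous; apply: df.
by rewrite cmod_polar ger0_norm.
Qed.

Lemma circle_mean f r rho : (forall z, cmod z < rho -> derivable f z 1) -> 0 <= r -> r < rho ->
  cint 0 twopi (fun t => f (polar r t)) = f 0 * twopi%:C%C.
Proof.
move=> df r0 rr; have := ltW twopi_gt0 => tp.
have cst0 (c : Cplx R) : cint 0 twopi (fun=> c) = c * twopi%:C%C.
  by rewrite cint_cst ?subr0.
move: r0; rewrite le_eqVlt => /predU1P[<-|r0].
  by rewrite -cst0; apply: cint_ext => t _; rewrite polarE mul0r.
have := circle_dq df (w := 0) (r := r); rewrite cmod0 => /(_ r0 rr) E.
rewrite -cst0; apply/eqP; rewrite -subr_eq0 -cintB; last exact: bm_cst.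
  apply/eqP; rewrite -[RHS]E; apply: cint_ext => t _.
  by rewrite mulrC -[X in X * dq _ _ _]subr0 dq_mul.
by apply: bm_cont => t _; apply: cont_circle df _ rr; exact: ltW.
Qed.

(** On |z| = r one has conj z = r^2 / z, so z / (z - w) is the conjugate of F(z) = 1 / (1 - conj(w)
    z / r^2). This F is holomorphic on the larger disk |z| < r^2 / |w|, and its mean is F(0) = 1. *)
Lemma cauchy_kernel_mean w r : cmod w < r ->
  cint 0 twopi (fun t => polar r t / (polar r t - w)) = twopi%:C%C.
Proof.
move=> wr; have r0 : 0 < r by apply: le_lt_trans wr; exact: cmod_ge0.
pose F z : Cplx R := (1 - w^* * z / (r ^+ 2)%:C%C)^-1.
have [w0|w0] := eqVneq w 0.
  have E := cint_cst (1 : Cplx R) (ltW twopi_gt0); rewrite subr0 mul1r in E; rewrite -E.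
  apply: cint_ext => t _; rewrite w0 subr0 divff// -cmod_gt0 cmod_polar normr_gt0 gt_eqF//.
have cw : 0 < cmod w by rewrite cmod_gt0.
pose rho := r ^+ 2 / cmod w.
have r2 : 0 < r ^+ 2 by rewrite exprn_gt0.
have rr : r < rho by rewrite /rho ltr_pdivlMr// expr2 ltr_pM2l.
have dF z : cmod z < rho -> derivable F z 1.
  move=> hz; apply: derV.
    rewrite subr_eq0 eq_sym; apply: contraTneq hz => E.
    have : cmod (w^* * z / (r ^+ 2)%:C%C) = 1 by rewrite E cmod1.
    rewrite !cmodM cmodV cmodC cmodJ gtr0_norm// => /eqP.
    rewrite -(inj_eq (mulIf (lt0r_neq0 r2))) mul1r divfK ?(lt0r_neq0 r2)// => /eqP E'.
    by rewrite -leNgt /rho ler_pdivrMr// mulrC E'.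
  apply: derB; first exact: der_cst.
  apply: derM; last exact: der_cst.
  by apply: derM; [exact: der_cst|exact: der_id].
have := circle_mean dF (ltW r0) rr.
have -> : F 0 = 1 by rewrite /F mulr0 mul0r subr0 invr1.
rewrite mul1r => E.
have -> : (twopi%:C%C : Cplx R) = (twopi%:C%C)^* by apply: cplx_eq; rewrite /= ?oppr0.
rewrite -E -cintJ; last by apply: bm_cont => t _; apply: cont_circle dF _ rr; exact: ltW.
apply: cint_ext => t _; rewrite /F.
have pz : polar r t != 0 by rewrite -cmod_gt0 cmod_polar normr_gt0 gt_eqF.
have pw : polar r t - w != 0.
  rewrite subr_eq0; apply: contraTneq wr => <-; rewrite cmod_polar ger0_norm ?ltxx//; exact: ltW.
have r2c : ((r ^+ 2)%:C%C : Cplx R) != 0 by rewrite -cmod_gt0 cmodC normr_gt0 gt_eqF.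
have r2J : ((r ^+ 2)%:C%C : Cplx R)^* = (r ^+ 2)%:C%C by apply: cplx_eq; rewrite /= ?oppr0.
have PJ := polarJV r t; move: PJ r2c r2J; generalize ((r ^+ 2)%:C%C : Cplx R) => c2 PJ c20 c2J.
rewrite fmorphV rmorphB rmorph1 !rmorphM fmorphV /= conjCK c2J PJ.
have -> : w * (c2 / polar r t) / c2 = w / polar r t by field; rewrite pz c20.
by field; rewrite pz pw.
Qed.

Lemma cauchy0 f w r rho : (forall z, cmod z < rho -> derivable f z 1) -> cmod w < r -> r < rho ->
  cint 0 twopi (fun t => f (polar r t) * polar r t / (polar r t - w)) = f w * twopi%:C%C.
Proof.
move=> df wr rr; have r0 : 0 < r by apply: le_lt_trans wr; exact: cmod_ge0.
have pw t : polar r t - w != 0.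
  rewrite subr_eq0; apply: contraTneq wr => <-; rewrite cmod_polar ger0_norm ?ltxx//; exact: ltW.
have ck t : {for t, continuous (fun t => polar r t / (polar r t - w))}.
  apply: contM; first exact: polar_cont_t.
  apply: contV; first exact: pw.
  by apply: contB; [exact: polar_cont_t|exact: cont_cst].
have cf t : {for t, continuous (fun t => f (polar r t))}.
  by apply: cont_circle df _ rr; exact: ltW.
rewrite -(cauchy_kernel_mean wr) -cintZ; last by apply: bm_cont => t _; exact: ck.
apply/eqP; rewrite -subr_eq0 -cintB; last 2 first.
- apply: bm_cont => t _; apply: (@contM _ _ (fun t => f (polar r t) * polar r t) (fun t => (polar r t - w)^-1)).
    by apply: contM; [exact: cf|exact: polar_cont_t].
  apply: contV; first exact: pw.
  by apply: contB; [exact: polar_cont_t|exact: cont_cst].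
- by apply: bm_cont => t _; apply: contM; [exact: cont_cst|exact: ck].
apply/eqP; rewrite -[RHS](circle_dq df wr rr); apply: cint_ext => t _.
rewrite dqE; last by rewrite -subr_eq0.
by field; exact: pw.
Qed.

Lemma cauchy_formula f p w r rho : (forall z, cmod (z - p) < rho -> derivable f z 1) ->
  cmod (w - p) < r -> r < rho ->
  cint 0 twopi (fun t => f (p + polar r t) * polar r t / (p + polar r t - w)) = f w * twopi%:C%C.
Proof.
move=> df wr rr; have := @cauchy0 (fun z => f (p + z)) (w - p) r rho _ wr rr.
rewrite [p + (w - p)]addrC subrK => <-.
  by apply: cint_ext => t _; congr (_ / _); rewrite opprB addrA [p + _]addrC.
by move=> z hz; apply: der_shift; apply: df; rewrite addrAC subrr add0r.
Qed.

End Cauchy.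

(** * Integrals of Cauchy type and higher derivatives *)

Section CauchyType.
Variable R : realType.
Implicit Types (f g : Cplx R -> Cplx R) (z w p : Cplx R) (r t rho : R).

(** For x = 1 / (v - w) and y = 1 / (v - w - h) the relation y - x = h x y holds: this is the
    first-order expansion in w of (v - w)^(-N), with a constant independent of v as long as x and y
    are bounded by K. *)
Lemma inv_pow_estimate (K : R) (N : nat) : 0 <= K -> exists2 C : R, 0 <= C &
  forall h x y : Cplx R, cmod x <= K -> cmod y <= K -> y - x = h * x * y ->
  cmod (y ^+ N - x ^+ N - N%:R * h * x ^+ N.+1) <= C * cmod h ^+ 2.
Proof.
move=> K0; elim: N => [|N [C C0 IH]].
  by exists 0 => // h x y _ _ _; rewrite !expr0 subrr !mul0r subr0 cmod0.
exists (K * C + N.+1%:R * (K ^+ N.+2 * K)).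
  by apply: addr_ge0; [exact: mulr_ge0|apply: mulr_ge0 => //; apply: mulr_ge0 => //; exact: exprn_ge0].
move=> h x y hx hy E; have -> : y ^+ N.+1 - x ^+ N.+1 - N.+1%:R * h * x ^+ N.+2 =
    y * (y ^+ N - x ^+ N - N%:R * h * x ^+ N.+1) + N.+1%:R * (h * h) * (x ^+ N.+2 * y).
  rewrite -natr1 !exprS; set Y := y ^+ N; set X := x ^+ N; set n := N%:R.
  have e0 : y - x - h * x * y = 0 by rewrite E subrr.
  transitivity (y * (Y - X - n * h * (x * X)) + (n + 1) * (h * h) * (x * (x * X) * y) +
     X * (y - x - h * x * y) * (1 + (n + 1) * h * x)); first by ring.
  by rewrite e0 mulr0 mul0r addr0.
apply: le_trans (cmodD _ _) _; rewrite mulrDl; apply: lerD.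
  rewrite cmodM -[X in _ <= X]mulrA; apply: ler_pM => //; try exact: cmod_ge0.
  exact: IH.
have cN : cmod (N.+1%:R : Cplx R) = N.+1%:R.
  by rewrite -(rmorph_nat (real_complex R)) cmodC ger0_norm.
rewrite cmodM [cmod (N.+1%:R * _)]cmodM cN [cmod (h * h)]cmodM [cmod (x ^+ _ * y)]cmodM cmodX.
have h3 : cmod x ^+ N.+2 <= K ^+ N.+2 by rewrite lerXn2r ?nnegrE ?cmod_ge0.
have h4 : cmod x ^+ N.+2 * cmod y <= K ^+ N.+2 * K.
  by apply: ler_pM => //; rewrite ?exprn_ge0 ?cmod_ge0.
have p0 : 0 <= (N.+1%:R : R) * (cmod h * cmod h) by rewrite !mulr_ge0 ?cmod_ge0.
apply: le_trans (ler_wpM2l p0 h4) _; set k1 := K ^+ N.+2; set n := N.+1%:R.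
by rewrite le_eqVlt; apply/orP; left; apply/eqP; ring.
Qed.

Lemma cont_kernel (gam : R -> Cplx R) w t n : {for t, continuous gam} -> gam t - w != 0 ->
  {for t, continuous (fun t => ((gam t - w) ^+ n)^-1)}.
Proof.
move=> cg nz; apply: (@contV _ _ (fun t => (gam t - w) ^+ n)); first by rewrite expf_neq0.
elim: n => [|n IH]; first exact: cont_cst.
have E : (fun t => (gam t - w) ^+ n.+1) = (fun t => (gam t - w) * (gam t - w) ^+ n).
  by apply/funext => s; rewrite exprS.
have cgw : {for t, continuous (fun t => gam t - w)} by apply: contB; [exact: cg|exact: cont_cst].
by rewrite E; apply: contM; [exact: cgw|exact: IH].
Qed.

(** Differentiation under the integral, from an expansion of the kernel that is uniform along the
    path. The density [phi] is only bounded and measurable, because it will live on rays ending on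
    the unit circle, where nothing is known of it. *)
Lemma cauchy_type_deriv (a b : R) (phi gam : R -> Cplx R) (w0 : Cplx R) (de : R) n :
  a <= b -> bm a b phi -> (forall t, a <= t <= b -> {for t, continuous gam}) -> 0 < de ->
  (forall t, a <= t <= b -> de <= cmod (gam t - w0)) ->
  cderiv (fun w => cint a b (fun t => phi t / (gam t - w) ^+ n)) w0
    (n%:R * cint a b (fun t => phi t / (gam t - w0) ^+ n.+1)).
Proof.
move=> ab bphi cg de0 hde.
have [B B0 hB] := bm_bound bphi.
pose K := 2 / de; have K0 : 0 < K by rewrite divr_gt0.
have [C C0 hC] := inv_pow_estimate n (ltW K0).
have nz h t : a <= t <= b -> cmod h < de / 2 -> de / 2 <= cmod (gam t - (w0 + h)).
  move=> /hde ht hh; have := cmod_ge_sub (gam t - w0) h; rewrite opprD addrA.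
  by apply: le_trans; lra.
have nz0 h t : a <= t <= b -> cmod h < de / 2 -> gam t - (w0 + h) != 0.
  by move=> ht hh; rewrite -cmod_gt0 (lt_le_trans _ (nz _ _ ht hh))// divr_gt0.
have h00 : cmod (0 : Cplx R) < de / 2 by rewrite cmod0 divr_gt0.
have bk h m : cmod h < de / 2 -> bm a b (fun t => phi t / (gam t - (w0 + h)) ^+ m).
  by move=> hh; apply: bmM => //; apply: bm_cont => t ht; apply: cont_kernel; [exact: cg|exact: nz0].
have bk0 m := bk 0 m h00; rewrite addr0 in bk0.
(* The summand 1 keeps [M] positive even when the path has length 0. *)
move=> e e0; pose M := B * C * (b - a) + 1.
have M0 : 0 < M by rewrite /M ltr_wpDl// !mulr_ge0 ?subr_ge0// ltW.
exists (Num.min (de / 2) (e / M)); first by rewrite lt_min !divr_gt0.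
move=> h; rewrite lt_min => /andP[h1 h2].
rewrite mulrAC -cintZ; last exact: bk0.
rewrite -cintB; [|exact: bk|exact: bk0].
rewrite -cintB; last first.
- by apply: bmM; [exact: bm_cst|exact: bk0].
- by apply: bmB; [exact: bk|exact: bk0].
apply: le_trans (@cint_bound _ _ _ _ (B * (C * cmod h ^+ 2)) ab _ _) _.
- apply: bmB; last by apply: bmM; [exact: bm_cst|exact: bk0].
  by apply: bmB; [exact: bk|exact: bk0].
- move=> t ht; set x := (gam t - w0)^-1; set y := (gam t - (w0 + h))^-1.
  have x0 := nz0 0 t ht h00; rewrite addr0 in x0.
  have y0 := nz0 h t ht h1.
  have -> : phi t / (gam t - (w0 + h)) ^+ n - phi t / (gam t - w0) ^+ n -
      n%:R * h * (phi t / (gam t - w0) ^+ n.+1) =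
      phi t * (y ^+ n - x ^+ n - n%:R * h * x ^+ n.+1).
    by rewrite /x /y !exprVn; ring.
  rewrite cmodM; apply: ler_pM; rewrite ?cmod_ge0//; first exact: hB.
  have iK v : de / 2 <= cmod v -> cmod v^-1 <= K.
    move=> hv; rewrite cmodV /K -[2 / de]invf_div lef_pV2// posrE ?divr_gt0//.
    by apply: lt_le_trans hv; rewrite divr_gt0.
  apply: hC; [apply: iK|apply: iK; exact: nz|].
    by have := nz 0 t ht h00; rewrite addr0.
  by rewrite /x /y; field; rewrite x0 y0.
have h3 : cmod h * M <= e by rewrite -ler_pdivlMr// ltW.
have -> : B * (C * cmod h ^+ 2) * (b - a) = (M - 1) * cmod h * cmod h by rewrite /M; ring.
apply: ler_wpM2r; first exact: cmod_ge0.
apply: le_trans h3; rewrite [X in _ <= X]mulrC; apply: ler_wpM2r; first exact: cmod_ge0.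
by rewrite lerBlDr lerDl.
Qed.

Lemma circle_dist p w r t : cmod (w - p) < r -> r - cmod (w - p) <= cmod (p + polar r t - w).
Proof.
move=> wr; have r0 : 0 < r by apply: le_lt_trans wr; exact: cmod_ge0.
have -> : p + polar r t - w = polar r t - (w - p) by ring.
apply: le_trans (cmod_ge_sub _ _); rewrite cmod_polar ger0_norm ?lexx//; exact: ltW.
Qed.

Lemma derive1n_cauchy f p rho r n w : (forall z, cmod (z - p) < rho -> derivable f z 1) ->
  cmod (w - p) < r -> r < rho ->
  derive1n n f w = n`!%:R / (twopi R)%:C%C *
    cint 0 (twopi R) (fun t => f (p + polar r t) * polar r t / (p + polar r t - w) ^+ n.+1).
Proof.
move=> df + rr; elim: n w => [|n IH] w wr.
  have -> : cint 0 (twopi R) (fun t => f (p + polar r t) * polar r t / (p + polar r t - w) ^+ 1) = f w * (twopi R)%:C%C.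
    by rewrite -(cauchy_formula df wr rr).
  by rewrite /derive1n /= mul1r mulrC mulfK// twopi_neq0.
rewrite /derive1n /= -/(derive1n n f).
pose I m v := cint 0 (twopi R) (fun t => f (p + polar r t) * polar r t / (p + polar r t - v) ^+ m).
have cp t : {for t, continuous (fun t => p + polar r t)}.
  by apply: contD; [exact: cont_cst|exact: polar_cont_t].
have r0 : 0 < r by apply: le_lt_trans wr; exact: cmod_ge0.
have bphi : bm 0 (twopi R) (fun t => f (p + polar r t) * polar r t).
  apply: bm_cont => t _; apply: contM; last exact: polar_cont_t.
  have : {for (p + polar r t), continuous f}.
    by apply: derivable_continuous; apply: df; rewrite addrAC subrr add0r cmod_polar gtr0_norm.
  by move=> H; exact: (cvg_comp (fun t => p + polar r t) f (cp t) H).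
have dI : cderiv (I n.+1) w (n.+1%:R * I n.+2 w).
  apply: (@cauchy_type_deriv _ _ _ _ _ (r - cmod (w - p))) => //.
  - exact: ltW (twopi_gt0 R).
  - by rewrite subr_gt0.
  - by move=> t _; exact: circle_dist.
have dI2 : cderiv (fun v => n`!%:R / (twopi R)%:C%C * I n.+1 v) w (n`!%:R / (twopi R)%:C%C * (n.+1%:R * I n.+2 w)).
  set c := _ / _; move=> e e0; have c1 : 0 < cmod c + 1 by rewrite ltr_wpDl// cmod_ge0.
  have [de de0 hde] := dI _ (divr_gt0 e0 c1).
  have rid (x1 x2 x3 h : Cplx R) : c * x1 - c * x2 - c * x3 * h = c * (x1 - x2 - x3 * h).
    by clear; move: c => c; ring.
  exists de => // h /hde H; rewrite rid cmodM; apply: le_trans (ler_wpM2l (cmod_ge0 _) H) _.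
  rewrite mulrA ler_wpM2r ?cmod_ge0// mulrCA -[X in _ <= X]mulr1 ler_wpM2l ?(ltW e0)//.
  by rewrite ler_pdivrMr// mul1r lerDl.
(* The induction hypothesis gives the formula on the disk |v - p| < r only, which suffices because
   derivatives are local. *)
have -> : derive1 (derive1n n f) w = n`!%:R / (twopi R)%:C%C * (n.+1%:R * I n.+2 w).
  apply: cderiv_derive1; apply: cderiv_near dI2; exists (r - cmod (w - p)); first by rewrite subr_gt0.
  move=> v hv; rewrite IH// -(subrK w v) -addrA; apply: le_lt_trans (cmodD _ _) _.
  by rewrite -ltrBrDr.
by rewrite factS natrM mulrA /I; congr (_ * _); rewrite mulrAC [n.+1%:R * _]mulrC.
Qed.

Definition cmean r (F : Cplx R -> Cplx R) : Cplx R := (twopi R)%:C%C^-1 * cint 0 (twopi R) (fun t => F (polar r t)).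
Definition rmean r (F : Cplx R -> R) : R := (twopi R)^-1 * rint 0 (twopi R) (fun t => F (polar r t)).

Lemma taylor_coefE f rho r n : (forall z, cmod z < rho -> derivable f z 1) -> 0 < r -> r < rho ->
  taylor_coef f n = cmean r (fun z => f z / z ^+ n).
Proof.
move=> df r0 rr; rewrite /taylor_coef (@derive1n_cauchy f 0 rho r n 0)//; last 2 first.
- by move=> z; rewrite subr0; exact: df.
- by rewrite subrr cmod0.
have fid (x y v : Cplx R) : x != 0 -> x / y * v / x = y^-1 * v.
  by move=> x0; rewrite mulrC !mulrA mulVf// mul1r.
rewrite fid; last by rewrite pnatr_eq0 -lt0n fact_gt0.
congr (_ * _); apply: cint_ext => t _; rewrite add0r subr0 exprS invfM mulrA.
by rewrite mulfK// -cmod_gt0 cmod_polar normr_gt0 gt_eqF.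
Qed.

End CauchyType.

(** * Taylor coefficients and circle means *)

Section CircleMeans.
Variable R : realType.
Implicit Types (f g F G : Cplx R -> Cplx R) (z w p : Cplx R) (r t rho B : R).

Definition bmc r F := bm 0 (twopi R) (fun t => F (polar r t)).

Lemma tp_ge0 : 0 <= twopi R. Proof. exact: ltW (twopi_gt0 R). Qed.

Lemma bmcD r F G : bmc r F -> bmc r G -> bmc r (fun z => F z + G z). Proof. exact: bmD. Qed.
Lemma bmcB r F G : bmc r F -> bmc r G -> bmc r (fun z => F z - G z). Proof. exact: bmB. Qed.
Lemma bmcM r F G : bmc r F -> bmc r G -> bmc r (fun z => F z * G z). Proof. exact: bmM. Qed.
Lemma bmcJ r F : bmc r F -> bmc r (fun z => (F z)^*). Proof. exact: bmJ. Qed.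
Lemma bmc_cst r (c : Cplx R) : bmc r (fun=> c). Proof. exact: bm_cst. Qed.
Lemma bmc_id r : bmc r (fun z => z).
Proof. by apply: bm_cont => t _; exact: polar_cont_t. Qed.
Lemma bmcX r F n : bmc r F -> bmc r (fun z => F z ^+ n).
Proof.
move=> bF; elim: n => [|n IH]; first exact: bmc_cst.
by apply: (bm_ext _ (bmcM bF IH)) => t _; rewrite exprS.
Qed.
Lemma bmc_sum r (I : Type) (s : seq I) (Fs : I -> Cplx R -> Cplx R) :
  (forall i, bmc r (Fs i)) -> bmc r (fun z => \sum_(i <- s) Fs i z).
Proof. by move=> H; apply: bm_sum. Qed.
Lemma bmc_kernel r w n : cmod w < r -> bmc r (fun z => ((z - w) ^+ n)^-1).
Proof.
move=> wr; have r0 : 0 < r by apply: le_lt_trans wr; exact: cmod_ge0.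
apply: bm_cont => t _; apply: (@cont_kernel R (polar r)); first exact: polar_cont_t.
rewrite subr_eq0; apply: contraTneq wr => <-; rewrite cmod_polar ger0_norm ?ltxx//; exact: ltW.
Qed.
Lemma bmcV r n : 0 < r -> bmc r (fun z => (z ^+ n)^-1).
Proof.
move=> r0; have := @bmc_kernel r 0 n; rewrite cmod0 => /(_ r0) H.
by apply: (bm_ext _ H) => t _; rewrite subr0.
Qed.
Lemma bmc_der r rho f : (forall z, cmod z < rho -> derivable f z 1) -> 0 <= r -> r < rho -> bmc r f.
Proof. by move=> df r0 rr; apply: bm_cont => t _; exact: cont_circle df r0 rr. Qed.

Lemma cmean_ext r F G : (forall t, F (polar r t) = G (polar r t)) -> cmean r F = cmean r G.
Proof. by move=> E; congr (_ * _); apply: cint_ext => t _. Qed.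
Lemma cmeanD r F G : bmc r F -> bmc r G -> cmean r (fun z => F z + G z) = cmean r F + cmean r G.
Proof. by move=> bF bG; rewrite /cmean -mulrDr; congr (_ * _); exact: cintD. Qed.
Lemma cmeanZ r (c : Cplx R) F : bmc r F -> cmean r (fun z => c * F z) = c * cmean r F.
Proof. by move=> bF; rewrite /cmean mulrCA; congr (_ * _); exact: cintZ. Qed.
Lemma cmeanB r F G : bmc r F -> bmc r G -> cmean r (fun z => F z - G z) = cmean r F - cmean r G.
Proof. by move=> bF bG; rewrite /cmean -mulrBr; congr (_ * _); exact: cintB. Qed.
Lemma cmeanJ r F : bmc r F -> cmean r (fun z => (F z)^*) = (cmean r F)^*.
Proof.
move=> bF; rewrite /cmean [RHS]rmorphM; congr (_ * _); last exact: cintJ.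
by rewrite fmorphV; congr (_^-1); apply: cplx_eq; rewrite /= ?oppr0.
Qed.
Lemma cmean_sum r (I : Type) (s : seq I) (Fs : I -> Cplx R -> Cplx R) :
  (forall i, bmc r (Fs i)) ->
  cmean r (fun z => \sum_(i <- s) Fs i z) = \sum_(i <- s) cmean r (Fs i).
Proof.
move=> H; rewrite /cmean (@cint_sum R 0 (twopi R) I s (fun i t => Fs i (polar r t)) H).
by rewrite mulr_sumr.
Qed.
Lemma cmean_norm r F : bmc r F -> cmod (cmean r F) <= rmean r (fun z => cmod (F z)).
Proof.
move=> bF; rewrite /cmean /rmean cmodM cmodV cmodC gtr0_norm ?twopi_gt0//.
rewrite ler_wpM2l ?invr_ge0 ?tp_ge0//; exact: cint_norm.
Qed.
Lemma cmean_bound r F B : bmc r F -> (forall t, 0 <= t <= twopi R -> cmod (F (polar r t)) <= B) -> cmod (cmean r F) <= B.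
Proof.
move=> bF hB; rewrite /cmean cmodM cmodV cmodC gtr0_norm ?twopi_gt0//.
rewrite mulrC ler_pdivrMr ?twopi_gt0//.
by have := cint_bound tp_ge0 bF hB; rewrite subr0.
Qed.
Lemma cmean_holo f r rho : (forall z, cmod z < rho -> derivable f z 1) -> 0 <= r -> r < rho ->
  cmean r f = f 0.
Proof.
by move=> df r0 rr; rewrite /cmean (circle_mean df r0 rr) mulrC mulfK// twopi_neq0.
Qed.
Lemma rmean_sqr r F : bmc r F ->
  cmean r (fun z => F z * (F z)^*) = (rmean r (fun z => cmod (F z) ^+ 2))%:C%C.
Proof.
move=> bF; rewrite /cmean /rmean [RHS]rmorphM /= fmorphV; congr (_ * _); apply: cplx_eq => /=.
  by apply: rint_ext => t _; rewrite mulJ_cmod.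
rewrite (@rint_ext _ _ _ _ (fun=> 0)) ?rint_cst ?tp_ge0 ?mul0r// => t _.
by rewrite mulJ_cmod.
Qed.

(** With q = w / z, Cauchy's kernel z / (z - w) is the sum of the q^n for n < N plus q^N z / (z -
    w). *)
Lemma taylor_remainder f rho r N w : (forall z, cmod z < rho -> derivable f z 1) ->
  cmod w < r -> r < rho ->
  f w - \sum_(n < N) taylor_coef f n * w ^+ n = cmean r (fun z => f z * ((w / z) ^+ N * (z / (z - w)))).
Proof.
move=> df wr rr; have r0 : 0 < r by apply: le_lt_trans wr; exact: cmod_ge0.
have bf := bmc_der df (ltW r0) rr.
have fw : f w = cmean r (fun z => f z * (z / (z - w))).
  rewrite /cmean (@cint_ext _ _ _ _ (fun t => f (polar r t) * polar r t / (polar r t - w))).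
    by rewrite (cauchy0 df wr rr) mulrC mulfK// twopi_neq0.
  by move=> t _; rewrite mulrA.
have bk : bmc r (fun z => f z * (z / (z - w))).
  apply: bmcM => //; apply: bmcM; first exact: bmc_id.
  by apply: (bm_ext _ (bmc_kernel 1 wr)) => t _; rewrite expr1.
have bn n : bmc r (fun z => w ^+ n * (f z / z ^+ n)).
  by apply: bmcM; [exact: bmc_cst|apply: bmcM => //; exact: bmcV].
have -> : \sum_(n < N) taylor_coef f n * w ^+ n = cmean r (fun z => \sum_(n < N) w ^+ n * (f z / z ^+ n)).
  rewrite cmean_sum; last by move=> i; exact: bn.
  apply: eq_bigr => n _; rewrite (taylor_coefE n df r0 rr) mulrC cmeanZ//.
  by apply: bmcM => //; exact: bmcV.
rewrite fw -cmeanB//; last by apply: bmc_sum => i; exact: bn.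
apply: cmean_ext => t; set z := polar r t.
have z0 : z != 0 by rewrite -cmod_gt0 cmod_polar normr_gt0 gt_eqF.
have zw : z - w != 0.
  rewrite subr_eq0; apply: contraTneq wr => <-; rewrite cmod_polar ger0_norm ?ltxx//; exact: ltW.
have -> : \sum_(n < N) w ^+ n * (f z / z ^+ n) = f z * \sum_(n < N) (w / z) ^+ n.
  by rewrite mulr_sumr; apply: eq_bigr => n _; rewrite expr_div_n mulrCA.
rewrite -mulrBr; congr (_ * _).
have kq : z / (z - w) = 1 + w / z * (z / (z - w)) by field; rewrite z0 zw.
elim: N => [|N IH]; first by rewrite big_ord0 subr0 expr0 mul1r.
rewrite big_ord_recr /= opprD addrA IH exprSr -mulrA -[X in _ - X]mulr1 -mulrBr.
by rewrite {1}kq addrC addrA addNr add0r.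
Qed.

Lemma cvg_geom_bound (u : nat -> Cplx R) (l : Cplx R) (D q : R) : 0 <= q < 1 ->
  (forall N, cmod (u N - l) <= D * q ^+ N) -> u @ \oo --> l.
Proof.
move=> /andP[q0 q1] H; apply/cvg_cplxP => e e0.
have : geometric D q @ \oo --> (0 : R) by apply: cvg_geometric; rewrite ger0_norm.
move=> /cvgrPdist_le/(_ _ e0); apply: filterS => n.
rewrite sub0r normrN => hn; apply: le_trans (H n) _; apply: le_trans hn; exact: ler_norm.
Qed.

Lemma circle_bound r F : bmc r F -> exists2 B, 0 < B & forall t, 0 <= t <= twopi R -> cmod (F (polar r t)) <= B.
Proof. exact: bm_bound. Qed.

Lemma taylor_approx f rho r : (forall z, cmod z < rho -> derivable f z 1) -> 0 <= r -> r < rho ->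
  exists D q, [/\ 0 <= D, 0 <= q < 1 & forall N t,
    cmod (f (polar r t) - \sum_(n < N) taylor_coef f n * polar r t ^+ n) <= D * q ^+ N].
Proof.
(* Cauchy's formula on an intermediate circle |z| = s yields the ratio q = r / s < 1. *)
move=> df r0 rr; pose s := (r + rho) / 2.
have rs : r < s by rewrite /s; lra.
have srho : s < rho by rewrite /s; lra.
have s0 : 0 < s by apply: le_lt_trans rs.
have bf := bmc_der df (ltW s0) srho.
have [B B0 hB] := circle_bound bf.
exists (B * (s / (s - r))), (r / s).
have sr : 0 < s - r by rewrite subr_gt0.
split; first by apply: mulr_ge0; [exact: ltW|apply: divr_ge0; exact: ltW].
  by rewrite divr_ge0 ?(ltW s0)//= ltr_pdivrMr// mul1r.
move=> N t; have wr : cmod (polar r t) < s by rewrite cmod_polar ger0_norm.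
rewrite (taylor_remainder N df wr srho); apply: cmean_bound.
  apply: bmcM => //; apply: bmcM.
    apply: bmcX; apply: bmcM; first exact: bmc_cst.
    by apply: (bm_ext _ (bmcV 1 s0)) => x _; rewrite expr1.
  apply: bmcM; first exact: bmc_id.
  by apply: (bm_ext _ (bmc_kernel 1 wr)) => x _; rewrite expr1.
move=> x hx; rewrite -mulrA [s / (s - r) * _]mulrC cmodM; apply: ler_pM; rewrite ?cmod_ge0//; first exact: hB.
rewrite cmodM; apply: ler_pM; rewrite ?cmod_ge0//.
  by rewrite cmodX cmodM cmodV !cmod_polar !ger0_norm ?(ltW s0).
rewrite cmodM cmodV cmod_polar ger0_norm ?(ltW s0)//; apply: ler_pM; rewrite ?(ltW s0) ?invr_ge0 ?cmod_ge0//.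
have hd : s - r <= cmod (polar s x - polar r t).
  by apply: le_trans (cmod_ge_sub _ _); rewrite !cmod_polar !ger0_norm ?(ltW s0).
by rewrite lef_pV2// posrE//; apply: lt_le_trans hd.
Qed.

Lemma cmean_monomialJ g rho r n : (forall z, cmod z < rho -> derivable g z 1) -> 0 < r -> r < rho ->
  cmean r (fun z => z ^+ n * (g z)^*) = (taylor_coef g n)^* * (r ^+ (2 * n))%:C%C.
Proof.
move=> dg r0 rr; have bg := bmc_der dg (ltW r0) rr.
rewrite (taylor_coefE n dg r0 rr) -cmeanJ; last by apply: bmcM => //; exact: bmcV.
rewrite mulrC -cmeanZ; last by apply: bmcJ; apply: bmcM => //; exact: bmcV.
apply: cmean_ext => t; set z := polar r t.
have z0 : z != 0 by rewrite -cmod_gt0 cmod_polar normr_gt0 gt_eqF.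
have zJ : (z^* : Cplx R) != 0 by rewrite -cmod_gt0 cmodJ cmod_gt0.
have zz : z * z^* = (r ^+ 2)%:C%C by rewrite mulJ_cmod cmod_polar real_normK ?num_real.
have E : (r ^+ (2 * n))%:C%C = z ^+ n * z^* ^+ n by rewrite -exprMn zz -rmorphXn exprM.
have E2 : (g z / z ^+ n)^* = (g z)^* / z^* ^+ n by rewrite [LHS]rmorphM fmorphV rmorphXn.
by rewrite E E2 [(g z)^* / _]mulrC mulrA mulfK// expf_neq0.
Qed.

(** Only f is expanded, with a uniform geometric error on the circle; the mean of z^n conj(g)
    already is a coefficient of g. *)
Lemma parseval_cvg f g rho r : (forall z, cmod z < rho -> derivable f z 1) ->
  (forall z, cmod z < rho -> derivable g z 1) -> 0 < r -> r < rho ->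
  (fun N => \sum_(n < N) taylor_coef f n * (taylor_coef g n)^* * (r ^+ (2 * n))%:C%C) @ \oo -->
    cmean r (fun z => f z * (g z)^*).
Proof.
move=> df dg r0 rr; have [D [q [D0 q01 H]]] := taylor_approx df (ltW r0) rr.
have bf := bmc_der df (ltW r0) rr; have bg := bmc_der dg (ltW r0) rr.
have [B B0 hB] := circle_bound bg.
apply: (@cvg_geom_bound _ _ (D * B) q q01) => N.
have bP : bmc r (fun z => \sum_(n < N) taylor_coef f n * z ^+ n).
  by apply: bmc_sum => i; apply: bmcM; [exact: bmc_cst|apply: bmcX; exact: bmc_id].
have -> : \sum_(n < N) taylor_coef f n * (taylor_coef g n)^* * (r ^+ (2 * n))%:C%C =
    cmean r (fun z => (\sum_(n < N) taylor_coef f n * z ^+ n) * (g z)^*).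
  have bi (i : 'I_N) : bmc r (fun z => z ^+ i * (g z)^*).
    by apply: bmcM; [apply: bmcX; exact: bmc_id|exact: bmcJ].
  rewrite (@cmean_ext r _ (fun z => \sum_(n < N) taylor_coef f n * (z ^+ n * (g z)^*))).
    rewrite cmean_sum; last by move=> i; apply: bmcM; [exact: bmc_cst|exact: bi].
    by apply: eq_bigr => i _; rewrite cmeanZ// (cmean_monomialJ i dg r0 rr) mulrA.
  by move=> t; rewrite mulr_suml; apply: eq_bigr => i _; rewrite mulrA.
rewrite cmodBC -cmeanB; [|by apply: bmcM => //; exact: bmcJ|by apply: bmcM => //; exact: bmcJ].
apply: cmean_bound.
  by apply: bmcB; apply: bmcM => //; exact: bmcJ.
move=> t ht; rewrite -mulrBl cmodM cmodJ mulrAC; apply: ler_pM; rewrite ?cmod_ge0//; exact: hB.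
Qed.

Lemma parseval_partial_Re f r N :
  complex.Re (\sum_(n < N) taylor_coef f n * (taylor_coef f n)^* * (r ^+ (2 * n))%:C%C) =
  \sum_(n < N) cmod (taylor_coef f n) ^+ 2 * r ^+ (2 * n).
Proof.
elim: N => [|N IH]; first by rewrite !big_ord0.
by rewrite !big_ord_recr /= cReD IH mulJ_cmod cReM /= mulr0 subr0.
Qed.

Lemma bessel f rho r N : (forall z, cmod z < rho -> derivable f z 1) -> 0 < r -> r < rho ->
  \sum_(n < N) cmod (taylor_coef f n) ^+ 2 * r ^+ (2 * n) <= rmean r (fun z => cmod (f z) ^+ 2).
Proof.
move=> df r0 rr; have bf := bmc_der df (ltW r0) rr.
pose u N : R := \sum_(n < N) cmod (taylor_coef f n) ^+ 2 * r ^+ (2 * n).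
have H : u @ \oo --> rmean r (fun z => cmod (f z) ^+ 2).
  have H0 := cvg_Re eventually_filter (parseval_cvg df df r0 rr); rewrite rmean_sqr// in H0.
  rewrite (funext (parseval_partial_Re f r)) in H0; exact: H0.
have nd : nondecreasing_seq u.
  apply/nondecreasing_seqP => n; rewrite /u big_ord_recr /= lerDl.
  by apply: mulr_ge0; [exact: sqr_ge0|apply: exprn_ge0; exact: ltW].
by have := nondecreasing_cvgn_le nd (cvgP _ H) N; rewrite (cvg_lim _ H).
Qed.

(** The n-th term carries a factor r^(2n) <= 1, so a bound on the coefficients bounds the mean at
    every radius. Together with [bessel] this passes between norms and means. *)
Lemma parseval_le f rho r B : (forall z, cmod z < rho -> derivable f z 1) -> 0 < r -> r < rho -> r <= 1 ->
  (forall N, \sum_(n < N) cmod (taylor_coef f n) ^+ 2 <= B) ->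
  rmean r (fun z => cmod (f z) ^+ 2) <= B.
Proof.
move=> df r0 rr r1 hB; have bf := bmc_der df (ltW r0) rr.
have H := cvg_Re eventually_filter (parseval_cvg df df r0 rr); rewrite rmean_sqr// in H.
rewrite (funext (parseval_partial_Re f r)) /= in H.
rewrite -(cvg_lim _ H)//; apply: limr_le; first exact: (cvgP _ H).
apply: nearW => N; apply: le_trans (hB N).
apply: ler_sum => n _; rewrite -[X in _ <= X]mulr1; apply: ler_wpM2l; first exact: sqr_ge0.
by apply: exprn_ile1 => //; exact: ltW.
Qed.

End CircleMeans.

(** * Continuation across the circle *)

Section AlmostEverywhere.
Variable R : realType.
Notation mu := (@lebesgue_measure R).

(** The translated measure agrees with Lebesgue measure on half-open intervals. Translation serves
    to carry almost-everywhere statements on [0, 2 pi] to arcs that cross the angle 0. *)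
Lemma lebesgue_shift (c : R) (A : set R) : measurable A -> mu ((fun t => t + c) @^-1` A) = mu A.
Proof.
have ms : measurable_fun [set: R] (fun t : R => t + c) by apply: measurable_funD.
pose nu := measure_function_pushforward__canonical__measure_function_Measure
  mu (f := (fun t : measurableTypeR R => (t + c : measurableTypeR R))) ms.
move=> mA; rewrite -[LHS]/(nu A); apply/esym; apply: (@lebesgue_measure_unique R nu) => //.
move=> _ [[a b] _ <-]; rewrite /nu /= /pushforward /=.
have -> : (fun t => t + c) @^-1` `]a, b] = `]a - c, b - c]%classic.
  by apply/seteqP; split => t /=; rewrite !in_itv/= ltrBlDr lerBrDr.
rewrite !lebesgue_measure_itv/= !lte_fin ltrD2r; case: ifP => // _.
by rewrite -!EFinB; congr EFin; ring.
Qed.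

Lemma ae_shift (c : R) (P : R -> Prop) : {ae mu, forall t, P t} -> {ae mu, forall t, P (t + c)}.
Proof.
move=> [A [mA A0 NA]]; exists ((fun t => t + c) @^-1` A); split.
- rewrite -[X in measurable X]setTI.
  have ms : measurable_fun [set: R] (fun t : R => t + c) by apply: measurable_funD.
  exact: ms.
- by rewrite lebesgue_shift.
- by move=> t nP; apply: NA.
Qed.

Lemma ae_neq (x : R) : {ae mu, forall t, t != x}.
Proof.
exists [set x]; split => //; first by rewrite lebesgue_measure_set1.
by move=> t /= /negP; rewrite negbK => /eqP.
Qed.

Lemma ae_imp (P Q : R -> Prop) : (forall t, P t -> Q t) -> {ae mu, forall t, P t} -> {ae mu, forall t, Q t}.
Proof. by move=> PQ; apply: (@filterS _ (almost_everywhere mu)). Qed.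

Lemma ae_and (P Q : R -> Prop) : {ae mu, forall t, P t} -> {ae mu, forall t, Q t} ->
  {ae mu, forall t, P t /\ Q t}.
Proof. by move=> hP hQ; exact: (@filterI _ (almost_everywhere mu) _ _ _ hP hQ). Qed.

Lemma ae_exists (P : R -> Prop) (a b : R) : a < b -> {ae mu, forall t, P t} -> exists2 t, a < t < b & P t.
Proof.
move=> ab [A [mA A0 NA]]; apply: contrapT => H.
have S : `]a, b[%classic `<=` A.
  move=> t; rewrite /= in_itv/= => tab; apply: NA => Pt; apply: H; by exists t.
have : (mu `]a, b[%classic <= mu A)%E by apply: le_measure; rewrite ?inE.
by rewrite A0 lebesgue_measure_itv/= lte_fin ab -EFinB lee_fin leNgt subr_gt0 ab.
Qed.

End AlmostEverywhere.

(** * Limits of contour integrals at the unit circle *)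

Section BoundaryTools.
Variable R : realType.
Notation mu := (@lebesgue_measure R).
Implicit Types (f g U V F : Cplx R -> Cplx R) (z w : Cplx R) (r t a b c x y : R).

(** The radii 1 - (1 - a) / (n + 1), which start at a and tend to 1 from below; a sequence, for the
    sake of dominated convergence. *)
Definition rad a (n : nat) : R := 1 + (a - 1) * harmonic n.

Lemma rad_itv a n : 0 <= a -> a < 1 -> a <= rad a n < 1.
Proof.
move=> a0 a1; have /andP[h0 h1] := harmonic_itv R n.
have hp : (0 : R) < harmonic n by rewrite /harmonic invr_gt0 ltr0n.
by rewrite /rad; apply/andP; split; nra.
Qed.

Lemma cvg_rad a : rad a n @[n --> \oo] --> (1 : R).
Proof. exact: cvg_lin_harmonic. Qed.

Lemma at_left_rad (h : R -> R) (l a : R) : 0 <= a -> a < 1 -> h r @[r --> 1^'-] --> l ->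
  h (rad a n) @[n --> \oo] --> l.
Proof.
move=> a0 a1 /cvg_at_leftP H; apply: H; split; last exact: cvg_rad.
by move=> n; case/andP: (rad_itv n a0 a1).
Qed.

(** The end point b is negligible for measurability, and its single value enters the bound through a
    maximum; this covers rays that end on the unit circle. *)
Lemma rbm_open a b (g : R -> R) B : (forall r, a <= r < b -> {for r, continuous g}) ->
  (forall r, a <= r < b -> `|g r| <= B) -> rbm a b g.
Proof.
move=> cg hB; split.
  apply/measurable_fun_itv_bndo_bndcP; apply: subspace_continuous_measurable_fun => //.
  by apply: continuous_in_subspaceT => r; rewrite inE/= in_itv/= => /cg.
exists (Num.max B `|g b|) => r /andP[ar]; rewrite le_eqVlt => /predU1P[->|rb].
  by rewrite le_max lexx orbT.
by rewrite le_max hB// ar.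
Qed.

Lemma bm_open a b (g : R -> Cplx R) B : (forall r, a <= r < b -> {for r, continuous g}) ->
  (forall r, a <= r < b -> cmod (g r) <= B) -> bm a b g.
Proof.
move=> cg hB; split; apply: (@rbm_open _ _ _ B) => r hr.
- by apply: cvg_Re; exact: cg.
- by apply: le_trans (cmod_Re _) _; exact: hB.
- by apply: cvg_Im; exact: cg.
- by apply: le_trans (cmod_Im _) _; exact: hB.
Qed.

(** The other three sides of the rectangle, run from the start of the outer arc to its end. For b =
    1 it stands in for an integral over an arc of the unit circle, where the integrand has no
    meaningful values. *)
Definition edge F a b t1 t2 : Cplx R := arc F a t1 t2 + ray F t2 a b - ray F t1 a b.

Lemma box_edge F a b t1 t2 : box F a b t1 t2 = 0 -> arc F b t1 t2 = edge F a b t1 t2.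
Proof.
rewrite /box /edge; move: (arc F b t1 t2) (arc F a t1 t2) (ray F t1 a b) (ray F t2 a b) => p q s v H.
by apply/eqP; rewrite -subr_eq0; apply/eqP; rewrite -[RHS]H; ring.
Qed.

Lemma ray_limit F a a' t B : 0 <= a -> a <= a' -> a' < 1 ->
  (forall r, a <= r < 1 -> {for polar r t, continuous F}) ->
  (forall r, a <= r < 1 -> cmod (F (polar r t)) <= B) ->
  ray F t a (rad a' n) @[n --> \oo] --> ray F t a 1.
Proof.
move=> a0 aa a1 cF hB; have a'0 := le_trans a0 aa.
(* The value of F at the end point on the unit circle is arbitrary; adding its modulus bounds the
   integrand on the closed ray. *)
pose B' := B + cmod (F (polar 1 t)) .
have B0 : 0 <= B by apply: le_trans (hB a _); rewrite ?cmod_ge0// lexx (le_lt_trans aa).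
have hB' r : a <= r <= 1 -> cmod (F (polar r t) * polar 1 t) <= B'.
  move=> /andP[ar]; rewrite cmodM cmod_polar1 mulr1 le_eqVlt => /predU1P[->|r1].
    by rewrite /B' lerDr.
  by apply: le_trans (hB r _) _; rewrite ?ar// /B' lerDl cmod_ge0.
have bF : bm a 1 (fun r => F (polar r t) * polar 1 t).
  apply: (@bm_open _ _ _ B) => r hr.
    by apply: contM; [apply: cont_ray; exact: cF|exact: cont_cst].
  by rewrite cmodM cmod_polar1 mulr1; exact: hB.
apply/cvg_cplxP => e e0.
have /cvgrPdist_le/(_ _ e0) : (B' * (1 - rad a' n)) @[n --> \oo] --> B' * (1 - 1).
  by apply: cvgM; [exact: cvg_cst|apply: cvgB; [exact: cvg_cst|exact: cvg_rad]].
rewrite subrr mulr0; apply: filterS => n; rewrite sub0r normrN => H.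
have /andP[r1 r2] := rad_itv n a'0 a1.
have E : ray F t a 1 = ray F t a (rad a' n) + cint (rad a' n) 1 (fun r => F (polar r t) * polar 1 t).
  by apply: cint_split => //; [exact: le_trans r1|exact: ltW].
rewrite E opprD addrA subrr add0r cmodN; apply: le_trans (le_trans (ler_norm _) H).
apply: cint_bound; first exact: ltW.
  by apply: bm_sub bF => //; exact: le_trans r1.
by move=> r /andP[h1 h2]; apply: hB'; rewrite h2 (le_trans aa)// (le_trans r1).
Qed.

Lemma ccvgD (T : Type) (L : set_system T) (FL : Filter L) (h k : T -> Cplx R) (l m : Cplx R) :
  h @ L --> l -> k @ L --> m -> (h t + k t) @[t --> L] --> (l + m).
Proof. by move=> H K; exact: (cvgD H K). Qed.

Lemma ccvgM (T : Type) (L : set_system T) (FL : Filter L) (h k : T -> Cplx R) (l m : Cplx R) :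
  h @ L --> l -> k @ L --> m -> (h t * k t) @[t --> L] --> (l * m).
Proof. by move=> H K; exact: (cvgM H K). Qed.

Lemma ccvg_cst (T : Type) (L : set_system T) (FL : Filter L) (l : Cplx R) :
  (fun _ : T => l) @ L --> l.
Proof. exact: cvg_cst. Qed.

Lemma edge_limit F a a' t1 t2 B : 0 <= a -> a <= a' -> a' < 1 ->
  (forall r t, a <= r < 1 -> t = t1 \/ t = t2 -> {for polar r t, continuous F}) ->
  (forall r t, a <= r < 1 -> t = t1 \/ t = t2 -> cmod (F (polar r t)) <= B) ->
  edge F a (rad a' n) t1 t2 @[n --> \oo] --> edge F a 1 t1 t2.
Proof.
move=> a0 aa a1 cF hB.
have h1 : t1 = t1 \/ t1 = t2 by left.
have h2 : t2 = t1 \/ t2 = t2 by right.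
have L1 := @ray_limit F a a' t1 B a0 aa a1 (fun r hr => cF r t1 hr h1) (fun r hr => hB r t1 hr h1).
have L2 := @ray_limit F a a' t2 B a0 aa a1 (fun r hr => cF r t2 hr h2) (fun r hr => hB r t2 hr h2).
pose v1 n := ray F t1 a (rad a' n); pose v2 n := ray F t2 a (rad a' n).
have K0 : (fun _ : nat => arc F a t1 t2) @ \oo --> arc F a t1 t2 by exact: ccvg_cst.
have K1 := @ccvgD _ _ eventually_filter _ v2 _ _ K0 L2.
have K2 := @ccvgB R _ _ eventually_filter _ v1 _ _ K1 L1.
have E n : edge F a (rad a' n) t1 t2 = arc F a t1 t2 + v2 n - v1 n by [].
by rewrite (funext E); exact: K2.
Qed.

Section ArcLimit.
Variables (U V : Cplx R -> Cplx R) (a t1 t2 M : R).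
Hypotheses (a0 : 0 < a) (t12 : t1 <= t2).
Hypothesis dU : forall r t, a <= r < 1 -> t1 <= t <= t2 -> derivable U (polar r t) 1.
Hypothesis dV : forall r t, a <= r < 1 -> t1 <= t <= t2 -> derivable V (polar r t) 1.
Hypothesis hU : forall r t, a <= r < 1 -> t1 <= t <= t2 -> cmod (U (polar r t)) <= M.
Hypothesis hV : forall r t, a <= r < 1 -> t1 <= t <= t2 -> cmod (V (polar r t)) <= M.
Hypothesis UV : forall a', a <= a' -> a' < 1 -> {ae mu, forall t, t1 <= t <= t2 ->
  cmod (U (polar (rad a' n) t) - (V (polar (rad a' n) t))^*) @[n --> \oo] --> (0 : R)}.

(** On |z| = 1 the conjugate of [refl_kernel V w z * (ci R * z)] is -conj(V(z)) / (z - w) times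
    [ci R * z], that is, minus a Cauchy integrand of conj(V). Unlike conj(V), the kernel is
    holomorphic in z, so its arcs can be moved inwards. *)
Definition refl_kernel V w z : Cplx R := V z / (z * (1 - w^* * z)).

Let pol0 r t : a <= r -> polar r t != 0.
Proof. by move=> ar; rewrite -cmod_gt0 cmod_polar normr_gt0 gt_eqF// (lt_le_trans a0). Qed.

Let den w z : cmod w < 1 -> cmod z <= 1 -> 1 - cmod w <= cmod (1 - w^* * z).
Proof.
move=> w1 z1; apply: le_trans (cmod_ge_sub _ _); rewrite cmod1 cmodM cmodJ lerD2l lerN2.
by rewrite ler_piMr// cmod_ge0.
Qed.

Let den0 w z : cmod w < 1 -> cmod z <= 1 -> 1 - w^* * z != 0.
Proof. by move=> w1 z1; rewrite -cmod_gt0; apply: lt_le_trans (den w1 z1); rewrite subr_gt0. Qed.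

Lemma der_refl_kernel w r t : cmod w < 1 -> a <= r < 1 -> t1 <= t <= t2 ->
  derivable (refl_kernel V w) (polar r t) 1.
Proof.
move=> w1 hr ht; have /andP[ar r1] := hr.
have c1 : cmod (polar r t) <= 1 by rewrite cmod_polar gtr0_norm ?(ltW r1)// (lt_le_trans a0).
apply: (@derM R V (fun z => (z * (1 - w^* * z))^-1)); first exact: dV.
apply: (@derV R (fun z => z * (1 - w^* * z))); first by rewrite mulf_neq0 ?pol0 ?den0.
apply: (@derM R id (fun z => 1 - w^* * z)); first exact: der_id.
apply: (@derB R (fun=> 1) (fun z => w^* * z)); first exact: der_cst.
by apply: (@derM R (fun=> w^*) id); [exact: der_cst|exact: der_id].
Qed.

Lemma refl_kernel_bound w r t : cmod w < 1 -> a <= r < 1 -> t1 <= t <= t2 ->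
  cmod (refl_kernel V w (polar r t)) <= M / (a * (1 - cmod w)).
Proof.
move=> w1 hr ht; have /andP[ar r1] := hr.
have r0 : 0 < r by apply: lt_le_trans ar.
have c1 : cmod (polar r t) <= 1 by rewrite cmod_polar gtr0_norm// ltW.
have k0 : 0 < 1 - cmod w by rewrite subr_gt0.
rewrite /refl_kernel cmodM cmodV; apply: ler_pM; rewrite ?cmod_ge0 ?invr_ge0 ?cmod_ge0//; first exact: hV.
have h : a * (1 - cmod w) <= cmod (polar r t * (1 - w^* * polar r t)).
  rewrite cmodM; apply: ler_pM; rewrite ?(ltW a0) ?(ltW k0)//; last exact: den.
  by rewrite cmod_polar gtr0_norm.
by rewrite lef_pV2// posrE; [apply: lt_le_trans h|]; rewrite mulr_gt0.
Qed.

(** As U and conj(V) have the same boundary values, the Cauchy integrand of U and the conjugate of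
    the reflected one cancel in the limit, by dominated convergence. The arc of the reflected kernel
    is an edge by Goursat, and edges have limits. *)
Lemma arc_limit w a' : cmod w < 1 -> a <= a' -> (1 + cmod w) / 2 <= a' -> a' < 1 ->
  arc (fun z => U z / (z - w)) (rad a' n) t1 t2 @[n --> \oo] -->
  - (edge (refl_kernel V w) a 1 t1 t2)^*.
Proof.
move=> w1 aa wa a1; have a'0 : 0 <= a' by apply: le_trans aa; exact: ltW.
pose F := refl_kernel V w.
have inS n : a <= rad a' n < 1.
  by have /andP[h1 h2] := rad_itv n a'0 a1; rewrite h2 (le_trans aa).
have cF r t : a <= r < 1 -> t1 <= t <= t2 -> {for polar r t, continuous F}.
  by move=> hr ht; apply: derivable_continuous; exact: der_refl_kernel.
have tin t : t = t1 \/ t = t2 -> t1 <= t <= t2 by case=> ->; rewrite lexx t12.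
have LE := @edge_limit F a a' t1 t2 _ (ltW a0) aa a1 (fun r t hr ht => cF r t hr (tin t ht))
  (fun r t hr ht => refl_kernel_bound w1 hr (tin t ht)).
have AE n : arc F (rad a' n) t1 t2 = edge F a (rad a' n) t1 t2.
  have /andP[h1 h2] := inS n; have B0 : box F a (rad a' n) t1 t2 = 0.
    apply: (goursat h1 t12) => r t /andP[ar rr] ht.
    by apply: (der_refl_kernel w1 _ ht); rewrite ar (le_lt_trans rr).
  exact: box_edge B0.
(* Half the distance from w to the unit circle: the radii are at least (1 + |w|) / 2, so the arcs
   stay at distance [ka] from w. *)
pose ka := (1 - cmod w) / 2; have ka0 : 0 < ka by rewrite /ka divr_gt0// subr_gt0.
have rw n t : ka <= cmod (polar (rad a' n) t - w).
  apply: le_trans (cmod_ge_sub _ _); have /andP[h1 h2] := rad_itv n a'0 a1.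
  by rewrite cmod_polar ger0_norm ?(le_trans a'0)// /ka; move: wa h1; lra.
have rw0 n t : polar (rad a' n) t - w != 0 by rewrite -cmod_gt0; apply: lt_le_trans (rw n t).
have cn n t : cmod (polar (rad a' n) t) <= 1.
  by have /andP[h1 h2] := rad_itv n a'0 a1; rewrite cmod_polar ger0_norm ?(ltW h2)// (le_trans a'0).
pose D n t := U (polar (rad a' n) t) / (polar (rad a' n) t - w) * (ci R * polar (rad a' n) t) +
  (F (polar (rad a' n) t) * (ci R * polar (rad a' n) t))^*.
pose G z := U z / (z - w).
have cG n t : t1 <= t <= t2 -> {for polar (rad a' n) t, continuous G}.
  move=> ht; apply: derivable_continuous; apply: (@derM R U (fun z => (z - w)^-1)); first exact: dU.
  apply: (@derV R (fun z => z - w)); first exact: rw0.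
  by apply: (@derB R id (fun=> w)); [exact: der_id|exact: der_cst].
have bG n : bm t1 t2 (fun t => G (polar (rad a' n) t) * (ci R * polar (rad a' n) t)).
  by apply: bm_arc => t ht; exact: cG.
have bF n : bm t1 t2 (fun t => F (polar (rad a' n) t) * (ci R * polar (rad a' n) t)).
  by apply: bm_arc => t ht; apply: cF.
have DE n : cint t1 t2 (D n) = arc G (rad a' n) t1 t2 + (arc F (rad a' n) t1 t2)^*.
  by rewrite /arc -(cintJ (bF n)); apply: (cintD (bG n)); exact: bmJ.
have Dest n t : t1 <= t <= t2 ->
    cmod (D n t) <= cmod (U (polar (rad a' n) t) - (V (polar (rad a' n) t))^*) / ka +
      M * (1 - rad a' n ^+ 2) / ka ^+ 2.
  move=> ht; have := rw0 n t; have := cn n t; have := rw n t.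
  have := pol0 t (proj1 (andP (inS n))); have := hV (inS n) ht.
  have Ez := mulJ_cmod (polar (rad a' n) t).
  rewrite cmod_polar real_normK ?num_real// in Ez.
  rewrite /D /F /refl_kernel; set r := rad a' n in Ez *; set z := polar r t in Ez *.
  move: (U z) (V z) => uz vz hv z0 rwz cz zw0.
  have d0 := den0 w1 cz.
  have zJ : (z^* : Cplx R) != 0 by rewrite -cmod_gt0 cmodJ cmod_gt0.
  have dJ : (1 - w^* * z)^* = 1 - w * z^* by rewrite rmorphB rmorph1 rmorphM /= conjCK.
  have d0' : 1 - w * z^* != 0 by rewrite -dJ -cmod_gt0 cmodJ cmod_gt0.
  have ciJ : (ci R)^* = - ci R by apply: cplx_eq; rewrite /= ?oppr0.
  have -> : (vz / (z * (1 - w^* * z)) * (ci R * z))^* = - (ci R * (vz^* / (1 - w * z^*))).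
    rewrite !rmorphM fmorphV !rmorphM /= ciJ dJ; field; by rewrite zJ d0'.
  (* Two sources of error: the mismatch of U and conj(V), and the failure of conj z = 1 / z at a
     radius below 1. *)
  have -> : uz / (z - w) * (ci R * z) - ci R * (vz^* / (1 - w * z^*)) =
      ci R * ((uz - vz^*) * (z / (z - w)) + vz^* * (w * (1 - z * z^*) / ((z - w) * (1 - w * z^*)))).
    by field; rewrite zw0 d0'.
  rewrite Ez cmodM cmod_ci mul1r; apply: le_trans (cmodD _ _) _.
  have iz : (cmod (z - w))^-1 <= ka^-1 by rewrite lef_pV2// posrE//; apply: lt_le_trans rwz.
  have iz0 : 0 <= (cmod (z - w))^-1 by rewrite invr_ge0 cmod_ge0.
  apply: lerD.
    rewrite !cmodM cmodV ler_wpM2l ?cmod_ge0// -[X in _ <= X]mul1r.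
    by apply: ler_pM; rewrite ?cmod_ge0.
  have r01 : 0 <= 1 - r ^+ 2.
    have /andP[h1 h2] := rad_itv n a'0 a1.
    by rewrite subr_ge0 exprn_ile1 ?(ltW h2)// (le_trans a'0).
  have -> : 1 - (r ^+ 2)%:C%C = (1 - r ^+ 2)%:C%C :> Cplx R by rewrite rmorphB rmorph1.
  have kd : ka <= cmod (1 - w * z^*).
    rewrite -dJ cmodJ; apply: le_trans (den w1 cz); rewrite /ka; move: w1; lra.
  have id : (cmod (1 - w * z^*))^-1 <= ka^-1 by rewrite lef_pV2// posrE//; apply: lt_le_trans kd.
  have id0 : 0 <= (cmod (1 - w * z^*))^-1 by rewrite invr_ge0 cmod_ge0.
  have M0 : 0 <= M by apply: le_trans hv; exact: cmod_ge0.
  rewrite cmodM cmodJ cmodM cmodV [cmod ((z - w) * _)]cmodM [cmod (w * _)]cmodM cmodC (ger0_norm r01) invfM.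
  have -> : M * (1 - r ^+ 2) / ka ^+ 2 = M * ((1 - r ^+ 2) * (ka^-1 * ka^-1)).
    by rewrite expr2 invfM !mulrA.
  move: r01; set q := 1 - r ^+ 2 => r01.
  have h1 : cmod w * q <= q by rewrite -[X in _ <= X]mul1r ler_wpM2r// ltW.
  have h2 := ler_pM iz0 id0 iz id.
  have h3 := ler_pM (mulr_ge0 (cmod_ge0 w) r01) (mulr_ge0 iz0 id0) h1 h2.
  exact: (ler_pM (cmod_ge0 _) (mulr_ge0 (mulr_ge0 (cmod_ge0 w) r01) (mulr_ge0 iz0 id0)) hv h3).
have D0 : cint t1 t2 (D n) @[n --> \oo] --> (0 : Cplx R).
  have M0 : 0 <= M.
    have h1 : t1 <= t1 <= t2 by rewrite lexx.
    exact: le_trans (cmod_ge0 _) (hV (inS 0%N) h1).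
  apply: (@cint_dct0 _ _ _ _ ((M + M) / ka + M / ka ^+ 2)) => //.
  - by move=> n; apply: bmD; [exact: bG|apply: bmJ; exact: bF].
  - move=> n t ht; apply: le_trans (Dest n t ht) _; apply: lerD.
      rewrite ler_wpM2r ?invr_ge0 ?(ltW ka0)//; apply: le_trans (cmodB _ _) _.
      by rewrite cmodJ; apply: lerD; [exact: (hU (inS n) ht)|exact: (hV (inS n) ht)].
    rewrite ler_wpM2r ?invr_ge0 ?sqr_ge0// -[X in _ <= X]mulr1 ler_wpM2l//.
    by rewrite gerBl sqr_ge0.
  move: (UV aa a1); apply: ae_imp => t H ht; have {}H := H ht.
  pose X n := cmod (U (polar (rad a' n) t) - (V (polar (rad a' n) t))^*).
  have S : (X n / ka + M * (1 - rad a' n ^+ 2) / ka ^+ 2) @[n --> \oo] --> 0 / ka + M * (1 - 1 ^+ 2) / ka ^+ 2.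
    apply: cvgD; first by apply: cvgM; [exact: H|exact: cvg_cst].
    apply: cvgM; last exact: cvg_cst.
    apply: cvgM; first exact: cvg_cst.
    apply: cvgB; first exact: cvg_cst.
    rewrite !expr2; under eq_fun do rewrite expr2.
    by apply: cvgM; exact: cvg_rad.
  rewrite mul0r expr1n subrr mulr0 mul0r addr0 in S.
  apply/cvgrPdist_le => e e0; move/cvgrPdist_le: S => /(_ _ e0); apply: filterS => n.
  rewrite !sub0r !normrN (ger0_norm (cmod_ge0 _)) => h; apply: le_trans (Dest n t ht) _.
  exact: le_trans (ler_norm _) h.
have AJ : (arc F (rad a' n) t1 t2)^* @[n --> \oo] --> (edge F a 1 t1 t2)^*.
  have AF : arc F (rad a' n) t1 t2 @[n --> \oo] --> edge F a 1 t1 t2 by rewrite (funext AE); exact: LE.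
  exact: (cvgJ eventually_filter AF).
pose c1 n := cint t1 t2 (D n); pose c2 n := (arc F (rad a' n) t1 t2)^*.
have L := @ccvgB R _ _ eventually_filter c1 c2 _ _ D0 AJ; rewrite sub0r in L.
have E n : c1 n - c2 n = arc G (rad a' n) t1 t2 by rewrite /c1 DE addrK.
by rewrite (funext E) in L; exact: L.
Qed.

End ArcLimit.
End BoundaryTools.

(** * Holomorphic dependence of path integrals on the pole *)

Section PathIntegrals.
Variable R : realType.
Implicit Types (U V : Cplx R -> Cplx R) (zt k : R -> Cplx R) (w : Cplx R) (x y d : R).

Lemma cvg_zero_const (l : Cplx R) : (fun _ : nat => (0 : Cplx R)) @ \oo --> l -> l = 0.
Proof.
move/cvg_cplxP => H; apply/eqP; rewrite -cmod_eq0 eq_le cmod_ge0 andbT.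
apply/ler_addgt0Pl => e e0; rewrite addr0; have [N _ hN] := H e e0.
by have := hN N (leqnn N); rewrite /= sub0r cmodN.
Qed.

Lemma der_path1 x y U zt k w0 d : x <= y -> bm x y (fun t => U (zt t)) ->
  (forall t, x <= t <= y -> {for t, continuous zt}) ->
  (forall t, x <= t <= y -> {for t, continuous k}) -> 0 < d ->
  (forall t, x <= t <= y -> d <= cmod (zt t - w0)) ->
  derivable (fun w => cint x y (fun t => U (zt t) / (zt t - w) * k t)) w0 1.
Proof.
move=> xy bU cz ck d0 hd.
have bk : bm x y (fun t => U (zt t) * k t) by apply: bmM => //; exact: bm_cont.
have H := cauchy_type_deriv 1 xy bk cz d0 hd.
have E w : cint x y (fun t => U (zt t) * k t / (zt t - w) ^+ 1) = cint x y (fun t => U (zt t) / (zt t - w) * k t).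
  by apply: cint_ext => t _; rewrite expr1 mulrAC.
by rewrite (funext E) in H; exact: (cderiv_derivable H).
Qed.

(** Although conj(w) occurs inside, the outer conjugation restores w: the integral is one of Cauchy
    type along the reflected path 1 / conj([zt]), hence holomorphic in w off that path. *)
Lemma der_path2 x y V zt k w0 d : x <= y -> bm x y (fun t => V (zt t)) ->
  (forall t, x <= t <= y -> {for t, continuous zt}) ->
  (forall t, x <= t <= y -> zt t != 0) ->
  (forall t, x <= t <= y -> {for t, continuous k}) -> 0 < d ->
  (forall t, x <= t <= y -> d <= cmod (((zt t)^*)^-1 - w0)) ->
  derivable (fun w => (cint x y (fun t => V (zt t) / (zt t * (1 - w^* * zt t)) * k t))^*) w0 1.
Proof.
move=> xy bV cz z0 ck d0 hd.
have zJ t : x <= t <= y -> (zt t)^* != 0 by move=> ht; rewrite -cmod_gt0 cmodJ cmod_gt0 z0.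
have czJ t : x <= t <= y -> {for t, continuous (fun t => ((zt t)^*)^-1)}.
  by move=> ht; apply: (@contV R R (fun t => (zt t)^*)); [exact: zJ|apply: contJ; exact: cz].
have bk : bm x y (fun t => (V (zt t) * (k t / zt t))^* * ((zt t)^*)^-1).
  apply: bmM; last exact: bm_cont.
  apply: bmJ; apply: bmM => //; apply: bm_cont => t ht.
  by apply: contM; [exact: ck|apply: contV; [exact: z0|exact: cz]].
have H := cauchy_type_deriv 1 xy bk czJ d0 hd.
apply: (derivable_near _ (cderiv_derivable H)); exists d => // w hw.
have nz t : x <= t <= y -> ((zt t)^*)^-1 - w != 0.
  move=> ht; rewrite subr_eq0; apply: contraTneq hw => <-; rewrite -leNgt; exact: hd.
have nz1 t : x <= t <= y -> 1 - w * (zt t)^* != 0.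
  move=> ht; have -> : 1 - w * (zt t)^* = (zt t)^* * (((zt t)^*)^-1 - w).
    by rewrite mulrBr divff ?zJ// [_ * w]mulrC.
  by rewrite mulf_neq0 ?nz ?zJ.
have dJ t : (1 - w^* * zt t)^* = 1 - w * (zt t)^*.
  by rewrite rmorphB rmorph1 rmorphM /= conjCK.
have nz2 t : x <= t <= y -> 1 - w^* * zt t != 0.
  by move=> ht; rewrite -cmod_gt0 -cmodJ dJ cmod_gt0 nz1.
rewrite -cintJ.
  apply: cint_ext => t ht; rewrite expr1 !rmorphM !fmorphV !rmorphM /= dJ.
  have h1 := nz t ht; have h2 := nz1 t ht; have h3 := zJ t ht.
  move: h1; rewrite -(mulrI_eq0 _ (mulfI h3)) mulrBr divff// [_ * w]mulrC => _.
  by field; rewrite h3 h2.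
apply: bmM; last exact: bm_cont.
apply: bmM => //; apply: bm_cont => t ht; apply: (@contV R R (fun t => zt t * (1 - w^* * zt t))).
  by rewrite mulf_neq0 ?z0 ?nz2.
apply: contM; first exact: cz.
apply: contB; first exact: cont_cst.
by apply: contM; [exact: cont_cst|exact: cz].
Qed.

Lemma cint_dq x y U zt k w : 
  (forall t, x <= t <= y -> {for t, continuous (fun t => U (zt t))}) ->
  (forall t, x <= t <= y -> {for t, continuous zt}) ->
  (forall t, x <= t <= y -> {for t, continuous k}) ->
  (forall t, x <= t <= y -> zt t != w) ->
  cint x y (fun t => dq U w (zt t) * k t) =
  cint x y (fun t => U (zt t) / (zt t - w) * k t) - U w * cint x y (fun t => 1 / (zt t - w) * k t).
Proof.
move=> cU cz ck zw.
have ci t : x <= t <= y -> {for t, continuous (fun t => (zt t - w)^-1)}.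
  move=> ht; apply: (@contV R R (fun t => zt t - w)); first by rewrite subr_eq0 zw.
  by apply: contB; [exact: cz|exact: cont_cst].
have b1 : bm x y (fun t => 1 / (zt t - w) * k t).
  apply: bm_cont => t ht; apply: contM; last exact: ck.
  by apply: contM; [exact: cont_cst|exact: ci].
have b2 : bm x y (fun t => U (zt t) / (zt t - w) * k t).
  apply: bm_cont => t ht; apply: contM; last exact: ck.
  by apply: contM; [exact: cU|exact: ci].
rewrite -(cintZ _ b1) -(cintB b2); last by apply: bmM; [exact: bm_cst|exact: b1].
apply: cint_ext => t ht; rewrite dqE ?zw//; ring.
Qed.

End PathIntegrals.

(** * Gluing across the outer arc of a sector *)

Section Sector.
Variable R : realType.
Notation mu := (@lebesgue_measure R).
Variables (u : Cplx R -> Cplx R) (a t1 t2 M : R).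
Hypotheses (a0 : 0 < a) (a1 : a < 1) (t12 : t1 <= t2).
Hypothesis du : forall z, cmod z < 1 -> derivable u z 1.
Hypothesis hu : forall r t, a <= r < 1 -> t1 <= t <= t2 -> cmod (u (polar r t)) <= M.
Hypothesis hv : forall r t, a <= r < 1 -> t1 <= t <= t2 -> u (polar r t) != 0 /\ cmod (u (polar r t))^-1 <= M.
Hypothesis hb : {ae mu, forall t, t1 <= t <= t2 -> cmod (u (polar r t)) @[r --> 1^'-] --> (1 : R)}.

(** A margin between w and the three sides used by [edge], and also their mirror images in the unit
    circle, which are the poles of the reflected integrals. The outer arc is left free, so that w
    may cross it. *)
Definition far w (d : R) := [/\ 0 < d,
  forall t, t1 <= t <= t2 -> d <= cmod (polar a t - w) /\ d <= cmod (((polar a t)^*)^-1 - w) &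
  forall r t, a <= r <= 1 -> t = t1 \/ t = t2 -> d <= cmod (polar r t - w) /\ d <= cmod (((polar r t)^*)^-1 - w)].

(** For |w| < 1 and U = conj(V) on the circle, this is minus the limit of the Cauchy integral of U
    around the whole rectangle, with the outer arc rewritten by [arc_limit]. In this form it is
    holomorphic in w on both sides of the outer arc. *)
Definition glue (U V : Cplx R -> Cplx R) (w : Cplx R) : Cplx R :=
  (edge (refl_kernel V w) a 1 t1 t2)^* + edge (fun z => U z / (z - w)) a 1 t1 t2.

Let in1 r t : a <= r -> r < 1 -> cmod (polar r t) < 1.
Proof. by move=> ar r1; rewrite cmod_polar ger0_norm// (le_trans (ltW a0)). Qed.
Let pol0 r t : a <= r -> polar r t != 0.
Proof. by move=> ar; rewrite -cmod_gt0 cmod_polar normr_gt0 gt_eqF// (lt_le_trans a0). Qed.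
Let tin t : t = t1 \/ t = t2 -> t1 <= t <= t2.
Proof. by case=> ->; rewrite lexx t12. Qed.

Lemma der_glue (U V : Cplx R -> Cplx R) w0 d :
  (forall r t, a <= r < 1 -> t1 <= t <= t2 -> derivable U (polar r t) 1) ->
  (forall r t, a <= r < 1 -> t1 <= t <= t2 -> derivable V (polar r t) 1) ->
  (forall r t, a <= r < 1 -> t1 <= t <= t2 -> cmod (U (polar r t)) <= M) ->
  (forall r t, a <= r < 1 -> t1 <= t <= t2 -> cmod (V (polar r t)) <= M) ->
  far w0 d -> derivable (glue U V) w0 1.
Proof.
move=> dU dV hU hV [d0 f1 f2].
have ha : a <= a < 1 by rewrite lexx a1.
have bA (F : Cplx R -> Cplx R) : (forall r t, a <= r < 1 -> t1 <= t <= t2 -> derivable F (polar r t) 1) ->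
    bm t1 t2 (fun t => F (polar a t)).
  by move=> dF; apply: bm_cont => t ht; apply: cont_arc; apply: derivable_continuous; exact: dF.
have bR (F : Cplx R -> Cplx R) (t : R) : (forall r t, a <= r < 1 -> t1 <= t <= t2 -> derivable F (polar r t) 1) ->
    (forall r t, a <= r < 1 -> t1 <= t <= t2 -> cmod (F (polar r t)) <= M) -> t = t1 \/ t = t2 ->
    bm a 1 (fun r => F (polar r t)).
  move=> dF hF /tin ht; apply: (@bm_open _ _ _ _ M) => r hr; last exact: hF.
  by apply: cont_ray; apply: derivable_continuous; exact: dF.
have ck (r t : R) : {for t, continuous (fun t : R => ci R * polar r t)}.
  by apply: contM; [exact: cont_cst|exact: polar_cont_t].
have cr (t r : R) : {for r, continuous (fun r : R => polar r t)} by exact: polar_cont_r.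
have cc (t r : R) : {for r, continuous (fun _ : R => polar 1 t : Cplx R)} by exact: cont_cst.
have D1 : derivable (fun w => (arc (refl_kernel V w) a t1 t2)^*) w0 1.
  exact: (@der_path2 R t1 t2 V (polar a) (fun t => ci R * polar a t) w0 d t12 (bA V dV)
    (fun t _ => @polar_cont_t R a t) (fun t _ => pol0 t (lexx a)) (fun t _ => ck a t) d0
    (fun t ht => (f1 t ht).2)).
have D2 t : t = t1 \/ t = t2 -> derivable (fun w => (ray (refl_kernel V w) t a 1)^*) w0 1.
  move=> ht; have H := (@der_path2 R a 1 V (fun r => polar r t) (fun=> polar 1 t) w0 d (ltW a1) (bR V t dV hV ht)
    (fun r _ => cr t r) (fun r hr => pol0 t (proj1 (andP hr))) (fun r _ => cc t r) d0
    (fun r hr => (f2 r t hr ht).2)).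
  by rewrite /ray /refl_kernel; exact: H.
have D3 : derivable (fun w => arc (fun z => U z / (z - w)) a t1 t2) w0 1.
  exact: (@der_path1 R t1 t2 U (polar a) (fun t => ci R * polar a t) w0 d t12 (bA U dU)
    (fun t _ => @polar_cont_t R a t) (fun t _ => ck a t) d0 (fun t ht => (f1 t ht).1)).
have D4 t : t = t1 \/ t = t2 -> derivable (fun w => ray (fun z => U z / (z - w)) t a 1) w0 1.
  move=> ht; have H := (@der_path1 R a 1 U (fun r => polar r t) (fun=> polar 1 t) w0 d (ltW a1) (bR U t dU hU ht)
    (fun r _ => cr t r) (fun r _ => cc t r) d0 (fun r hr => (f2 r t hr ht).1)).
  by rewrite /ray; exact: H.
have e1 : t1 = t1 \/ t1 = t2 by left.
have e2 : t2 = t1 \/ t2 = t2 by right.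
have E : glue U V = (fun w => ((arc (refl_kernel V w) a t1 t2)^* + (ray (refl_kernel V w) t2 a 1)^* -
   (ray (refl_kernel V w) t1 a 1)^*) + (arc (fun z => U z / (z - w)) a t1 t2 +
   ray (fun z => U z / (z - w)) t2 a 1 - ray (fun z => U z / (z - w)) t1 a 1)).
  by apply/funext => w; rewrite /glue /edge rmorphB rmorphD.
rewrite E; apply: derD; (apply: derB; [apply: derD|]).
- exact: D1.
- exact: D2.
- exact: D2.
- exact: D3.
- exact: D4.
- exact: D4.
Qed.

(** The integral of (u(z) - u(w)) / (z - w) around the rectangle vanishes; split it and let the
    outer radius tend to 1. Thus u is a quotient of two [glue] functions, in which the constant of
    Cauchy's formula cancels and its value is irrelevant. *)
Lemma glue_identity w d : cmod w < 1 -> far w d ->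
  u w * glue (fun=> 1) (fun=> 1) w = glue u (fun z => (u z)^-1) w.
Proof.
move=> w1 [d0 f1 f2].
pose a' := Num.max a ((1 + cmod w) / 2).
have aa : a <= a' by rewrite /a' le_max lexx.
have wa : (1 + cmod w) / 2 <= a' by rewrite /a' le_max lexx orbT.
have a'1 : a' < 1 by rewrite /a' gt_max a1 /=; move: w1; lra.
have a'0 : 0 <= a' by apply: le_trans aa; exact: ltW.
(* One of u and 1 / u has modulus at least 1 at any point of the sector, and M bounds both; so M
   also bounds the constant 1. *)
have M1 : 1 <= M.
  have ha : a <= a < 1 by rewrite lexx a1.
  have ht : t1 <= t1 <= t2 by rewrite lexx.
  have [un iu] := hv ha ht; have hh := hu ha ht.
  have c0 : 0 < cmod (u (polar a t1)) by rewrite cmod_gt0.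
  rewrite cmodV in iu; have [h|h] := leP 1 (cmod (u (polar a t1))); first exact: le_trans hh.
  by apply: le_trans iu; rewrite invf_ge1// ltW.
have duS r t : a <= r < 1 -> t1 <= t <= t2 -> derivable u (polar r t) 1.
  by move=> /andP[ar r1] _; apply: du; exact: in1.
have dvS r t : a <= r < 1 -> t1 <= t <= t2 -> derivable (fun z => (u z)^-1) (polar r t) 1.
  by move=> hr ht; apply: derV; [case: (hv hr ht)|exact: duS].
have hvS r t : a <= r < 1 -> t1 <= t <= t2 -> cmod (u (polar r t))^-1 <= M.
  by move=> hr ht; case: (hv hr ht).
have h1S r t : a <= r < 1 -> t1 <= t <= t2 -> cmod (1 : Cplx R) <= M by rewrite cmod1.
have d1S r t : a <= r < 1 -> t1 <= t <= t2 -> derivable (fun _ : Cplx R => (1 : Cplx R)) (polar r t) 1.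
  by move=> _ _; exact: der_cst.
have UV b : a <= b -> b < 1 -> {ae mu, forall t, t1 <= t <= t2 ->
    cmod (u (polar (rad b n) t) - ((u (polar (rad b n) t))^-1)^*) @[n --> \oo] --> (0 : R)}.
  move=> ab b1; move: hb; apply: ae_imp => t H ht.
  have b0 : 0 <= b by apply: le_trans ab; exact: ltW.
  have H1 := at_left_rad b0 b1 (H ht).
  pose X n := cmod (u (polar (rad b n) t)).
  have S : (`|X n * X n - 1| * M) @[n --> \oo] --> `|1 * 1 - 1| * M.
    apply: cvgM; last exact: cvg_cst.
    by apply: cvg_norm; apply: cvgB; [apply: cvgM; exact: H1|exact: cvg_cst].
  rewrite mul1r subrr normr0 mul0r in S.
  apply/cvgrPdist_le => e e0; move/cvgrPdist_le: S => /(_ _ e0); apply: filterS => n.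
  rewrite !sub0r !normrN => h; rewrite ger0_norm ?cmod_ge0//; apply: le_trans (le_trans (ler_norm _) h).
  have hr : a <= rad b n < 1 by have /andP[r1 r2] := rad_itv n b0 b1; rewrite r2 (le_trans ab).
  have [un iu] := hv hr ht; rewrite /X; move: un iu; set z := u _ => un iu.
  have zJ : (z^* : Cplx R) != 0 by rewrite -cmod_gt0 cmodJ cmod_gt0.
  have -> : z - (z^-1)^* = (z * z^* - 1) * (z^-1)^* by rewrite fmorphV; field.
  rewrite cmodM cmodJ mulJ_cmod; have -> : (cmod z ^+ 2)%:C%C - 1 = (cmod z ^+ 2 - 1)%:C%C :> Cplx R.
    by rewrite rmorphB rmorph1.
  by rewrite cmodC expr2 ler_wpM2l.
have UV1 b : a <= b -> b < 1 -> {ae mu, forall t, t1 <= t <= t2 ->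
    cmod ((1 : Cplx R) - (1 : Cplx R)^*) @[n --> \oo] --> (0 : R)}.
  by move=> _ _; apply: aeW => t _; rewrite rmorph1 subrr cmod0; exact: cvg_cst.
have L1 := @arc_limit R u (fun z => (u z)^-1) a t1 t2 M a0 t12 duS dvS hu hvS UV w a' w1 aa wa a'1.
have L2 := @arc_limit R (fun=> 1) (fun=> 1) a t1 t2 M a0 t12 d1S d1S h1S h1S UV1 w a' w1 aa wa a'1.
have zw r t : a <= r <= 1 -> t = t1 \/ t = t2 -> polar r t - w != 0.
  by move=> hr ht; rewrite -cmod_gt0; apply: lt_le_trans d0 _; case: (f2 r t hr ht).
have eL (U : Cplx R -> Cplx R) : (forall r t, a <= r < 1 -> t1 <= t <= t2 -> derivable U (polar r t) 1) ->
    (forall r t, a <= r < 1 -> t1 <= t <= t2 -> cmod (U (polar r t)) <= M) ->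
    edge (fun z => U z / (z - w)) a (rad a' n) t1 t2 @[n --> \oo] -->
    edge (fun z => U z / (z - w)) a 1 t1 t2.
  move=> dU hU.
  have le1 r : a <= r < 1 -> a <= r <= 1 by case/andP => -> /ltW ->.
  have cE r t : a <= r < 1 -> t = t1 \/ t = t2 -> {for polar r t, continuous (fun z => U z / (z - w))}.
    move=> hr ht; apply: derivable_continuous; apply: (@derM R U (fun z => (z - w)^-1)).
      exact: (dU _ _ hr (tin ht)).
    apply: (@derV R (fun z => z - w)); first exact: (zw _ _ (le1 r hr) ht).
    by apply: (@derB R id (fun=> w)); [exact: der_id|exact: der_cst].
  have bE r t : a <= r < 1 -> t = t1 \/ t = t2 -> cmod (U (polar r t) / (polar r t - w)) <= M / d.
    move=> hr ht; rewrite cmodM cmodV; apply: ler_pM; rewrite ?cmod_ge0 ?invr_ge0 ?cmod_ge0//.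
      exact: (hU _ _ hr (tin ht)).
    have [h _] := f2 r t (le1 r hr) ht.
    by rewrite lef_pV2// posrE//; apply: lt_le_trans h.
  exact: (@edge_limit R (fun z => U z / (z - w)) a a' t1 t2 (M / d) (ltW a0) aa a'1 cE bE).
have K1 := eL u duS hu; have K2 := eL (fun=> 1) d1S h1S.
(* [box_edge] for [dq u w]: the radius of the outer arc exceeds |w|, and w avoids the other sides,
   so the quotient splits on each side. *)
have S n : arc (fun z => u z / (z - w)) (rad a' n) t1 t2 - u w * arc (fun z => 1 / (z - w)) (rad a' n) t1 t2 =
  edge (fun z => u z / (z - w)) a (rad a' n) t1 t2 - u w * edge (fun z => 1 / (z - w)) a (rad a' n) t1 t2.
  have /andP[r1 r2] := rad_itv n a'0 a'1; set rr := rad a' n in r1 r2 *.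
  have arr : a <= rr by exact: le_trans aa r1.
  have wr : cmod w < rr by apply: lt_le_trans r1; apply: lt_le_trans wa; move: w1; lra.
  have ca r t : a <= r <= rr -> {for polar r t, continuous u}.
    by move=> /andP[h1 h2]; apply: derivable_continuous; apply: du; apply: in1 => //; exact: le_lt_trans r2.
  have B0 : box (dq u w) a rr t1 t2 = 0.
    apply: (@goursat_circle R _ _ _ _ _ (cmod w) arr t12).
      move=> r t /andP[h1 h2] _; apply: cont_dq; apply: du; apply: in1 => //; exact: le_lt_trans r2.
    move=> r t /andP[h1 h2] rw _; apply: der_dq.
      apply: contraNneq rw => <-; rewrite cmod_polar ger0_norm// (le_trans (ltW a0))//.
    by apply: du; apply: in1 => //; exact: le_lt_trans r2.
  have AS r : a <= r <= rr -> (forall t, t1 <= t <= t2 -> polar r t != w) ->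
      arc (dq u w) r t1 t2 = arc (fun z => u z / (z - w)) r t1 t2 - u w * arc (fun z => 1 / (z - w)) r t1 t2.
    move=> hr nw.
    have c1 (t : R) : t1 <= t <= t2 -> {for t, continuous (fun t => u (polar r t))}.
      by move=> _; apply: cont_arc; exact: ca.
    have c2 (t : R) : t1 <= t <= t2 -> {for t, continuous (fun t => ci R * polar r t)}.
      by move=> _; apply: contM; [exact: cont_cst|exact: polar_cont_t].
    exact: (cint_dq c1 (fun t _ => @polar_cont_t R r t) c2 nw).
  have RS t : t = t1 \/ t = t2 ->
      ray (dq u w) t a rr = ray (fun z => u z / (z - w)) t a rr - u w * ray (fun z => 1 / (z - w)) t a rr.
    move=> ht.
    have c1 (r : R) : a <= r <= rr -> {for r, continuous (fun r => u (polar r t))}.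
      by move=> hr; apply: cont_ray; exact: ca.
    have c2 (r : R) : a <= r <= rr -> {for r, continuous (fun r : R => polar r t)}.
      by move=> _; exact: polar_cont_r.
    have c3 (r : R) : a <= r <= rr -> {for r, continuous (fun _ : R => polar 1 t : Cplx R)}.
      by move=> _; exact: cont_cst.
    have nw (r : R) : a <= r <= rr -> polar r t != w.
      move=> /andP[h1 h2]; rewrite -subr_eq0; apply: (zw _ _ _ ht).
      by rewrite h1 ltW// (le_lt_trans h2).
    exact: (cint_dq c1 c2 c3 nw).
  have := box_edge B0; rewrite /edge AS ?arr ?lexx//; last first.
    move=> t _; apply: contraTneq wr => <-; rewrite cmod_polar ger0_norm ?ltxx//.
    exact: le_trans (ltW a0) arr.
  rewrite AS ?arr ?lexx//; last first.
    move=> t ht; have [h _] := f1 t ht; rewrite -subr_eq0 -cmod_gt0; exact: lt_le_trans h.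
  rewrite (RS t1 (or_introl erefl)) (RS t2 (or_intror erefl)) => ->.
  set q1 := arc _ a _ _; set q2 := arc _ a _ _; set q3 := ray _ _ _ _; set q4 := ray _ _ _ _; set q5 := ray _ _ _ _; set q6 := ray _ _ _ _.
  by move: (u w) q1 q2 q3 q4 q5 q6 => *; ring.
pose X n := arc (fun z => u z / (z - w)) (rad a' n) t1 t2.
pose Y n := arc (fun z => 1 / (z - w)) (rad a' n) t1 t2.
pose P n := edge (fun z => u z / (z - w)) a (rad a' n) t1 t2.
pose Q n := edge (fun z => 1 / (z - w)) a (rad a' n) t1 t2.
have C0 : (fun _ : nat => u w) @ \oo --> u w by exact: ccvg_cst.
have T1 := @ccvgB R _ _ eventually_filter X _ _ _ L1 (@ccvgM R _ _ eventually_filter _ Y _ _ C0 L2).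
have T2 := @ccvgB R _ _ eventually_filter P _ _ _ K1 (@ccvgM R _ _ eventually_filter _ Q _ _ C0 K2).
have T3 := @ccvgB R _ _ eventually_filter _ _ _ _ T1 T2.
have Z : forall n, X n - u w * Y n - (P n - u w * Q n) = 0 by move=> n; rewrite /X /Y S subrr.
rewrite (funext Z) in T3.
rewrite /glue; move: T3; set c1 := _^*; set c2 := _^*; set e1 := edge _ _ _ _ _; set e2 := edge _ _ _ _ _ => T3.
have T4 := cvg_zero_const T3.
apply/eqP; rewrite -subr_eq0; apply/eqP; rewrite -[RHS]T4; move: (u w) c1 c2 e1 e2 {T3 T4} => *; ring.
Qed.

End Sector.

(** * Sectors around a boundary point off the spectrum *)

Section ExtensionGeometry.
Variable R : realType.
Notation mu := (@lebesgue_measure R).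
Implicit Types (u : Cplx R -> Cplx R) (z w : Cplx R) (r t : R).

Lemma polar_surj z : cmod z = 1 -> exists2 t, 0 <= t <= twopi R & z = polar 1 t.
Proof.
move=> z1; have := sqr_cmod z; rewrite z1 expr1n; case: z z1 => x y _ /= E.
have hx : -1 <= x <= 1.
  have x2 : x ^+ 2 <= 1 by rewrite E lerDl sqr_ge0.
  by rewrite -ler_norml -(ler_pXn2r (_ : 0 < 2)%N) ?nnegrE// real_normK ?num_real// expr1n.
have s2 : Num.sqrt (1 - x ^+ 2) = `|y| by rewrite E addrAC subrr add0r sqrtr_sqr.
have /andP[h1 h2] := hx.
have ac0 := acos_ge0 hx; have ac1 := acos_lepi hx.
have p0 := pi_ge0 R.
have E1 : polar 1 (acos x) = Complex x `|y|.
  by rewrite /polar !mul1r acosK ?in_itv//= sin_acos// s2.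
have [y0|y0] := leP 0 y.
  by exists (acos x); [rewrite ac0 /twopi; lra|rewrite E1 ger0_norm].
exists (- acos x + 2 * pi); first by rewrite /twopi; apply/andP; split; lra.
by rewrite polar_periodic -polarJ E1 ltr0_norm//; apply: cplx_eq; rewrite /= ?opprK.
Qed.

(** Needed because the arc around the given point may leave [0, 2 pi] at either end. *)
Lemma ae_periodic (P : R -> Prop) : (forall t, P (t + 2 * pi) <-> P t) ->
  {ae mu, forall t, 0 <= t <= 2 * pi -> P t} ->
  {ae mu, forall t, - (2 * pi) <= t <= 4 * pi -> P t}.
Proof.
move=> Pp H.
have H1 := ae_shift (2 * pi) H.
have H2 := ae_shift (- (2 * pi)) H.
move: (ae_and H (ae_and H1 H2)); apply: ae_imp => t [h0 [h1 h2]] /andP[ta tb].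
have [t0|t0] := leP 0 t.
  have [t2|t2] := leP t (2 * pi); first by apply: h0; rewrite t0.
  have : P (t + - (2 * pi)) by apply: h2; apply/andP; split; lra.
  by move/Pp; rewrite subrK.
by apply/Pp; apply: h1; apply/andP; split; lra.
Qed.

(** The limes inferior is a supremum, over neighbourhoods, of nonnegative infima; if it is not 0,
    some neighbourhood has a positive infimum. *)
Lemma spectrum_lower u z : cmod z = 1 -> ~ spectrum u z -> exists e d : R, [/\ 0 < e, 0 < d &
  forall w, cmod w < 1 -> cmod (w - z) < e -> d <= cmod (u w)].
Proof.
move=> z1 ns; apply: contrapT => H; apply: ns; split; first by rewrite /closed_disk /= z1.
rewrite limf_einfE; apply/eqP; rewrite eq_le; apply/andP; split.
  apply: ge_ereal_sup => _ [V FV <-]; rewrite leNgt; apply/negP => inf0.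
  apply: H; have [e e0 he] := (near_cplxP z _).1 FV.
  set i := ereal_inf _ in inf0.
  (* The infimum may be infinite as far as this argument knows; any d then serves. *)
  have [d d0 di] : exists2 d : R, 0 < d & (d%:E <= i)%E.
    case: i inf0 => [d|_|]//=; first by rewrite lte_fin => d0; exists d.
    by exists 1; rewrite ?leey.
  exists e, d; split => // w w1 wz; rewrite -lee_fin; apply: le_trans di _.
  by apply: ereal_inf_lbound; exists w => //; exact: he.
apply: le_trans (ereal_sup_ubound (_ : [set ereal_inf [set (cmod (u x))%:E | x in V] | V in
  within (@unit_disk R) (nbhs z)] (ereal_inf [set (cmod (u x))%:E | x in [set: Cplx R]]))).
  by apply: le_ereal_inf_tmp => _ [x _ <-]; rewrite lee_fin cmod_ge0.
by exists [set: Cplx R] => //; exact: filterT.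
Qed.

Lemma cRe_div z w : w != 0 -> complex.Re (z / w) = complex.Re (z * w^*) / cmod w ^+ 2.
Proof.
move=> w0; have c0 : cmod w ^+ 2 != 0 by rewrite expf_neq0// cmod_eq0.
have -> : z / w = z * w^* * ((cmod w ^+ 2)^-1)%:C%C.
  have wJ : (w^* : Cplx R) != 0 by rewrite -cmod_gt0 cmodJ cmod_gt0.
  have -> : ((cmod w ^+ 2)^-1)%:C%C = (w * w^*)^-1 :> Cplx R by rewrite mulJ_cmod fmorphV.
  by field; rewrite w0 wJ.
by rewrite cReM /= mulr0 subr0.
Qed.

Lemma cIm_div z w : w != 0 -> complex.Im (z / w) = complex.Im (z * w^*) / cmod w ^+ 2.
Proof.
move=> w0; have c0 : cmod w ^+ 2 != 0 by rewrite expf_neq0// cmod_eq0.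
have -> : z / w = z * w^* * ((cmod w ^+ 2)^-1)%:C%C.
  have wJ : (w^* : Cplx R) != 0 by rewrite -cmod_gt0 cmodJ cmod_gt0.
  have -> : ((cmod w ^+ 2)^-1)%:C%C = (w * w^*)^-1 :> Cplx R by rewrite mulJ_cmod fmorphV.
  by field; rewrite w0 wJ.
by rewrite cImM /= mulr0 add0r.
Qed.

(** For |w| = 1 this is the difference of 1 / (z - w) and 1 / (z (1 - conj(w) z)). Multiplied by z
    it becomes (z + w) / (z - w), whose real part is minus the Poisson kernel. *)
Definition glue_kernel w z : Cplx R := 2 / (z - w) - z^-1.

(** The conjugation in [glue] flips the sign of the imaginary part, so that the two kernels combine
    into their difference. *)
Lemma path_Im (x y : R) (zt k : R -> Cplx R) w : cmod w = 1 ->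
  (forall t, x <= t <= y -> {for t, continuous zt}) ->
  (forall t, x <= t <= y -> {for t, continuous k}) ->
  (forall t, x <= t <= y -> zt t != 0) -> (forall t, x <= t <= y -> zt t != w) ->
  rbm x y (fun t => complex.Im (glue_kernel w (zt t) * k t)) /\
  complex.Im ((cint x y (fun t => 1 / (zt t * (1 - w^* * zt t)) * k t))^*) +
    complex.Im (cint x y (fun t => 1 / (zt t - w) * k t)) =
  rint x y (fun t => complex.Im (glue_kernel w (zt t) * k t)).
Proof.
move=> w1 cz ck z0 zw.
have ww : w * w^* = 1 by rewrite mulJ_cmod w1 expr1n.
have wJ0 : (w^* : Cplx R) != 0 by rewrite -cmod_gt0 cmodJ w1.
have zw0 t : x <= t <= y -> zt t - w != 0 by move=> ht; rewrite subr_eq0 zw.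
have dE z : 1 - w^* * z = w^* * (w - z) by rewrite mulrBr [w^* * w]mulrC ww.
have d0 t : x <= t <= y -> zt t * (1 - w^* * zt t) != 0.
  by move=> ht; rewrite dE !mulf_neq0 ?z0// -oppr_eq0 opprB zw0.
have bG : bm x y (fun t => 1 / (zt t - w) * k t).
  apply: bm_cont => t ht; apply: contM; last exact: ck.
  apply: contM; first exact: cont_cst.
  apply: (@contV R R (fun t => zt t - w)); first exact: zw0.
  by apply: contB; [exact: cz|exact: cont_cst].
have bF : bm x y (fun t => 1 / (zt t * (1 - w^* * zt t)) * k t).
  apply: bm_cont => t ht; apply: contM; last exact: ck.
  apply: contM; first exact: cont_cst.
  apply: (@contV R R (fun t => zt t * (1 - w^* * zt t))); first exact: d0.
  apply: contM; first exact: cz.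
  apply: contB; first exact: cont_cst.
  by apply: contM; [exact: cont_cst|exact: cz].
have pE t : x <= t <= y ->
    1 / (zt t - w) * k t - 1 / (zt t * (1 - w^* * zt t)) * k t = glue_kernel w (zt t) * k t.
  move=> ht; rewrite /glue_kernel; have h1 := zw0 t ht; have h2 := z0 t ht; have h3 := d0 t ht.
  have h4 : w - zt t != 0 by rewrite -oppr_eq0 opprB.
  have w0 : w != 0 by rewrite -cmod_gt0 w1.
  have -> : 1 / (zt t * (1 - w^* * zt t)) = w / (zt t * (w - zt t)).
    rewrite dE; have -> : w^* = w^-1 by apply: (mulfI w0); rewrite ww divff.
    by field; rewrite w0 h2 h4.
  by field; rewrite h1 h2 h4.
have bD := bm_ext pE (bmB bG bF).
split; first by case: bD.
rewrite cImJ addrC -cImB -(cintB bG bF) /=.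
by apply: rint_ext => t ht; rewrite pE.
Qed.

Lemma far_near (a t1 t2 d : R) z w : far a t1 t2 z (2 * d) -> cmod (w - z) < d -> far a t1 t2 w d.
Proof.
move=> [d0 f1 f2] hw; have dd : 0 < d by apply: le_lt_trans hw; exact: cmod_ge0.
have T v : 2 * d <= cmod (v - z) -> d <= cmod (v - w).
  move=> h; have -> : v - w = (v - z) - (w - z) by ring.
  by apply: le_trans (cmod_ge_sub _ _); move: h hw; lra.
split => // [t /f1[h1 h2]|r t hr /(f2 _ _ hr)[h1 h2]]; split; exact: T.
Qed.

(** After a rotation the centre is 1, and the imaginary part bounds the distance from below. *)
Lemma ray_far (r s t0 : R) : 0 <= r -> r * `|sin s| <= cmod (polar r (t0 + s) - polar 1 t0).
Proof.
move=> r0; have -> : polar r (t0 + s) - polar 1 t0 = polar 1 t0 * (polar r s - 1) :> Cplx R.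
  by rewrite polarE polarD [polar r s]polarE; ring.
rewrite cmodM cmod_polar1 mul1r; apply: le_trans (cmod_Im _); rewrite cImB /= subr0.
by rewrite normrM ger0_norm.
Qed.

Lemma inv_polarJ (r t : R) : 0 < r -> ((polar r t)^*)^-1 = polar r^-1 t :> Cplx R.
Proof.
move=> r0; have p0 : polar r t != 0 by rewrite -cmod_gt0 cmod_polar normr_gt0 gt_eqF.
have rc : (r%:C%C : Cplx R) != 0 by rewrite -cmod_gt0 cmodC normr_gt0 gt_eqF.
have p1 := polar1_neq0 t.
rewrite polarJV rmorphXn polarE [polar r^-1 t]polarE fmorphV; field.
by rewrite p1 rc.
Qed.

Section SectorAt.
Variables (t0 a eta : R).
Hypotheses (a0 : 0 < a) (a1 : a < 1) (eta0 : 0 < eta) (eta1 : eta <= 1).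
Let z0 : Cplx R := polar 1 t0.

Let sin_eta : 0 < sin eta.
Proof. by apply: sin_gt0_pi; rewrite eta0 /=; have := pi_ge2 R; move: eta1; lra. Qed.

Lemma far_center : far a (t0 - eta) (t0 + eta) z0 (Num.min (1 - a) (a * sin eta)).
Proof.
have as0 : 0 < a * sin eta by rewrite mulr_gt0.
have i1 : 1 <= a^-1 by rewrite invf_ge1// ltW.
have arcs r t : 0 < r -> 1 - a <= `|1 - r| -> Num.min (1 - a) (a * sin eta) <= cmod (polar r t - z0).
  move=> r0 h; rewrite ge_min; apply/orP; left; apply: le_trans h _.
  have := cmod_dist z0 (polar r t); rewrite /z0 cmod_polar1 cmod_polar (gtr0_norm r0).
  by rewrite cmodBC.
have rays r t : a <= r -> t = t0 - eta \/ t = t0 + eta ->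
    Num.min (1 - a) (a * sin eta) <= cmod (polar r t - z0).
  move=> ar ht; rewrite ge_min; apply/orP; right.
  have r0 : 0 <= r by apply: le_trans ar; exact: ltW.
  have : a * sin eta <= r * sin eta by rewrite ler_pM2r.
  case: ht => -> h.
    by apply: le_trans h _; have := ray_far (- eta) t0 r0; rewrite sinN normrN gtr0_norm.
  by apply: le_trans h _; have := ray_far eta t0 r0; rewrite gtr0_norm.
split.
- by rewrite lt_min as0 subr_gt0 a1.
- move=> t ht; rewrite inv_polarJ//; split; apply: arcs => //; rewrite ?invr_gt0//.
    by rewrite ger0_norm// subr_ge0 ltW.
  rewrite ler0_norm ?subr_le0// opprB.
  have : a * a^-1 = 1 by rewrite divff// gt_eqF.
  move: i1; set i := a^-1; move: a0 a1 => *; nra.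
- move=> r t /andP[ar r1] ht; have r0 : 0 < r by apply: lt_le_trans ar.
  rewrite inv_polarJ//; split; apply: rays => //.
  by apply: le_trans (ltW a1) _; rewrite invf_ge1.
Qed.

(** The imaginary part is negative: on the inner arc the integrand is minus a Poisson kernel, and on
    the rays it has the sign of -sin of the angle from the centre, so that both rays push in the
    same direction. *)
Lemma glue1_neq0 : glue a (t0 - eta) (t0 + eta) (fun=> 1) (fun=> 1) z0 != 0.
Proof.
have [d0 f1 f2] := far_center; set d := Num.min _ _ in d0 f1 f2.
have t12 : t0 - eta <= t0 + eta by move: eta0; lra.
have zc : cmod z0 = 1 by rewrite /z0 cmod_polar1.
have nz v : d <= cmod (v - z0) -> v != z0.
  by move=> h; rewrite -subr_eq0 -cmod_gt0; apply: lt_le_trans h.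
have pol0 r t : a <= r -> polar r t != 0 :> Cplx R.
  by move=> ar; rewrite -cmod_gt0 cmod_polar normr_gt0 gt_eqF// (lt_le_trans a0).
have ck (t : R) : {for t, continuous (fun t : R => ci R * polar a t)}.
  by apply: contM; [exact: cont_cst|exact: polar_cont_t].
have cr (t r : R) : {for r, continuous (fun r : R => polar r t)} by exact: polar_cont_r.
have cc (t r : R) : {for r, continuous (fun _ : R => polar 1 t : Cplx R)} by exact: cont_cst.
have [bA IA] := @path_Im _ _ (polar a) (fun t => ci R * polar a t) z0 zc
  (fun t _ => @polar_cont_t R a t) (fun t _ => ck t) (fun t _ => pol0 a t (lexx a))
  (fun t ht => nz _ (f1 t ht).1).
have PR t ht := @path_Im a 1 (fun r => polar r t) (fun=> polar 1 t) z0 zc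
  (fun r _ => cr t r) (fun r _ => cc t r) (fun r hr => pol0 r t (proj1 (andP hr)))
  (fun r hr => nz _ (f2 r t hr ht).1).
have [b1 I1] := PR _ (or_introl erefl); have [b2 I2] := PR _ (or_intror erefl).
have hA : rint (t0 - eta) (t0 + eta) (fun t => complex.Im (glue_kernel z0 (polar a t) * (ci R * polar a t))) < 0.
  (* On the inner arc the kernel is (a^2 - 1) / |z - z0|^2, and |z - z0| <= 2. *)
  have neg : (a ^+ 2 - 1) / 4 < 0 by rewrite ltr_pdivrMr// mul0r subr_lt0 expr2; move: a0 a1; nra.
  apply: (@le_lt_trans _ _ ((a ^+ 2 - 1) / 4 * ((t0 + eta) - (t0 - eta)))); last first.
    by rewrite nmulr_rlt0//; move: eta0; lra.
  rewrite -rint_cst//; apply: rint_le => //; first exact: rbm_cst.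
  move=> t ht; have [h1 _] := f1 t ht; set z := polar a t in h1 *.
  have zw : z - z0 != 0 by rewrite subr_eq0 nz.
  have zn : z != 0 := pol0 a t (lexx a).
  have -> : glue_kernel z0 z * (ci R * z) = ci R * ((z + z0) / (z - z0)).
    by rewrite /glue_kernel; field; rewrite zw zn.
  have -> : complex.Im (ci R * ((z + z0) / (z - z0))) = complex.Re ((z + z0) / (z - z0)).
    by rewrite cImM /= mul0r mul1r add0r.
  rewrite cRe_div//.
  have -> : complex.Re ((z + z0) * (z - z0)^*) = cmod z ^+ 2 - cmod z0 ^+ 2.
    by rewrite cReM cReJ cImJ cReD cImD cReB cImB !sqr_cmod; ring.
  rewrite zc /z cmod_polar gtr0_norm// expr1n.
  have c4 : cmod (z - z0) ^+ 2 <= 4.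
    have h : cmod (z - z0) <= 2.
      by apply: le_trans (cmodB _ _) _; rewrite zc /z cmod_polar gtr0_norm//; move: a1; lra.
    by have := cmod_ge0 (z - z0); nra.
  have c0 : 0 < cmod (z - z0) ^+ 2 by rewrite exprn_gt0// cmod_gt0.
  have a2 : a ^+ 2 - 1 <= 0 by rewrite subr_le0 expr2; move: a0 a1; nra.
  apply: (ler_wnM2l a2); by rewrite lef_pV2// posrE.
(* The summand 1 / z contributes a real number along a ray; multiplying the other one by the
   conjugate denominator leaves only 2 sin s. *)
have ray_Im (s r : R) : a <= r <= 1 -> t0 + s = t0 - eta \/ t0 + s = t0 + eta ->
    complex.Im (glue_kernel z0 (polar r (t0 + s)) * polar 1 (t0 + s)) =
    - sin s * (2 / cmod (polar r (t0 + s) - z0) ^+ 2).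
  move=> hr ht; have [h1 _] := f2 r _ hr ht; have /andP[ar _] := hr.
  have r0 : 0 < r by apply: lt_le_trans ar.
  have zw : polar r (t0 + s) - z0 != 0 by rewrite subr_eq0 nz.
  have zn := pol0 r (t0 + s) ar.
  have rc : (r%:C%C : Cplx R) != 0 by rewrite -cmod_gt0 cmodC normr_gt0 gt_eqF.
  have pE : polar 1 (t0 + s) / polar r (t0 + s) = (r^-1)%:C%C.
    by rewrite [polar r _]polarE fmorphV; field; rewrite rc polar1_neq0.
  have -> : glue_kernel z0 (polar r (t0 + s)) * polar 1 (t0 + s) =
      (2 * polar 1 (t0 + s)) / (polar r (t0 + s) - z0) - polar 1 (t0 + s) / polar r (t0 + s).
    by rewrite /glue_kernel; field; rewrite zw zn.
  rewrite pE cImB (_ : complex.Im (r^-1)%:C%C = 0)// subr0 cIm_div//.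
  have -> : complex.Im (2 * polar 1 (t0 + s) * (polar r (t0 + s) - z0)^*) = - (2 * sin s).
    have -> : 2 * polar 1 (t0 + s) * (polar r (t0 + s) - z0)^* =
        (2 * r)%:C%C - 2 * polar 1 s :> Cplx R.
      have Hz : z0 * z0^* = 1 by rewrite mulJ_cmod zc expr1n.
      have Hs : polar 1 s * (polar 1 s)^* = 1 :> Cplx R by rewrite mulJ_cmod cmod_polar1 expr1n.
      have rJ : (r%:C%C : Cplx R)^* = r%:C%C by apply: cplx_eq; rewrite /= ?oppr0.
      rewrite [polar r _]polarE !polarD -/z0 rmorphB !rmorphM /= rJ.
      have -> : 2%:R%:C%C = 2 :> Cplx R by rewrite rmorph_nat.
      transitivity (2 * r%:C%C * (z0 * z0^*) * (polar 1 s * (polar 1 s)^*) - 2 * polar 1 s * (z0 * z0^*)).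
        by ring.
      by rewrite Hz Hs !mulr1.
    by rewrite cImB cImM /= mul1r; ring.
  by ring.
have p2 r s : 0 <= 2 / cmod (polar r (t0 + s) - z0) ^+ 2 by rewrite divr_ge0// sqr_ge0.
have h2 : rint a 1 (fun r => complex.Im (glue_kernel z0 (polar r (t0 + eta)) * polar 1 (t0 + eta))) <= 0.
  have := rint_cst 0 (ltW a1); rewrite mul0r => <-; apply: rint_le => //; first exact: rbm_cst.
  move=> r hr; rewrite ray_Im//; last by right.
  by rewrite mulNr oppr_le0 mulr_ge0// ltW.
have h1 : 0 <= rint a 1 (fun r => complex.Im (glue_kernel z0 (polar r (t0 - eta)) * polar 1 (t0 - eta))).
  apply: rint_ge0 => r hr; rewrite ray_Im//; last by left.
  by rewrite sinN opprK mulr_ge0// ltW.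
apply: contraTneq hA => N0; rewrite -leNgt.
have : complex.Im (glue a (t0 - eta) (t0 + eta) (fun=> 1) (fun=> 1) z0) = 0 by rewrite N0.
rewrite /glue /edge rmorphB rmorphD !(cImD, cImB).
rewrite -IA; move: I1 I2 h1 h2 => <- <-.
rewrite /arc /ray /refl_kernel; lra.
Qed.

End SectorAt.

Lemma open_cball z (e : R) : open [set w : Cplx R | cmod (w - z) < e].
Proof.
rewrite openE => w /= hw; apply/near_cplxP; exists (e - cmod (w - z)); first by rewrite subr_gt0.
move=> v hv /=; have -> : v - z = (v - w) + (w - z) by ring.
by apply: le_lt_trans (cmodD _ _) _; rewrite -ltrBrDr.
Qed.

(* Off the spectrum u is locally bounded below, so that u and its reflection
   1 / conj(u(1 / conj z)) have the same boundary values on an arc around z; Cauchy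
   integrals of both over the boundary of a polar rectangle continue u across the arc. *)
Lemma extension_exists u z : inner_function u -> cmod z = 1 -> ~ spectrum u z ->
  exists G, analytic_extension u z G.
Proof.
move=> [hol [M0 hM0] hae] z1 ns.
have du w : cmod w < 1 -> derivable u w 1 by move=> hw; exact: hol.
have [e [de [e0 de0 hlow]]] := spectrum_lower z1 ns.
have [t0 /andP[t00 t02] zE] := polar_surj z1.
have e4 : 0 < e / 4 by rewrite divr_gt0.
(* Both margins are at most e / 4, so the sector lies within e of z, where u is bounded below; the
   caps 1 and 1/2 keep sin(eta) and a positive. *)
pose eta := Num.min (e / 4) 1; pose a := 1 - Num.min (e / 4) 2^-1.
have eta0 : 0 < eta by rewrite lt_min e4 ltr01.
have eta1 : eta <= 1 by rewrite ge_min lexx orbT.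
have etae : eta <= e / 4 by rewrite ge_min lexx.
have a1 : a < 1 by rewrite /a gtrBl lt_min e4 invr_gt0 ltr0n.
have a0 : 0 < a.
  have : Num.min (e / 4) 2^-1 <= 2^-1 :> R by rewrite ge_min lexx orbT.
  by rewrite /a; lra.
have ae : 1 - a <= e / 4 by rewrite /a opprB addrC subrK ge_min lexx.
pose M := Num.max M0 de^-1.
have inD r t : a <= r < 1 -> cmod (polar r t : Cplx R) < 1.
  by move=> /andP[h1 h2]; rewrite cmod_polar ger0_norm// (le_trans (ltW a0)).
have inE r t : a <= r < 1 -> t0 - eta <= t <= t0 + eta -> cmod (polar r t - z) < e.
  move=> /andP[h1 h2] /andP[h3 h4]; rewrite zE; apply: le_lt_trans (polar_lip2 _ _ _ _) _.
  have r1 : `|r| <= 1 by rewrite ger0_norm ?(ltW h2)// (le_trans (ltW a0)).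
  have H1 : `|t - t0| <= eta by rewrite ler_norml; apply/andP; split; lra.
  have H2 : `|r - 1| <= e / 4 by rewrite ler_norml; apply/andP; split; lra.
  have H3 : `|r| * `|t - t0| <= 1 * eta by apply: ler_pM.
  by move: H2 H3 etae e0; lra.
have hu r t : a <= r < 1 -> t0 - eta <= t <= t0 + eta -> cmod (u (polar r t)) <= M.
  by move=> hr _; rewrite le_max hM0//; exact: inD.
have hv r t : a <= r < 1 -> t0 - eta <= t <= t0 + eta -> u (polar r t) != 0 /\ cmod (u (polar r t))^-1 <= M.
  move=> hr ht; have h := hlow _ (inD r t hr) (inE r t hr ht).
  split; first by rewrite -cmod_gt0; apply: lt_le_trans h.
  by rewrite le_max; apply/orP; right; rewrite cmodV lef_pV2// posrE//; apply: lt_le_trans h.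
have hb : {ae mu, forall t, t0 - eta <= t <= t0 + eta -> cmod (u (polar r t)) @[r --> 1^'-] --> (1 : R)}.
  have per t : (cmod (u (polar r (t + 2 * pi))) @[r --> 1^'-] --> (1 : R)) <->
      (cmod (u (polar r t)) @[r --> 1^'-] --> (1 : R)).
    have -> : (fun r => cmod (u (polar r (t + 2 * pi)))) = (fun r => cmod (u (polar r t))).
      by apply/funext => r; rewrite polar_periodic.
    by [].
  move: (ae_periodic per hae); apply: ae_imp => t P /andP[h1 h2].
  apply: P; have := pi_ge2 R; move: h1 h2 t00 t02 eta1; rewrite /twopi => *; apply/andP; split; lra.
have t12 : t0 - eta <= t0 + eta by move: eta0; lra.
have duS r t : a <= r < 1 -> t0 - eta <= t <= t0 + eta -> derivable u (polar r t) 1.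
  by move=> hr _; apply: du; exact: inD.
have dvS r t : a <= r < 1 -> t0 - eta <= t <= t0 + eta -> derivable (fun z => (u z)^-1) (polar r t) 1.
  by move=> hr ht; apply: derV; [case: (hv r t hr ht)|exact: duS].
have M1 : 1 <= M.
  have ha : a <= a < 1 by rewrite lexx a1.
  have ht : t0 - eta <= t0 - eta <= t0 + eta by rewrite lexx.
  have [un iu] := hv _ _ ha ht; have hh := hu _ _ ha ht; rewrite cmodV in iu.
  have c0 : 0 < cmod (u (polar a (t0 - eta))) by rewrite cmod_gt0.
  have [h|h] := leP 1 (cmod (u (polar a (t0 - eta)))); first exact: le_trans hh.
  by apply: le_trans iu; rewrite invf_ge1// ltW.
(* Half the margin at z, so that the margin d persists for |w - z| < d. *)
pose d := Num.min (1 - a) (a * sin eta) / 2.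
have Fz : far a (t0 - eta) (t0 + eta) z (2 * d).
  by rewrite /d mulrC divfK// zE; exact: far_center.
have d0 : 0 < d by case: Fz; rewrite pmulr_rgt0.
pose N := glue a (t0 - eta) (t0 + eta) (fun=> 1) (fun=> 1).
pose A := glue a (t0 - eta) (t0 + eta) u (fun z => (u z)^-1).
have dN w : cmod (w - z) < d -> derivable N w 1.
  move=> hw; apply: (@der_glue R a _ _ M a0 a1 t12 (fun=> 1) (fun=> 1) w d).
  - by move=> *; exact: der_cst.
  - by move=> *; exact: der_cst.
  - by move=> *; rewrite cmod1.
  - by move=> *; rewrite cmod1.
  - exact: far_near hw.
have dA w : cmod (w - z) < d -> derivable A w 1.
  move=> hw; apply: (@der_glue R a _ _ M a0 a1 t12 u (fun z => (u z)^-1) w d duS dvS hu).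
    by move=> r t hr ht; case: (hv r t hr ht).
  exact: far_near hw.
have Nz : N z != 0 by rewrite /N zE; exact: glue1_neq0.
have Nz2 : 0 < cmod (N z) / 2 by rewrite divr_gt0// cmod_gt0.
have zz : cmod (z - z) < d by rewrite subrr cmod0.
have /cont_cplxP/(_ _ Nz2)[d' d'0 hd'] := derivable_continuous (dN z zz).
have N0 w : cmod (w - z) < d' -> N w != 0.
  move=> /hd' h; rewrite -cmod_gt0; have h' := cmod_ge_sub (N z) (N w); rewrite cmodBC in h'.
  by move: h h' Nz2; lra.
exists (fun w => A w / N w), [set w | cmod (w - z) < Num.min d d']; split.
- exact: open_cball.
- by rewrite /= subrr cmod0 lt_min d0 d'0.
- move=> w /=; rewrite lt_min => /andP[h1 h2].
  apply: (@derM R A (fun w => (N w)^-1)); first exact: dA.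
  by apply: derV; [exact: N0|exact: dN].
- move=> w /=; rewrite lt_min => /andP[h1 h2] w1.
  apply: (mulIf (N0 w h2)); rewrite divfK ?N0//; apply/esym.
  exact: (@glue_identity R u a _ _ M a0 a1 t12 du hu hv hb w d w1 (far_near Fz h1)).
Qed.

End ExtensionGeometry.

(** * Boundary partners and difference quotients *)

Section BoundaryClass.
Variable R : realType.
Notation mu := (@lebesgue_measure R).
Implicit Types (f g h F G H : Cplx R -> Cplx R) (z w p : Cplx R) (r t rho : R).

(** Subtract Cauchy's formulas at w and p and divide by w - p. The resulting integral of Cauchy type
    also makes sense at w = p, which shows that the singularity is removable. *)
Lemma dq_cauchy F p r rho w : (forall v, cmod (v - p) < rho -> derivable F v 1) ->
  cmod (w - p) < r -> r < rho ->
  dq F p w = (twopi R)%:C%C^-1 * cint 0 (twopi R) (fun t => F (p + polar r t) / (p + polar r t - w) ^+ 1).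
Proof.
move=> dF wr rr; have r0 : 0 < r by apply: le_lt_trans wr; exact: cmod_ge0.
have pr t : polar r t != 0 :> Cplx R by rewrite -cmod_gt0 cmod_polar normr_gt0 gt_eqF.
have nz v t : cmod (v - p) < r -> p + polar r t - v != 0.
  by move=> vr; rewrite -cmod_gt0; apply: lt_le_trans (circle_dist _ vr); rewrite subr_gt0.
have pp : cmod (p - p) < r by rewrite subrr cmod0.
have cp (t : R) : {for t, continuous (fun t : R => p + polar r t)}.
  by apply: contD; [exact: cont_cst|exact: polar_cont_t].
have cF (t : R) : {for t, continuous (fun t : R => F (p + polar r t))}.
  have Hc : {for (p + polar r t), continuous F}.
    by apply: derivable_continuous; apply: dF; rewrite addrAC subrr add0r cmod_polar gtr0_norm.
  exact: (cvg_comp (fun t => p + polar r t) F (cp t) Hc).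
have [->|wp] := eqVneq w p.
  rewrite /dq eqxx; have := derive1n_cauchy 1 dF pp rr.
  rewrite /derive1n /= => ->; rewrite mul1r; congr (_ * _); apply: cint_ext => t _.
  by rewrite addrAC subrr add0r expr1 expr2 invfM mulrA mulfK.
have b v : cmod (v - p) < r -> bm 0 (twopi R) (fun t => F (p + polar r t) * polar r t / (p + polar r t - v)).
  move=> vr; apply: bm_cont => t _; apply: (@contM R R (fun t => F (p + polar r t) * polar r t) (fun t => (p + polar r t - v)^-1)).
    by apply: contM; [exact: cF|exact: polar_cont_t].
  apply: (@contV R R (fun t => p + polar r t - v)); first exact: nz.
  by apply: contB; [exact: cp|exact: cont_cst].
have b1 : bm 0 (twopi R) (fun t => F (p + polar r t) / (p + polar r t - w) ^+ 1).
  by apply: bm_cont => t _; apply: contM; [exact: cF|apply: (@cont_kernel R (fun t => p + polar r t)); [exact: cp|exact: nz]].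
have E1 := cauchy_formula dF wr rr; have E2 := cauchy_formula dF pp rr.
have E : (w - p) * cint 0 (twopi R) (fun t => F (p + polar r t) / (p + polar r t - w) ^+ 1) = (F w - F p) * (twopi R)%:C%C.
  rewrite [RHS]mulrBl -E1 -E2 -(cintB (b w wr) (b p pp)) -(cintZ _ b1); apply: cint_ext => t _.
  have n1 := nz w t wr; have n2 := pr t; rewrite expr1.
  have -> : p + polar r t - p = polar r t by ring.
  by field; rewrite n1 n2.
have wp0 : w - p != 0 by rewrite subr_eq0.
rewrite dqE//; apply: (mulfI wp0); rewrite [RHS]mulrCA E [LHS]mulrC divfK// [RHS]mulrC mulfK//.
exact: twopi_neq0.
Qed.

Lemma cderiv_dq F p r rho w : (forall v, cmod (v - p) < rho -> derivable F v 1) ->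
  cmod (w - p) < r -> r < rho ->
  cderiv (dq F p) w ((twopi R)%:C%C^-1 * cint 0 (twopi R) (fun t => F (p + polar r t) / (p + polar r t - w) ^+ 2)).
Proof.
move=> dF wr rr; have r0 : 0 < r by apply: le_lt_trans wr; exact: cmod_ge0.
have cp (t : R) : {for t, continuous (fun t : R => p + polar r t)}.
  by apply: contD; [exact: cont_cst|exact: polar_cont_t].
have bF : bm 0 (twopi R) (fun t => F (p + polar r t)).
  apply: bm_cont => t _; have Hc : {for (p + polar r t), continuous F}.
    by apply: derivable_continuous; apply: dF; rewrite addrAC subrr add0r cmod_polar gtr0_norm.
  exact: (cvg_comp (fun t => p + polar r t) F (cp t) Hc).
have dpos : 0 < r - cmod (w - p) by rewrite subr_gt0.
have D := cauchy_type_deriv 1 (ltW (twopi_gt0 R)) bF (fun t _ => cp t) dpos (fun t _ => circle_dist t wr).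
rewrite mul1r in D; set I2 := cint _ _ _ in D *.
have D' : cderiv (fun v => (twopi R)%:C%C^-1 * cint 0 (twopi R) (fun t => F (p + polar r t) / (p + polar r t - v) ^+ 1)) w ((twopi R)%:C%C^-1 * I2).
  set c := _^-1; move: D; set I1 := fun v => cint _ _ _ => D e e0.
  have c1 : 0 < cmod c + 1 by rewrite ltr_wpDl// cmod_ge0.
  have [de de0 hde] := D _ (divr_gt0 e0 c1); exists de => // x /hde X.
  have rid (x1 x2 x3 y : Cplx R) : c * x1 - c * x2 - c * x3 * y = c * (x1 - x2 - x3 * y).
    by clear; move: c => c; ring.
  rewrite rid cmodM; apply: le_trans (ler_wpM2l (cmod_ge0 _) X) _.
  rewrite mulrA ler_wpM2r ?cmod_ge0// mulrCA -[leRHS]mulr1 ler_wpM2l ?(ltW e0)//.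
  by rewrite ler_pdivrMr// mul1r lerDl.
apply: cderiv_near D'; exists (r - cmod (w - p)) => // v hv.
rewrite (dq_cauchy dF _ rr)//; have -> : v - p = (v - w) + (w - p) by ring.
by apply: le_lt_trans (cmodD _ _) _; rewrite -ltrBrDr.
Qed.

(** The origin of the factor 1/2: both sides are the same Cauchy integral, up to the factorial in
    the formula for the second derivative. *)
Lemma derive1_dq F p rho : 0 < rho -> (forall v, cmod (v - p) < rho -> derivable F v 1) ->
  derive1 (dq F p) p = derive1n 2 F p / 2.
Proof.
move=> rho0 dF; have r0 : 0 < rho / 2 by rewrite divr_gt0.
have rr : rho / 2 < rho by move: rho0; lra.
have pp : cmod (p - p) < rho / 2 by rewrite subrr cmod0.
rewrite (cderiv_derive1 (cderiv_dq dF pp rr)) (derive1n_cauchy 2 dF pp rr).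
have -> : cint 0 (twopi R) (fun t => F (p + polar (rho / 2) t) * polar (rho / 2) t / (p + polar (rho / 2) t - p) ^+ 3) =
    cint 0 (twopi R) (fun t => F (p + polar (rho / 2) t) / (p + polar (rho / 2) t - p) ^+ 2).
  apply: cint_ext => t _; rewrite addrAC subrr add0r exprS invfM mulrA mulfK//.
  by rewrite -cmod_gt0 cmod_polar normr_gt0 gt_eqF.
set I := cint _ _ _; have -> : 2`!%:R = 2 :> Cplx R by [].
have n2 : (2 : Cplx R) != 0 by rewrite pnatr_eq0.
by rewrite [RHS]mulrC !mulrA mulVf// mul1r.
Qed.

(** Balls instead of open sets: finitely many extensions then share the ball of smallest radius. *)
Definition extb f z F := exists2 rho : R, 0 < rho & forall w, cmod (w - z) < rho ->
  derivable F w 1 /\ (cmod w < 1 -> F w = f w).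

Lemma extb_analytic f z F : extb f z F -> analytic_extension f z F.
Proof.
move=> [rho r0 H]; exists [set w | cmod (w - z) < rho]; split.
- exact: open_cball.
- by rewrite /= subrr cmod0.
- by move=> w /H[].
- by move=> w /H[_].
Qed.

Lemma analytic_extb f z F : analytic_extension f z F -> extb f z F.
Proof.
move=> [V [oV Vz hV E]]; have /near_cplxP[rho r0 hr] := open_nbhs_nbhs (conj oV Vz).
by exists rho => // w /hr Vw; split; [exact: hV|exact: E].
Qed.

(** Bounded holomorphic functions with a continuation across z. The continuation is carried along
    explicitly because [extension_at] is an arbitrary choice. *)
Definition nice z f F := [/\ forall w, cmod w < 1 -> derivable f w 1,
  exists2 B : R, 0 <= B & forall w, cmod w < 1 -> cmod (f w) <= B & extb f z F].

Lemma nice_cst z (c : Cplx R) : nice z (fun=> c) (fun=> c).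
Proof.
split; first by move=> w _; exact: der_cst.
  by exists (cmod c) => //; exact: cmod_ge0.
by exists 1 => // w _; split => //; exact: der_cst.
Qed.

Lemma nice_id z : nice z (fun w => w) (fun w => w).
Proof.
split; first by move=> w _; exact: der_id.
  by exists 1 => // w /ltW.
by exists 1 => // w _; split => //; exact: der_id.
Qed.

Lemma niceB z f g F G : nice z f F -> nice z g G -> nice z (fun w => f w - g w) (fun w => F w - G w).
Proof.
move=> [df [B B0 hB] [e e0 he]] [dg [B' B'0 hB'] [e' e'0 he']]; split.
- by move=> w hw; apply: derB; [exact: df|exact: dg].
- exists (B + B'); first exact: addr_ge0.
  by move=> w hw; apply: le_trans (cmodB _ _) _; apply: lerD; [exact: hB|exact: hB'].
- exists (Num.min e e'); first by rewrite lt_min e0 e'0.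
  move=> w; rewrite lt_min => /andP[/he[d1 E1] /he'[d2 E2]]; split; first exact: derB.
  by move=> hw; rewrite E1 ?E2.
Qed.

Lemma niceM z f g F G : nice z f F -> nice z g G -> nice z (fun w => f w * g w) (fun w => F w * G w).
Proof.
move=> [df [B B0 hB] [e e0 he]] [dg [B' B'0 hB'] [e' e'0 he']]; split.
- by move=> w hw; apply: derM; [exact: df|exact: dg].
- exists (B * B'); first exact: mulr_ge0.
  by move=> w hw; rewrite cmodM; apply: ler_pM; rewrite ?cmod_ge0//; [exact: hB|exact: hB'].
- exists (Num.min e e'); first by rewrite lt_min e0 e'0.
  move=> w; rewrite lt_min => /andP[/he[d1 E1] /he'[d2 E2]]; split; first exact: derM.
  by move=> hw; rewrite E1 ?E2.
Qed.

(** Boundedness: near z the quotient agrees with the continuous [dq F z], and elsewhere the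
    denominator is bounded below. *)
Lemma nice_dq z f F : cmod z = 1 -> nice z f F -> nice z (fun w => (f w - F z) / (w - z)) (dq F z).
Proof.
move=> z1 [df [B B0 hB] [e e0 he]].
have wz w : cmod w < 1 -> w - z != 0.
  by move=> hw; rewrite subr_eq0; apply: contraTneq hw => ->; rewrite z1 ltxx.
have dF v : cmod (v - z) < e -> derivable F v 1 by move=> /he[].
have e2 : e / 2 < e by move: e0; lra.
have dQ w : cmod (w - z) < e / 2 -> derivable (dq F z) w 1.
  by move=> hw; exact: (cderiv_derivable (cderiv_dq dF hw e2)).
have EQ w : cmod (w - z) < e -> cmod w < 1 -> dq F z w = (f w - F z) / (w - z).
  move=> h1 h2; have nw : w != z by rewrite -subr_eq0 wz.
  by rewrite (dqE F nw) ((he w h1).2 h2).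
have ze : cmod (z - z) < e / 2 by rewrite subrr cmod0 divr_gt0.
split.
- move=> w hw; apply: (@derM R (fun w => f w - F z) (fun w => (w - z)^-1)).
    by apply: derB; [exact: df|exact: der_cst].
  apply: (@derV R (fun w => w - z)); first exact: wz.
  by apply: derB; [exact: der_id|exact: der_cst].
- have /cont_cplxP/(_ _ ltr01)[d d0 hd] := derivable_continuous (dQ z ze).
  pose s := Num.min d (e / 2); have s0 : 0 < s by rewrite lt_min d0 divr_gt0.
  exists (Num.max (1 + cmod (dq F z z)) ((B + cmod (F z)) / s)).
    by rewrite le_max addr_ge0 ?cmod_ge0.
  move=> w hw; have [h|h] := ltP (cmod (w - z)) s; rewrite le_max.
    move: h; rewrite lt_min => /andP[h1 h2]; rewrite -(EQ w (lt_trans h2 e2) hw).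
    apply/orP; left; rewrite -lerBlDr; apply: le_trans (cmod_ge_sub _ _) _; exact: hd.
  apply/orP; right; rewrite cmodM cmodV; apply: ler_pM; rewrite ?cmod_ge0 ?invr_ge0 ?cmod_ge0//.
    by apply: le_trans (cmodB _ _) _; rewrite lerD2r; exact: hB.
  by rewrite lef_pV2// posrE cmod_gt0 wz.
- exists (e / 2); first by rewrite divr_gt0.
  by move=> w hw; split; [exact: dQ|move=> w1; exact: (EQ w (lt_trans hw e2) w1)].
Qed.

(** The fixed radii for all circle means; starting at 1/2 keeps them positive. *)
Definition rn (n : nat) : R := rad 2^-1 n.

Lemma rn_itv n : 2^-1 <= rn n < 1.
Proof. by apply: rad_itv; [rewrite invr_ge0|rewrite invf_lt1 ?ltr1n]. Qed.
Lemma rn_gt0 n : 0 < rn n.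
Proof. by have /andP[h _] := rn_itv n; apply: lt_le_trans h; rewrite invr_gt0. Qed.
Lemma rn_lt1 n : rn n < 1. Proof. by case/andP: (rn_itv n). Qed.
Lemma cvg_rn : rn n @[n --> \oo] --> (1 : R). Proof. exact: cvg_rad. Qed.
Lemma rn_disk n t : cmod (polar (rn n) t) < 1.
Proof. by rewrite cmod_polar gtr0_norm ?rn_gt0 ?rn_lt1. Qed.

Lemma cvg_polar_rn t : polar (rn n) t @[n --> \oo] --> (polar 1 t : Cplx R).
Proof. exact: (cvg_comp rn (fun r => polar r t) cvg_rn (@polar_cont_r R 1 t)). Qed.

Lemma ext_value f z F F2 : cmod z = 1 -> extb f z F -> extb f z F2 -> F z = F2 z.
Proof.
move=> z1 [e e0 he] [e' e'0 he']; have [t _ zE] := polar_surj z1.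
have zz x : 0 < x -> cmod (z - z) < x by rewrite subrr cmod0.
have [d1 _] := he z (zz _ e0); have [d2 _] := he' z (zz _ e'0).
have /cont_cplxP c1 := derivable_continuous d1; have /cont_cplxP c2 := derivable_continuous d2.
apply/eqP; rewrite -subr_eq0 -cmod_eq0 eq_le cmod_ge0 andbT; apply/ler_addgt0Pl => x x0; rewrite addr0.
have x2 : 0 < x / 2 by rewrite divr_gt0.
have [a a0 ha] := c1 _ x2; have [b b0 hb] := c2 _ x2.
pose m := Num.min (Num.min e e') (Num.min a b).
have m0 : 0 < m by rewrite !lt_min e0 e'0 a0 b0.
have m2 : 0 < m / 2 by rewrite divr_gt0.
have /cvg_cplxP/(_ _ m2)[N _ hN] := @cvg_polar_rn t.
have hw : cmod (polar (rn N) t - polar 1 t) <= m / 2 := hN N (leqnn N).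
rewrite -zE in hw; set w := polar _ _ in hw.
have : cmod (w - z) < m by apply: le_lt_trans hw _; move: m0; lra.
rewrite !lt_min => /andP[/andP[h1 h2] /andP[h3 h4]].
have w1 : cmod w < 1 by exact: rn_disk.
have -> : F z - F2 z = (F2 w - F2 z) - (F w - F z).
  by rewrite ((he w h1).2 w1) ((he' w h2).2 w1); ring.
apply: le_trans (cmodB _ _) _; rewrite [leRHS]splitr; apply: lerD; [exact: hb|exact: ha].
Qed.

(** The partner relation f conj(u) = conj(f') on the circle, expressed without boundary values of
    any of the three functions. *)
Definition bdry u f f' := {ae mu, forall t, 0 <= t <= twopi R ->
  cmod (f (polar (rn n) t) * (u (polar (rn n) t))^* - (f' (polar (rn n) t))^*) @[n --> \oo] --> (0 : R)}.

(** Angles of full measure accumulate at z, and the continuations are continuous there, so the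
    relation holds at z itself; it is solved for F'(z) by conjugation. *)
Lemma bdry_value u f f' z U F F' : cmod z = 1 -> extb u z U -> extb f z F -> extb f' z F' ->
  bdry u f f' -> F' z = U z * (F z)^*.
Proof.
move=> z1 [e1 e10 he1] [e2 e20 he2] [e3 e30 he3] hb.
have zz x : 0 < x -> cmod (z - z) < x by rewrite subrr cmod0.
have [d1 _] := he1 z (zz _ e10); have [d2 _] := he2 z (zz _ e20); have [d3 _] := he3 z (zz _ e30).
pose De w := F w * (U w)^* - (F' w)^*.
have cD : {for z, continuous De}.
  apply: contB; last by apply: contJ; exact: derivable_continuous.
  by apply: contM; [exact: derivable_continuous|apply: contJ; exact: derivable_continuous].
suff D0 : De z = 0.
  move/eqP: D0; rewrite /De subr_eq0 => /eqP D0.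
  by rewrite -[F' z]conjCK -D0 rmorphM /= conjCK mulrC.
apply/eqP; rewrite -cmod_eq0 eq_le cmod_ge0 andbT; apply/ler_addgt0Pl => x x0; rewrite addr0.
have x2 : 0 < x / 2 by rewrite divr_gt0.
have [a a0 ha] := (cont_cplxP De z).1 cD _ x2.
pose m := Num.min (Num.min e1 e2) (Num.min e3 a).
have m0 : 0 < m by rewrite !lt_min e10 e20 e30 a0.
have [t0 /andP[t00 t02] zE] := polar_surj z1.
have m2 : 0 < m / 2 by rewrite divr_gt0.
(* A good angle near t0, on the side that stays in [0, 2 pi]: to the right if t0 < 2 pi, to the left
   otherwise. *)
have [t [ht1 ht2 ht3]] : exists t, [/\ 0 <= t <= twopi R, `|t - t0| <= m / 2 &
    cmod (f (polar (rn n) t) * (u (polar (rn n) t))^* - (f' (polar (rn n) t))^*) @[n --> \oo] --> (0 : R)].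
  have tp := twopi_gt0 R.
  have [h|h] := ltP t0 (twopi R).
    have hlt : t0 < Num.min (t0 + m / 2) (twopi R) by rewrite lt_min h ltrDl m2.
    have [t /andP[ta tb] P] := ae_exists hlt hb; move: tb; rewrite lt_min => /andP[tb1 tb2].
    exists t; split; last by apply: P; apply/andP; split; lra.
      by apply/andP; split; lra.
    by rewrite ler_norml; apply/andP; split; lra.
  have hlt : Num.max (t0 - m / 2) 0 < t0 by rewrite gt_max gtrBl m2 (lt_le_trans tp).
  have [t /andP[+ tb] P] := ae_exists hlt hb; rewrite gt_max => /andP[ta1 ta2].
  exists t; split; last by apply: P; apply/andP; split; lra.
    by apply/andP; split; lra.
  by rewrite ler_norml; apply/andP; split; lra.
have dz : cmod (polar 1 t - z) <= m / 2.
  rewrite zE; apply: le_trans (polar_lip2 _ _ _ _) _.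
  by rewrite subrr normr0 addr0 normr1 mul1r.
have m4 : 0 < m / 4 by rewrite divr_gt0.
have /cvg_cplxP/(_ _ m4) H1 := @cvg_polar_rn t.
move/cvgrPdist_le: ht3 => /(_ _ x2) H2.
have [N _ hN] : \forall n \near \oo, cmod (polar (rn n) t - polar 1 t) <= m / 4 /\
   `|0 - cmod (f (polar (rn n) t) * (u (polar (rn n) t))^* - (f' (polar (rn n) t))^*)| <= x / 2.
  by apply: filterS2 H1 H2.
have [h1 h2] := hN N (leqnn N); move: h1 h2; have w1 := rn_disk N t.
set w := polar (rn N) t in w1 * => h1; rewrite sub0r normrN ger0_norm ?cmod_ge0// => h2.
have : cmod (w - z) < m.
  have -> : w - z = (w - polar 1 t) + (polar 1 t - z) by ring.
  by apply: le_lt_trans (cmodD _ _) _; move: h1 dz m0; lra.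
rewrite !lt_min => /andP[/andP[k1 k2] /andP[k3 k4]].
have E : De w = f w * (u w)^* - (f' w)^*.
  by rewrite /De ((he1 w k1).2 w1) ((he2 w k2).2 w1) ((he3 w k3).2 w1).
have -> : De z = De w - (De w - De z) by ring.
apply: le_trans (cmodB _ _) _; rewrite [leRHS]splitr; apply: lerD; last exact: ha.
by rewrite E.
Qed.

(** Both ends of [0, 2 pi] give the same point, hence the extra excluded angles; together they are
    negligible in [bdry_step]. *)
Lemma polar1_inj s t : 0 <= s <= twopi R -> 0 <= t <= twopi R -> t != s -> t != s + twopi R ->
  t != s - twopi R -> polar 1 t != polar 1 s :> Cplx R.
Proof.
move=> /andP[s0 s1] /andP[t0 t1] n1 n2 n3; apply/eqP => E.
pose y := (t - s) / 2.
have ty : t = s + (y + y) by rewrite /y -splitr addrC subrK.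
have : polar 1 (y + y) = 1 :> Cplx R.
  by apply: (mulfI (polar1_neq0 s)); rewrite -polarD -ty E mulr1.
move=> [+ _]; rewrite mul1r cosD => C.
have sy : sin y = 0.
  have := sin2cos2 y; rewrite !expr2 => S.
  by apply/eqP; rewrite -sqrf_eq0 expr2; apply/eqP; move: C S; lra.
have tp : twopi R = 2 * pi by [].
have := pi_gt0 R => p0.
have [y0|y0|y0] := ltgtP y 0.
- have := @sin_gt0_pi R (- y); rewrite sinN sy oppr0 ltxx oppr_gt0 y0 /= => H.
  have ym : - y >= pi by rewrite leNgt; apply/negP => /H.
  by move/eqP: n3; apply; move: ym ty s1 t0; rewrite tp; lra.
- have := @sin_gt0_pi R y; rewrite sy ltxx y0 /= => H.
  have ym : y >= pi by rewrite leNgt; apply/negP => /H.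
  by move/eqP: n2; apply; move: ym ty s0 t1; rewrite tp; lra.
- by move/eqP: n1; apply; rewrite ty y0 !addr0.
Qed.

(** On |w| = 1 the function 1 / (w - z) is the conjugate of -z w / (w - z), which turns (f - c)
    conj(u) / (w - z) into a conjugate of a holomorphic function. *)
Lemma bdry_step u f f' z (c : Cplx R) (B : R) : cmod z = 1 ->
  (forall w, cmod w < 1 -> cmod (u w) <= B) -> (forall w, cmod w < 1 -> cmod (f' w) <= B) ->
  bdry u f f' ->
  bdry u (fun w => (f w - c) / (w - z)) (fun w => - z * w * ((f' w - c^* * u w) / (w - z))).
Proof.
move=> z1 hu hf' hb; have [t0 ht0 zE] := polar_surj z1.
have zz : z * z^* = 1 by rewrite mulJ_cmod z1 expr1n.
move: (ae_and hb (ae_and (ae_neq t0) (ae_and (ae_neq (t0 + twopi R)) (ae_neq (t0 - twopi R))))).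
apply: ae_imp => t [hD [n1 [n2 n3]]] ht; have {}hD := hD ht.
have pz : polar 1 t != z by rewrite zE; exact: polar1_inj.
pose v n : Cplx R := polar (rn n) t.
pose D n := cmod (f (v n) * (u (v n))^* - (f' (v n))^*).
pose d := cmod (polar 1 t - z).
have d0 : d != 0 by rewrite cmod_eq0 subr_eq0.
have vz n : v n - z != 0.
  by rewrite subr_eq0; apply/eqP => E; have := rn_disk n t; rewrite -/(v n) E z1 ltxx.
have cd : (cmod (v n - z))^-1 @[n --> \oo] --> d^-1.
  apply: cvgV => //; apply: cvg_cmod.
  by apply: (@ccvgB R _ _ eventually_filter v (fun=> z)); [exact: cvg_polar_rn|exact: ccvg_cst].
pose K := B + cmod c * B.
have S : (D n * (cmod (v n - z))^-1 + K * (1 - rn n * rn n) * ((cmod (v n - z))^-1 * (cmod (v n - z))^-1)) @[n --> \oo]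
    --> 0 * d^-1 + K * (1 - 1 * 1) * (d^-1 * d^-1).
  apply: cvgD; first by apply: cvgM; [exact: hD|exact: cd].
  apply: cvgM; last by apply: cvgM; exact: cd.
  apply: cvgM; first exact: cvg_cst.
  by apply: cvgB; [exact: cvg_cst|apply: cvgM; exact: cvg_rn].
rewrite mul0r mulr1 subrr mulr0 mul0r addr0 in S.
apply/cvgrPdist_le => e e0; move/cvgrPdist_le: S => /(_ _ e0); apply: filterS => n.
rewrite !sub0r !normrN (ger0_norm (cmod_ge0 _)) => h; apply: le_trans (le_trans (ler_norm _) h).
rewrite -/(v n) /D; have w1 : cmod (v n) < 1 by exact: rn_disk.
have := hu _ w1; have := hf' _ w1; have nz := vz n.
have vv : v n * (v n)^* = (rn n * rn n)%:C%C.
  by rewrite mulJ_cmod cmod_polar real_normK ?num_real// expr2.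
move: vv nz w1; move: (v n) (f (v n)) (f' (v n)) (u (v n)) => w fw f'w uw vv nz w1 hf'w huw.
have wJ : w^* - z^* != 0 by rewrite -rmorphB -cmod_gt0 cmodJ cmod_gt0.
have EJ : (- z * w * ((f'w - c^* * uw) / (w - z)))^* = - (z^* * w^*) * ((f'w^* - c * uw^*) / (w^* - z^*)).
  by rewrite !rmorphM fmorphV !rmorphB !rmorphM rmorphN /= conjCK mulNr.
rewrite EJ.
(* The error of that identity inside the disk; it tends to 0 along a fixed radius not ending at
   z. *)
have br : (w - z)^-1 + z^* * w^* / (w^* - z^*) = - z^* * (1 - rn n * rn n)%:C%C / ((w - z) * (w^* - z^*)).
  have -> : (1 - rn n * rn n)%:C%C = 1 - w * w^* :> Cplx R by rewrite vv rmorphB rmorph1.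
  transitivity ((w^* - z^* + z^* * (w * w^*) - z * z^* * w^*) / ((w - z) * (w^* - z^*))).
    by field; rewrite nz wJ.
  by rewrite zz; congr (_ / _); ring.
have -> : (fw - c) / (w - z) * uw^* - - (z^* * w^*) * ((f'w^* - c * uw^*) / (w^* - z^*)) =
   (fw * uw^* - f'w^*) / (w - z) + (f'w^* - c * uw^*) * ((w - z)^-1 + z^* * w^* / (w^* - z^*)).
  by field; rewrite nz wJ.
rewrite br; apply: le_trans (cmodD _ _) _; rewrite cmodM cmodV; apply: lerD => //.
have hK : cmod (f'w^* - c * uw^*) <= K.
  by apply: le_trans (cmodB _ _) _; rewrite cmodJ cmodM cmodJ /K lerD// ler_wpM2l// cmod_ge0.
have r0 : 0 <= 1 - rn n * rn n.
  by have := rn_gt0 n; have := rn_lt1 n; move: (rn n) => r r1 rp; nra.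
rewrite cmodM -[leRHS]mulrA; apply: ler_pM => //; try exact: cmod_ge0.
have -> : w^* - z^* = (w - z)^* by rewrite rmorphB.
rewrite cmodM cmodV [cmod (- z^* * _)]cmodM [cmod ((w - z) * _)]cmodM cmodN !cmodJ z1 mul1r.
by rewrite cmodC ger0_norm// invfM.
Qed.

End BoundaryClass.

(** * Limits of circle means *)

Section HardyLimits.
Variable R : realType.
Implicit Types (f g h u F G X Y : Cplx R -> Cplx R) (z w : Cplx R) (r t K L : R).

(** The weighted form |x y| <= (s x^2 + y^2 / s) / 2 is linear in the two means, hence stable under
    limits; the weight is chosen by each user. *)
Lemma mean_CS r X Y (s : R) : bmc r X -> bmc r Y -> 0 < s ->
  cmod (cmean r (fun w => X w * (Y w)^*)) <=
  (s * rmean r (fun w => cmod (X w) ^+ 2) + s^-1 * rmean r (fun w => cmod (Y w) ^+ 2)) / 2.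
Proof.
move=> bX bY s0; have bXY := bmcM bX (bmcJ bY).
apply: le_trans (cmean_norm bXY) _; rewrite /rmean.
have bX2 : rbm 0 (twopi R) (fun t => cmod (X (polar r t)) ^+ 2).
  by apply: (rbm_ext _ (rbmM (bm_cmod bX) (bm_cmod bX))) => t _; rewrite expr2.
have bY2 : rbm 0 (twopi R) (fun t => cmod (Y (polar r t)) ^+ 2).
  by apply: (rbm_ext _ (rbmM (bm_cmod bY) (bm_cmod bY))) => t _; rewrite expr2.
have c1 := rbmM (rbm_cst 0 (twopi R) (s / 2)) bX2.
have c2 := rbmM (rbm_cst 0 (twopi R) (s^-1 / 2)) bY2.
have H : rint 0 (twopi R) (fun t => cmod (X (polar r t) * (Y (polar r t))^*)) <=
    rint 0 (twopi R) (fun t => s / 2 * cmod (X (polar r t)) ^+ 2 + s^-1 / 2 * cmod (Y (polar r t)) ^+ 2).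
  apply: rint_le; [exact: bm_cmod bXY|exact: rbmD|].
  move=> t _; rewrite cmodM cmodJ; set x := cmod _; set y := cmod _.
  rewrite -subr_ge0; have -> : s / 2 * x ^+ 2 + s^-1 / 2 * y ^+ 2 - x * y = (s * x - y) ^+ 2 / (2 * s).
    by field; rewrite gt_eqF.
  by rewrite divr_ge0 ?sqr_ge0// mulr_ge0// ltW.
rewrite (rintD c1 c2) (rintZ _ bX2) (rintZ _ bY2) in H.
have tp : 0 <= (twopi R)^-1 by rewrite invr_ge0 tp_ge0.
apply: le_trans (ler_wpM2l tp H) _; rewrite le_eqVlt; apply/orP; left; apply/eqP; ring.
Qed.

(** The function f conj(u h) differs from conj(f' h), whose mean is its value at 0, by (f conj(u) -
    conj(f')) conj(h). The first factor tends to 0 in mean square by dominated convergence, while h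
    is merely bounded in mean square. *)
Lemma mean_limit u f f' h (B Bf Bf' K : R) :
  (forall w, cmod w < 1 -> derivable u w 1) -> (forall w, cmod w < 1 -> derivable f w 1) ->
  (forall w, cmod w < 1 -> derivable f' w 1) -> (forall w, cmod w < 1 -> derivable h w 1) ->
  (forall w, cmod w < 1 -> cmod (u w) <= B) -> (forall w, cmod w < 1 -> cmod (f w) <= Bf) ->
  (forall w, cmod w < 1 -> cmod (f' w) <= Bf') -> bdry u f f' ->
  (forall n, rmean (rn R n) (fun w => cmod (h w) ^+ 2) <= K) ->
  cmean (rn R n) (fun w => f w * (u w * h w)^*) @[n --> \oo] --> (f' 0 * h 0)^*.
Proof.
move=> du df df' dh hu hf hf' hb hK.
have b X n : (forall w, cmod w < 1 -> derivable X w 1) -> bmc (rn R n) X.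
  by move=> dX; exact: bmc_der dX (ltW (rn_gt0 R n)) (rn_lt1 R n).
pose De w := f w * (u w)^* - (f' w)^*.
have bD n : bmc (rn R n) De.
  by apply: bmcB; [apply: bmcM; [exact: b|apply: bmcJ; exact: b]|apply: bmcJ; exact: b].
have E n : cmean (rn R n) (fun w => f w * (u w * h w)^*) - (f' 0 * h 0)^* = cmean (rn R n) (fun w => De w * (h w)^*).
  have dfh w : cmod w < 1 -> derivable (fun w => f' w * h w) w 1.
    by move=> hw; apply: derM; [exact: df'|exact: dh].
  rewrite -(cmean_holo dfh (ltW (rn_gt0 R n)) (rn_lt1 R n)) -(cmeanJ (b _ n dfh)) -cmeanB.
  - by apply: cmean_ext => t; rewrite /De !rmorphM /=; ring.
  - by apply: bmcM; [exact: b|apply: bmcJ; apply: bmcM; exact: b].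
  - by apply: bmcJ; exact: b.
have D2 : rmean (rn R n) (fun w => cmod (De w) ^+ 2) @[n --> \oo] --> (0 : R).
  rewrite -(mulr0 (twopi R)^-1); apply: cvgM; first exact: cvg_cst.
  apply: (@rint_dct R 0 (twopi R) (fun n t => cmod (De (polar (rn R n) t)) ^+ 2) ((Bf * B + Bf') ^+ 2) (tp_ge0 R)).
  - move=> n; have bDn := bm_cmod (bD n).
    by apply: (rbm_ext _ (rbmM bDn bDn)) => t _; rewrite expr2.
  - move=> n t _; rewrite ger0_norm ?sqr_ge0//; have w1 := rn_disk n t.
    rewrite lerXn2r ?nnegrE ?cmod_ge0//.
      apply: addr_ge0; last exact: le_trans (cmod_ge0 _) (hf' _ w1).
      by apply: mulr_ge0; [exact: le_trans (cmod_ge0 _) (hf _ w1)|exact: le_trans (cmod_ge0 _) (hu _ w1)].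
    apply: le_trans (cmodB _ _) _; rewrite cmodM !cmodJ; apply: lerD; last exact: hf'.
    by apply: ler_pM; rewrite ?cmod_ge0//; [exact: hf|exact: hu].
  - move: hb; apply: ae_imp => t H ht; have {}H := H ht.
    rewrite -(mulr0 (0 : R)) (_ : (fun n => _) = (fun n => cmod (De (polar (rn R n) t)) * cmod (De (polar (rn R n) t)))).
      by apply: cvgM; exact: H.
    by apply/funext => n; rewrite expr2.
have K0 : 0 <= K.
  apply: le_trans (hK 0%N); rewrite /rmean mulr_ge0 ?invr_ge0 ?tp_ge0//.
  by apply: rint_ge0 => t _; exact: sqr_ge0.
apply: cplx_sub_cvg0; rewrite (funext E); apply/cvg_cplxP => e e0.
(* With this weight the term of h is at most K / s <= e, and the other one is eventually at most e;
   K + 1 is positive even for K = 0. *)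
pose s := (K + 1) / e; have s0 : 0 < s by rewrite divr_gt0// ltr_wpDl.
have es : 0 < e / s by rewrite divr_gt0.
move/cvgrPdist_le: D2 => /(_ _ es); apply: filterS => n; rewrite sub0r normrN => hn.
rewrite subr0; apply: le_trans (mean_CS (bD n) (b h n dh) s0) _.
have h1 : s * rmean (rn R n) (fun w => cmod (De w) ^+ 2) <= e.
  by rewrite mulrC -ler_pdivlMr//; exact: le_trans (ler_norm _) hn.
have h2 : s^-1 * rmean (rn R n) (fun w => cmod (h w) ^+ 2) <= e.
  rewrite mulrC ler_pdivrMr// /s mulrCA divff ?gt_eqF// mulr1.
  by apply: le_trans (hK n) _; rewrite lerDl.
by move: h1 h2; lra.
Qed.

Lemma cvg_rnX k : rn R n ^+ k @[n --> \oo] --> (1 : R).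
Proof.
elim: k => [|k IH]; first by under eq_fun do rewrite expr0; exact: cvg_cst.
have -> : (fun n => rn R n ^+ k.+1) = (fun n => rn R n * rn R n ^+ k) by apply/funext => n; rewrite exprS.
by rewrite -[X in _ --> X](mulr1 (1 : R)); apply: cvgM; [exact: cvg_rn|exact: IH].
Qed.

Lemma cvg_poly_rn (c : nat -> R) N :
  \sum_(n < N) c n * rn R j ^+ (2 * n) @[j --> \oo] --> \sum_(n < N) c n.
Proof.
elim: N => [|N IH].
  by rewrite big_ord0; under eq_fun do rewrite big_ord0; exact: cvg_cst.
rewrite big_ord_recr /=; under eq_fun do rewrite big_ord_recr /=.
apply: cvgD; first exact: IH.
by rewrite -[X in _ --> X]mulr1; apply: cvgM; [exact: cvg_cst|exact: cvg_rnX].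
Qed.

(** Bessel at radius r_n, with N fixed and n large: the weights r_n^(2k) on finitely many
    coefficients tend to 1, so an asymptotic bound on the means suffices. *)
Lemma coef_bound f L : (forall w, cmod w < 1 -> derivable f w 1) ->
  (forall e, 0 < e -> \forall n \near \oo, rmean (rn R n) (fun w => cmod (f w) ^+ 2) <= L + e) ->
  forall N, \sum_(n < N) cmod (taylor_coef f n) ^+ 2 <= L.
Proof.
move=> df hL N; apply/ler_addgt0Pl => e e0.
have e2 : 0 < e / 2 by rewrite divr_gt0.
have Hc := @cvg_poly_rn (fun n => cmod (taylor_coef f n) ^+ 2) N.
move/cvgrPdist_le: Hc => /(_ _ e2) H.
have [M _ hM] : \forall n \near \oo, rmean (rn R n) (fun w => cmod (f w) ^+ 2) <= L + e / 2 /\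
    `|\sum_(k < N) cmod (taylor_coef f k) ^+ 2 - \sum_(k < N) cmod (taylor_coef f k) ^+ 2 * rn R n ^+ (2 * k)| <= e / 2.
  by apply: filterS2 (hL _ e2) H.
have [h1 h2] := hM M (leqnn M).
have h3 := le_trans (bessel N df (rn_gt0 R M) (rn_lt1 R M)) h1.
by move: (le_trans (ler_norm _) h2) h3; lra.
Qed.

(* Abel summation: the Abel means of a dominated series determine its sum. *)
Lemma abel_zero (x y : nat -> Cplx R) (c : nat -> R) (K : R) : (forall n, cmod (x n) <= c n) ->
  (forall N, \sum_(n < N) c n <= K) ->
  (forall j, (fun N => \sum_(n < N) x n * (rn R j ^+ (2 * n))%:C%C) @ \oo --> y j) ->
  y @ \oo --> (0 : Cplx R) -> limn (series x) = 0.
Proof.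
move=> hx hK hy y0.
have c0 n : 0 <= c n by apply: le_trans (hx n); exact: cmod_ge0.
pose C N := \sum_(n < N) c n.
have nd : {homo C : n m / (n <= m)%N >-> n <= m}.
  by apply/nondecreasing_seqP => n; rewrite /C big_ord_recr /= lerDl.
have cC : cvgn C by apply: nondecreasing_is_cvgn => //; exists K => _ [N _ <-]; exact: hK.
have Cle := nondecreasing_cvgn_le nd cC; set l := limn C in Cle.
pose S j N := \sum_(n < N) x n * (rn R j ^+ (2 * n))%:C%C.
pose P j N := \sum_(n < N) c n * rn R j ^+ (2 * n).
have rX j n : 0 <= rn R j ^+ n <= 1.
  by rewrite exprn_ge0 ?exprn_ile1// ltW ?rn_gt0 ?rn_lt1.
(* Inserting the Abel weights changes a partial sum by no more than it changes that of the
   dominating series. *)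
have A1 j N : cmod (S j N - \sum_(n < N) x n) <= C N - P j N.
  rewrite /S /C /P -!sumrB; apply: le_trans (cmod_sum _ _) _; apply: ler_sum => n _.
  rewrite -[X in _ - X]mulr1 -mulrBr cmodM.
  have -> : (rn R j ^+ (2 * n))%:C%C - 1 = (rn R j ^+ (2 * n) - 1)%:C%C :> Cplx R by rewrite rmorphB rmorph1.
  have /andP[p0 p1] := rX j (2 * n)%N.
  rewrite cmodC ler0_norm ?subr_le0// opprB.
  have -> : c n - c n * rn R j ^+ (2 * n) = c n * (1 - rn R j ^+ (2 * n)) by rewrite mulrBr mulr1.
  by apply: ler_wpM2r; rewrite ?subr_ge0.
have A2 j N d : cmod (S j (N + d)%N - S j N) <= C (N + d)%N - C N.
  elim: d => [|d IH]; first by rewrite addn0 !subrr cmod0.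
  rewrite addnS /S /C !big_ord_recr /= -/(S j (N + d)%N) -/(C (N + d)%N).
  rewrite addrAC [X in _ <= X]addrAC; apply: le_trans (cmodD _ _) _; apply: lerD; first exact: IH.
  have /andP[p0 p1] := rX j (2 * (N + d))%N.
  rewrite cmodM cmodC ger0_norm// -[X in _ <= X]mulr1; apply: ler_pM => //; exact: cmod_ge0.
(* For j large the Abel mean [y j] is near 0 and the weights on the first N terms are near 1; the
   terms beyond N cost at most the tail of [c]. So the partial sum is bounded by that tail. *)
have A N : cmod (\sum_(n < N) x n) <= l - C N.
  apply/ler_addgt0Pl => e e0; have e3 : 0 < e / 3 by rewrite divr_gt0.
  have Hc := @cvg_poly_rn c N; move/cvgrPdist_le: Hc => /(_ _ e3) H1.
  move/cvg_cplxP: (y0) => /(_ _ e3) H2.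
  have [j _ hj] : \forall j \near \oo, `|C N - P j N| <= e / 3 /\ cmod (y j - 0) <= e / 3.
    by apply: filterS2 H1 H2.
  have [h1 h2] := hj j (leqnn j); rewrite subr0 in h2.
  have /cvg_cplxP/(_ _ e3)[M _ hM] := hy j.
  have h3 : cmod (S j (N + M)%N - y j) <= e / 3 := hM (N + M)%N (leq_addl N M).
  have -> : \sum_(n < N) x n = y j + (S j (N + M)%N - y j) - (S j (N + M)%N - S j N) - (S j N - \sum_(n < N) x n).
    by ring.
  have k1 := A1 j N; have k2 := A2 j N M; have k3 := Cle (N + M)%N.
  have k4 := ler_norm (C N - P j N).
  apply: le_trans (cmodB _ _) _; apply: le_trans (lerD (cmodB _ _) (lexx _)) _.
  apply: le_trans (lerD (lerD (cmodD _ _) (lexx _)) (lexx _)) _.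
  by move: h1 h2 h3 k1 k2 k3 k4; lra.
apply: cvg_lim => //; apply/cvg_cplxP => e e0.
move/cvgrPdist_le: cC => /(_ _ e0); apply: filterS => N hN.
rewrite subr0 /series /= big_mkord; apply: le_trans (A N) _.
exact: le_trans (ler_norm _) hN.
Qed.

Definition hardy_sum f : \bar R := (\sum_(0 <= n <oo) ((cmod (taylor_coef f n)) ^+ 2)%:E)%E.

Lemma hardy_sum_ge0 f : (0 <= hardy_sum f)%E.
Proof. by apply: nneseries_ge0 => n _ _; rewrite lee_fin sqr_ge0. Qed.

Lemma hardy_sum_le f K : (forall N, \sum_(n < N) cmod (taylor_coef f n) ^+ 2 <= K) -> (hardy_sum f <= K%:E)%E.
Proof.
move=> H; apply: lime_le; first by apply: is_cvg_nneseries => n _ _; rewrite lee_fin sqr_ge0.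
by apply: nearW => N; rewrite sumEFin lee_fin big_mkord.
Qed.

Lemma hardy_sum_ge f N : ((\sum_(n < N) cmod (taylor_coef f n) ^+ 2)%:E <= hardy_sum f)%E.
Proof.
have := @nneseries_lim_ge R (fun n => ((cmod (taylor_coef f n)) ^+ 2)%:E) xpredT 0%N N.
rewrite sumEFin big_mkord; apply=> n _ _; by rewrite lee_fin sqr_ge0.
Qed.

Lemma hardy_norm_lt f : (hardy_norm f < +oo)%E -> exists K : R, forall N, \sum_(n < N) cmod (taylor_coef f n) ^+ 2 <= K.
Proof.
rewrite /hardy_norm -/(hardy_sum f) => H.
have : hardy_sum f \is a fin_num.
  by rewrite -(sqrte_fin_num (hardy_sum_ge0 f)) ge0_fin_numE ?sqrte_ge0.
case E : (hardy_sum f) => [s| |]// _; exists s => N.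
by have := hardy_sum_ge f N; rewrite E lee_fin.
Qed.

Lemma hardy_norm_le f K : 0 <= K -> (forall N, \sum_(n < N) cmod (taylor_coef f n) ^+ 2 <= K ^+ 2) -> (hardy_norm f <= K%:E)%E.
Proof.
move=> K0 H; rewrite /hardy_norm -/(hardy_sum f).
have -> : K%:E = sqrte (K%:E ^+ 2)%E by rewrite sqrte_sqr gee0_abs.
by rewrite lee_sqrt ?sqre_ge0//; exact: hardy_sum_le.
Qed.

Lemma rmean_bound f B : (forall w, cmod w < 1 -> derivable f w 1) ->
  (forall w, cmod w < 1 -> cmod (f w) <= B) -> forall n, rmean (rn R n) (fun w => cmod (f w) ^+ 2) <= B ^+ 2.
Proof.
move=> df hB n; have bf := bmc_der df (ltW (rn_gt0 R n)) (rn_lt1 R n).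
have B0 : 0 <= B by apply: le_trans (cmod_ge0 _) (hB _ (rn_disk n 0)).
have := rint_cst (B ^+ 2) (tp_ge0 R); rewrite subr0 => E.
rewrite /rmean mulrC ler_pdivrMr ?twopi_gt0// -E; apply: rint_le; last 1 first.
- by move=> t _; rewrite lerXn2r ?nnegrE ?cmod_ge0//; apply: hB; exact: rn_disk.
- by apply: (rbm_ext _ (rbmM (bm_cmod bf) (bm_cmod bf))) => t _; rewrite expr2.
- exact: rbm_cst.
Qed.

(** By [mean_limit] the means of f conj(u h) tend to conj(f'(0) h(0)) = 0; they are Abel means of
    the series that defines the inner product of f and u h. *)
Lemma class_model u f f' (B Bf Bf' : R) :
  (forall w, cmod w < 1 -> derivable u w 1) -> (forall w, cmod w < 1 -> derivable f w 1) ->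
  (forall w, cmod w < 1 -> derivable f' w 1) ->
  (forall w, cmod w < 1 -> cmod (u w) <= B) -> (forall w, cmod w < 1 -> cmod (f w) <= Bf) ->
  (forall w, cmod w < 1 -> cmod (f' w) <= Bf') -> bdry u f f' -> f' 0 = 0 -> model_space u f.
Proof.
move=> du df df' hu hf hf' hb f'0.
have d0 : cmod (0 : Cplx R) < 1 by rewrite cmod0.
have B0 : 0 <= B by apply: le_trans (cmod_ge0 _) (hu _ d0).
have Bf0 : 0 <= Bf by apply: le_trans (cmod_ge0 _) (hf _ d0).
have cf : forall N, \sum_(n < N) cmod (taylor_coef f n) ^+ 2 <= Bf ^+ 2.
  apply: coef_bound => // e e0; apply: nearW => n.
  by apply: le_trans (rmean_bound df hf n) _; rewrite lerDl ltW.
split.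
  split; first by move=> w hw; exact: df.
  by apply: le_lt_trans (hardy_norm_le Bf0 cf) _; rewrite ltry.
move=> h [dh /hardy_norm_lt[K hK]].
have {}dh w : cmod w < 1 -> derivable h w 1 by move=> hw; exact: dh.
have duh w : cmod w < 1 -> derivable (fun w => u w * h w) w 1.
  by move=> hw; apply: derM; [exact: du|exact: dh].
have mh n := parseval_le dh (rn_gt0 R n) (rn_lt1 R n) (ltW (rn_lt1 R n)) hK.
have muh n : rmean (rn R n) (fun w => cmod (u w * h w) ^+ 2) <= B ^+ 2 * K.
  apply: le_trans (_ : B ^+ 2 * rmean (rn R n) (fun w => cmod (h w) ^+ 2) <= _); last by rewrite ler_wpM2l ?sqr_ge0.
  rewrite /rmean mulrCA ler_wpM2l ?invr_ge0 ?tp_ge0//.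
  have bh := bmc_der dh (ltW (rn_gt0 R n)) (rn_lt1 R n).
  have buh := bmc_der duh (ltW (rn_gt0 R n)) (rn_lt1 R n).
  have bh2 : rbm 0 (twopi R) (fun t => cmod (h (polar (rn R n) t)) ^+ 2).
    by apply: (rbm_ext _ (rbmM (bm_cmod bh) (bm_cmod bh))) => t _; rewrite expr2.
  rewrite -(rintZ _ bh2); apply: rint_le.
  - by apply: (rbm_ext _ (rbmM (bm_cmod buh) (bm_cmod buh))) => t _; rewrite expr2.
  - exact: rbmM (rbm_cst _ _ _) bh2.
  - move=> t _; rewrite cmodM exprMn ler_wpM2r ?sqr_ge0// lerXn2r ?nnegrE ?cmod_ge0//.
    by apply: hu; exact: rn_disk.
have cuh : forall N, \sum_(n < N) cmod (taylor_coef (fun w => u w * h w) n) ^+ 2 <= B ^+ 2 * K.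
  apply: coef_bound => // e e0; apply: nearW => n.
  by apply: le_trans (muh n) _; rewrite lerDl ltW.
have L := mean_limit du df df' dh hu hf hf' hb mh.
rewrite f'0 mul0r rmorph0 in L.
(* The dominating series comes from a b <= (a^2 + b^2) / 2 for the coefficients of f and u h. *)
rewrite /hardy_dot; apply: (@abel_zero _ (fun j => cmean (rn R j) (fun w => f w * (u w * h w)^*))
  (fun n => (cmod (taylor_coef f n) ^+ 2 + cmod (taylor_coef (fun w => u w * h w) n) ^+ 2) / 2) ((Bf ^+ 2 + B ^+ 2 * K) / 2)).
- move=> n; rewrite cmodM cmodJ -subr_ge0; set a := cmod _; set b := cmod _.
  have -> : (a ^+ 2 + b ^+ 2) / 2 - a * b = (a - b) ^+ 2 / 2 by field.
  by rewrite divr_ge0// sqr_ge0.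
- by move=> N; rewrite -mulr_suml big_split /=; have := cf N; have := cuh N; lra.
- by move=> j; exact: (parseval_cvg df duh (rn_gt0 R j) (rn_lt1 R j)).
- exact: L.
Qed.

(* The pairing with k = (u - c) / (z - zeta) reproduces zeta * conj c * f(zeta). *)
Lemma reproducing_limit u f f1 f' f1' z (c Fz : Cplx R) (B Bf Bf1 Bf' Bf1' Bk : R) k :
  cmod z = 1 -> (forall w, k w = (u w - c) / (w - z)) -> (forall w, cmod w < 1 -> f1 w = (f w - Fz) / (w - z)) ->
  (forall w, cmod w < 1 -> derivable u w 1) -> (forall w, cmod w < 1 -> derivable f w 1) ->
  (forall w, cmod w < 1 -> derivable f' w 1) -> (forall w, cmod w < 1 -> derivable f1 w 1) ->
  (forall w, cmod w < 1 -> derivable f1' w 1) -> (forall w, cmod w < 1 -> derivable k w 1) ->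
  (forall w, cmod w < 1 -> cmod (u w) <= B) -> (forall w, cmod w < 1 -> cmod (f w) <= Bf) ->
  (forall w, cmod w < 1 -> cmod (f' w) <= Bf') -> (forall w, cmod w < 1 -> cmod (f1 w) <= Bf1) ->
  (forall w, cmod w < 1 -> cmod (f1' w) <= Bf1') -> (forall w, cmod w < 1 -> cmod (k w) <= Bk) ->
  bdry u f f' -> bdry u f1 f1' -> f' 0 = 0 -> f1' 0 = 0 ->
  cmean (rn R n) (fun w => f w * (k w)^*) @[n --> \oo] --> z * c^* * Fz.
Proof.
move=> z1 kE f1E du df df' df1 df1' dk hu hf hf' hf1 hf1' hk hb hb1 f'0 f1'0.
have d0 : cmod (0 : Cplx R) < 1 by rewrite cmod0.
have zz : z * z^* = 1 by rewrite mulJ_cmod z1 expr1n.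
have z0 : z != 0 by rewrite -cmod_gt0 z1.
have b X n : (forall w, cmod w < 1 -> derivable X w 1) -> bmc (rn R n) X.
  by move=> dX; exact: bmc_der dX (ltW (rn_gt0 R n)) (rn_lt1 R n).
have d1 (w : Cplx R) : cmod w < 1 -> derivable (fun _ : Cplx R => (1 : Cplx R)) w 1 by move=> _; exact: der_cst.
have h1 n : rmean (rn R n) (fun _ : Cplx R => cmod (1 : Cplx R) ^+ 2) <= 1.
  have := @rmean_bound (fun=> 1) 1 d1; rewrite expr1n; apply => w _; by rewrite cmod1.
have L1 := mean_limit du df df' d1 hu hf hf' hb h1.
have L2 := mean_limit du df1 df1' d1 hu hf1 hf1' hb1 h1.
rewrite f'0 mul0r rmorph0 in L1; rewrite f1'0 mul0r rmorph0 in L2.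
have bzf1 n : bmc (rn R n) (fun w => w * f1 w) by apply: bmcM; [exact: bmc_id|exact: b].
have m0 n : cmean (rn R n) (fun w => w * f1 w) = 0.
  have dz w : cmod w < 1 -> derivable (fun w => w * f1 w) w 1.
    by move=> hw; apply: derM; [exact: der_id|exact: df1].
  by rewrite (cmean_holo dz (ltW (rn_gt0 R n)) (rn_lt1 R n)) mul0r.
pose M1 n := cmean (rn R n) (fun w => f w * (u w * 1)^*).
pose M2 n := cmean (rn R n) (fun w => f1 w * (u w * 1)^*).
pose M3 n := cmean (rn R n) (fun w => f1 w * (k w)^*).
(* Write f = Fz + (w - z) f1. On |w| = 1, w - z = -w z conj(w - z), so (w - z) f1 conj(k) = -w z f1
   conj(u - c); then replace w f1 by f - Fz + z f1 in the part with conj(u). [M1] and [M2] tend to 0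
   because the partners vanish at 0, and the factor 1 - r^2 measures the defect on the circle of
   radius r. *)
have EM n : cmean (rn R n) (fun w => f w * (k w)^*) =
    (Fz * (k 0)^* + z * Fz * (u 0)^*) - (z * M1 n + (z * z * M2 n + z * (1 - rn R n * rn R n)%:C%C * M3 n)).
  have b1 : bmc (rn R n) (fun w => f w * (u w * 1)^*).
    by apply: bmcM; [exact: b|apply: bmcJ; apply: bmcM; [exact: b|exact: bmc_cst]].
  have b2 : bmc (rn R n) (fun w => f1 w * (u w * 1)^*).
    by apply: bmcM; [exact: b|apply: bmcJ; apply: bmcM; [exact: b|exact: bmc_cst]].
  have b3 : bmc (rn R n) (fun w => f1 w * (k w)^*) by apply: bmcM; [exact: b|apply: bmcJ; exact: b].
  have bk := bmcJ (b k n dk); have bu := bmcJ (b u n du).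
  rewrite -(cmean_holo dk (ltW (rn_gt0 R n)) (rn_lt1 R n)) -(cmean_holo du (ltW (rn_gt0 R n)) (rn_lt1 R n)).
  rewrite -(cmeanJ (b k n dk)) -(cmeanJ (b u n du)) /M1 /M2 /M3.
  rewrite -(cmeanZ Fz bk) -(cmeanZ (z * Fz) bu) -(cmeanZ z b1) -(cmeanZ (z * z) b2) -(cmeanZ _ b3).
  have c1 := bmcM (bmc_cst (rn R n) Fz) bk; have c2 := bmcM (bmc_cst (rn R n) (z * Fz)) bu.
  have c3 := bmcM (bmc_cst (rn R n) z) b1; have c4 := bmcM (bmc_cst (rn R n) (z * z)) b2.
  have c5 := bmcM (bmc_cst (rn R n) (z * (1 - rn R n * rn R n)%:C%C)) b3.
  have c6 := bmcM (bmc_cst (rn R n) (z * c^*)) (bzf1 n).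
  rewrite -(cmeanD c1 c2) -(cmeanD c4 c5) -(cmeanD c3 (bmcD c4 c5)) -(cmeanB (bmcD c1 c2) (bmcD c3 (bmcD c4 c5))).
  (* The remaining part z conj(c) w f1 is holomorphic and vanishes at 0, so its mean is 0 and it may
     be added. *)
  rewrite -[RHS]addr0 -(mulr0 (z * c^*)) -(m0 n) -(cmeanZ _ (bzf1 n)).
  rewrite -(cmeanD (bmcB (bmcD c1 c2) (bmcD c3 (bmcD c4 c5))) c6).
  apply: cmean_ext => t; have w1 := rn_disk n t; rewrite kE (f1E _ w1).
  have nz : polar (rn R n) t - z != 0.
    by rewrite subr_eq0; apply/eqP => E; move: w1; rewrite E z1 ltxx.
  have vv : polar (rn R n) t * (polar (rn R n) t)^* = (rn R n * rn R n)%:C%C.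
    by rewrite mulJ_cmod cmod_polar real_normK ?num_real// expr2.
  have -> : (1 - rn R n * rn R n)%:C%C = 1 - polar (rn R n) t * (polar (rn R n) t)^* :> Cplx R.
    by rewrite vv rmorphB rmorph1.
  move: nz; move: (polar (rn R n) t) (f _) (u _) => w fw uw nz.
  have wJ : w^* - z^* != 0 by rewrite -rmorphB -cmod_gt0 cmodJ cmod_gt0.
  rewrite mulr1 rmorphM fmorphV !rmorphB /=.
  have zJ : z^* = z^-1 by apply: (mulfI z0); rewrite zz divff.
  move: wJ; rewrite zJ => wJ; field.
  rewrite nz z0 /=; apply: contraNneq wJ => E.
  by apply/eqP; apply: (mulfI z0); rewrite mulr0 mulrBr divff// [z * _]mulrC E.
have r0 : (rn R n * rn R n) @[n --> \oo] --> (1 * 1 : R) by apply: cvgM; exact: cvg_rn.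
have hM3 n : cmod (M3 n) <= Bf1 * Bk.
  apply: cmean_bound; first by apply: bmcM; [exact: b|apply: bmcJ; exact: b].
  move=> t _; rewrite cmodM cmodJ; have w1 := rn_disk n t.
  by apply: ler_pM; rewrite ?cmod_ge0//; [exact: hf1|exact: hk].
pose E3 n := z * (1 - rn R n * rn R n)%:C%C * M3 n.
have L3 : E3 @ \oo --> (0 : Cplx R).
  apply/cvg_cplxP => e e0.
  have S : ((1 - rn R n * rn R n) * (Bf1 * Bk)) @[n --> \oo] --> (1 - 1 * 1) * (Bf1 * Bk).
    by apply: cvgM; [apply: cvgB; [exact: cvg_cst|exact: r0]|exact: cvg_cst].
  rewrite mulr1 subrr mul0r in S; move/cvgrPdist_le: S => /(_ _ e0); apply: filterS => n.
  rewrite sub0r normrN subr0 => hn; apply: le_trans (le_trans (ler_norm _) hn).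
  have p : 0 <= 1 - rn R n * rn R n.
    by have := rn_gt0 R n; have := rn_lt1 R n; move: (rn R n) => r r1 rp; nra.
  rewrite /E3 cmodM cmodM z1 mul1r cmodC (ger0_norm p).
  by apply: ler_wpM2l; [exact: p|exact: hM3].
pose E2 n := z * z * M2 n; pose E1 n := z * M1 n.
have Cc (x : Cplx R) : (fun _ : nat => x) @ \oo --> x by exact: ccvg_cst.
have T1 : E1 @ \oo --> z * 0.
  by apply: (@ccvgM R _ _ eventually_filter (fun=> z) M1 z 0); [exact: Cc|exact: L1].
have T2 : E2 @ \oo --> z * z * 0.
  by apply: (@ccvgM R _ _ eventually_filter (fun=> z * z) M2 (z * z) 0); [exact: Cc|exact: L2].
have T4 := @ccvgD R _ _ eventually_filter E1 _ _ _ T1 (@ccvgD R _ _ eventually_filter E2 E3 _ _ T2 L3).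
have T5 := @ccvgB R _ _ eventually_filter (fun=> Fz * (k 0)^* + z * Fz * (u 0)^*) _ _ _ (Cc _) T4.
rewrite (funext EM).
have -> : z * c^* * Fz = Fz * (k 0)^* + z * Fz * (u 0)^* - (z * 0 + (z * z * 0 + 0)).
  have zJ : z^* = z^-1 by apply: (mulfI z0); rewrite zz divff.
  by rewrite kE sub0r rmorphM fmorphV rmorphN rmorphB /= zJ; field.
exact: T5.
Qed.

End HardyLimits.

(** * Assembly of the norm estimate *)

Section Main.
Variable R : realType.
Implicit Types (f g h u F G : Cplx R -> Cplx R) (z w : Cplx R) (r t s : R).

Lemma inner_bdry u : inner_function u -> bdry u u (fun=> 1).
Proof.
move=> [_ _]; rewrite /bdry; apply: ae_imp => t H ht; have {}H := H ht.
have h0 : 0 <= 2^-1 :> R by rewrite invr_ge0.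
have h1 : 2^-1 < 1 :> R by rewrite invf_lt1 ?ltr1n.
have C : cmod (u (polar (rn R n) t)) @[n --> \oo] --> (1 : R) := at_left_rad h0 h1 H.
have S : `|cmod (u (polar (rn R n) t)) * cmod (u (polar (rn R n) t)) - 1| @[n --> \oo] --> `|1 * 1 - 1 : R|.
  by apply: cvg_norm; apply: cvgB; [apply: cvgM; exact: C|exact: cvg_cst].
rewrite mulr1 subrr normr0 in S.
have E n : cmod (u (polar (rn R n) t) * (u (polar (rn R n) t))^* - (1 : Cplx R)^*) =
    `|cmod (u (polar (rn R n) t)) * cmod (u (polar (rn R n) t)) - 1|.
  rewrite mulJ_cmod rmorph1 -expr2; set x := cmod _ ^+ 2.
  have -> : x%:C%C - 1 = (x - 1)%:C%C :> Cplx R by rewrite rmorphB rmorph1.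
  by rewrite cmodC.
by rewrite -(funext E) in S; exact: S.
Qed.

Lemma bdryZ u f f' s : bdry u f f' -> bdry u (fun w => s%:C%C * f w) (fun w => s%:C%C * f' w).
Proof.
rewrite /bdry; apply: ae_imp => t H ht; have {}H := H ht.
pose X n : Cplx R := f (polar (rn R n) t) * (u (polar (rn R n) t))^* - (f' (polar (rn R n) t))^*.
have S : `|s| * cmod (X n) @[n --> \oo] --> `|s| * 0 by apply: cvgM; [exact: cvg_cst|exact: H].
rewrite mulr0 in S.
have sJ : (s%:C%C : Cplx R)^* = s%:C%C by apply: cplx_eq; [rewrite cReJ|rewrite cImJ /= oppr0].
have E n : cmod (s%:C%C * f (polar (rn R n) t) * (u (polar (rn R n) t))^* - (s%:C%C * f' (polar (rn R n) t))^*) =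
    `|s| * cmod (X n).
  rewrite -cmodC -cmodM /X; congr cmod.
  move: (polar (rn R n) t) => v; have -> : (s%:C%C * f' v)^* = s%:C%C * (f' v)^* by rewrite rmorphM /= sJ.
  by rewrite mulrBr mulrA.
by rewrite -(funext E) in S; exact: S.
Qed.

Lemma rmean_ge0 r f : 0 <= rmean r (fun w => cmod (f w) ^+ 2).
Proof.
by rewrite /rmean mulr_ge0 ?invr_ge0 ?tp_ge0//; apply: rint_ge0 => t _; exact: sqr_ge0.
Qed.

Lemma rmeanZ r s f : bmc r f ->
  rmean r (fun w => cmod (s%:C%C * f w) ^+ 2) = s ^+ 2 * rmean r (fun w => cmod (f w) ^+ 2).
Proof.
move=> bf; rewrite /rmean mulrCA; congr (_ * _).
have bf2 : rbm 0 (twopi R) (fun t => cmod (f (polar r t)) ^+ 2).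
  by apply: (rbm_ext _ (rbmM (bm_cmod bf) (bm_cmod bf))) => t _; rewrite expr2.
rewrite -(rintZ _ bf2); apply: rint_ext => t _.
by rewrite cmodM cmodC exprMn real_normK ?num_real.
Qed.

(* The partner of (f - f(z)) / (w - z) is -z w (f' - conj(f(z)) u) / (w - z);
   its numerator vanishes at z by bdry_value. *)
Lemma class_step u z G f F f' F' : cmod z = 1 -> nice z u G -> nice z f F -> nice z f' F' ->
  bdry u f f' -> exists f1' F1', [/\ nice z (fun w => (f w - F z) / (w - z)) (dq F z), nice z f1' F1',
    bdry u (fun w => (f w - F z) / (w - z)) f1' & f1' 0 = 0].
Proof.
move=> z1 nu nf nf' hb.
have [_ [B B0 hB] eu] := nu; have [_ _ ef] := nf; have [_ [B' B'0 hB'] ef'] := nf'.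
have V := bdry_value z1 eu ef ef' hb.
have ng := niceB nf' (niceM (nice_cst z (F z)^*) nu).
have nq := nice_dq z1 ng.
have g0 : F' z - (F z)^* * G z = 0 by rewrite V mulrC subrr.
exists (fun w => - z * w * ((f' w - (F z)^* * u w) / (w - z))).
exists (fun w => - z * w * dq (fun w => F' w - (F z)^* * G w) z w); split.
- exact: nice_dq.
- have E : (fun w => (f' w - (F z)^* * u w - (F' z - (F z)^* * G z)) / (w - z)) =
      (fun w => (f' w - (F z)^* * u w) / (w - z)) by apply/funext => w; rewrite g0 subr0.
  rewrite E in nq; exact: (niceM (niceM (nice_cst z (- z)) (nice_id z)) nq).
- have h1 w : cmod w < 1 -> cmod (u w) <= B + B'.
    by move=> hw; apply: le_trans (hB _ hw) _; rewrite lerDl.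
  have h2 w : cmod w < 1 -> cmod (f' w) <= B + B'.
    by move=> hw; apply: le_trans (hB' _ hw) _; rewrite lerDr.
  exact: (bdry_step (F z) z1 h1 h2 hb).
- by rewrite mulr0 mul0r.
Qed.

Lemma reproducing u z G f F f' F' f1' F1' : cmod z = 1 -> nice z u G -> nice z f F -> nice z f' F' ->
  nice z f1' F1' -> bdry u f f' -> bdry u (fun w => (f w - F z) / (w - z)) f1' -> f' 0 = 0 -> f1' 0 = 0 ->
  cmean (rn R n) (fun w => f w * ((u w - G z) / (w - z))^*) @[n --> \oo] --> z * (G z)^* * F z.
Proof.
move=> z1 nu nf nf' nf1' hb hb1 e e1.
have [df1 [Bf1 _ hf1] _] := nice_dq z1 nf; have [dk [Bk _ hk] _] := nice_dq z1 nu.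
move: nu nf nf' nf1' => [du [B _ hu] _] [df [Bf _ hf] _] [df' [Bf' _ hf'] _] [df1' [Bf1' _ hf1'] _].
exact: (@reproducing_limit R u f (fun w => (f w - F z) / (w - z)) f' f1' z (G z) (F z) B Bf Bf1 Bf' Bf1' Bk
  (fun w => (u w - G z) / (w - z)) z1 (fun w => erefl) (fun w _ => erefl)
  du df df' df1 df1' dk hu hf hf' hf1 hf1' hk hb hb1 e e1).
Qed.

(** The weight s = D / E turns the second term into E / 2, which is absorbed on the left and leaves
    E^2 <= D^2 S. *)
Lemma sqr_le_of_means (E D S : R) : 0 <= E -> 0 < D -> 0 <= S ->
  (forall s, 0 < s -> E <= (s * (D * S) + s^-1 * D) / 2) -> (E / D) ^+ 2 <= S.
Proof.
move=> E0 D0 S0 H; have [->|En] := eqVneq E 0; first by rewrite mul0r expr0n.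
have Ep : 0 < E by rewrite lt_neqAle eq_sym En.
have := H _ (divr_gt0 Ep D0 : 0 < E / D); have := H _ (divr_gt0 D0 Ep) => + _.
have -> : D / E * (D * S) = D ^+ 2 * S / E by rewrite expr2; ring.
have -> : (D / E)^-1 * D = E by field; rewrite !gt_eqF.
move=> h; have : E <= D ^+ 2 * S / E by move: h; lra.
by rewrite ler_pdivlMr// -expr2 expr_div_n ler_pdivrMr ?exprn_gt0// mulrC.
Qed.

Lemma dq_diag F z : dq F z z = derive1 F z. Proof. by rewrite /dq eqxx. Qed.

End Main.

Theorem theorem2p6 (R : realType) (u : Cplx R -> Cplx R) (zeta : Cplx R)
    (u_inner : inner_function u) (u_nonconstant : nonconstant_on_disk u)
    (zeta_circle : unit_circle zeta) (zeta_spectrum : ~ spectrum u zeta) :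
  ((cmod (derive1n 2 (extension_at u zeta) zeta) /
      (2 * cmod (derive1 (extension_at u zeta) zeta)))%:E
   <= model_opnorm u (diff_quotient zeta))%E.
Proof.
have z1 : cmod zeta = 1 by exact: zeta_circle.
set G := extension_at u zeta.
have aG : analytic_extension u zeta G.
  exact: (xgetPex u (extension_exists u_inner z1 zeta_spectrum)).
have [hu0 [M hM] _] := u_inner.
have du w : cmod w < 1 -> derivable u w 1 by move=> hw; exact: hu0.
have d0 : cmod (0 : Cplx R) < 1 by rewrite cmod0.
have M0 : 0 <= M := le_trans (cmod_ge0 _) (hM 0 d0).
have nu : nice zeta u G by split; [exact: du|exists M|exact: analytic_extb].
have [_ _ eu] := nu; have [_ _ e1] := nice_cst zeta 1.
(* For the pair u and 1, the boundary relation at zeta says that |u(zeta)| = 1. *)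
have V := bdry_value z1 eu eu e1 (inner_bdry u_inner).
have c1 : cmod (G zeta) = 1.
  have := congr1 (@cmod R) V; rewrite cmodM cmodJ cmod1 => h.
  by apply/eqP; rewrite -sqrp_eq1 ?cmod_ge0// expr2 -h.
have [k' [K' [nk nk' bk k'0]]] := class_step z1 nu nu (nice_cst zeta 1) (inner_bdry u_inner).
have [k1' [K1' [nk1 nk1' bk1 k1'0]]] := class_step z1 nu nk nk' bk.
(* The reproducing property of [k1] involves the partner of its own difference quotient, hence a
   third step. *)
have [k2' [K2' [nk2 nk2' bk2 k2'0]]] := class_step z1 nu nk1 nk1' bk1.
have L1 := reproducing z1 nu nk nk' nk1' bk bk1 k'0 k1'0.
have L2 := reproducing z1 nu nk1 nk1' nk2' bk1 bk2 k1'0 k2'0.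
move: nk nk1 bk bk1 L1 L2 => /=.
set k := fun w => (u w - G zeta) / (w - zeta).
set k1 := fun w => (k w - dq G zeta zeta) / (w - zeta).
move=> nk nk1 bk bk1 L1 L2.
have [rho rho0 hG] := analytic_extb aG.
have dG v : cmod (v - zeta) < rho -> derivable G v 1 by move=> /hG[].
have D2E : dq (dq G zeta) zeta zeta = derive1n 2 G zeta / 2.
  exact: etrans (dq_diag (dq G zeta) zeta) (derive1_dq rho0 dG).
have D1E : dq G zeta zeta = derive1 G zeta := dq_diag G zeta.
have c2 : cmod (2 : Cplx R) = 2.
  have -> : (2 : Cplx R) = (2 : R)%:C%C by rewrite rmorph_nat.
  by rewrite cmodC normr_nat.
set E := cmod (dq (dq G zeta) zeta zeta); set D := cmod (dq G zeta zeta).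
have -> : cmod (derive1n 2 G zeta) / (2 * cmod (derive1 G zeta)) = E / D.
  by rewrite /E /D D2E D1E cmodM cmodV c2 invfM mulrA.
have E0 : 0 <= E by exact: cmod_ge0.
have D0 : 0 <= D by exact: cmod_ge0.
have [dk [Bk _ hk] _] := nk; have [dk1 _ _] := nk1; have [dk' _ _] := nk'.
have bmk n : bmc (rn R n) k := bmc_der dk (ltW (rn_gt0 R n)) (rn_lt1 R n).
have bmk1 n : bmc (rn R n) k1 := bmc_der dk1 (ltW (rn_gt0 R n)) (rn_lt1 R n).
have Z x : cmod (zeta * (G zeta)^* * x) = cmod x by rewrite !cmodM cmodJ z1 c1 !mul1r.
have N1 : rmean (rn R n) (fun w => cmod (k w) ^+ 2) @[n --> \oo] --> D.
  have H : cmod (cmean (rn R n) (fun w => k w * (k w)^*)) @[n --> \oo] -->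
      cmod (zeta * (G zeta)^* * dq G zeta zeta) := cvg_cmod eventually_filter L1.
  have X n : cmod (cmean (rn R n) (fun w => k w * (k w)^*)) = rmean (rn R n) (fun w => cmod (k w) ^+ 2).
    by rewrite (rmean_sqr (bmk n)) cmodC ger0_norm ?rmean_ge0.
  by rewrite (funext X) Z in H.
have N2 : cmod (cmean (rn R n) (fun w => k1 w * (k w)^*)) @[n --> \oo] --> E.
  have H : cmod (cmean (rn R n) (fun w => k1 w * (k w)^*)) @[n --> \oo] -->
      cmod (zeta * (G zeta)^* * dq (dq G zeta) zeta zeta) := cvg_cmod eventually_filter L2.
  by rewrite Z in H.
(* The factor that normalises k. If D = 0 the inverse is 0 by convention, so s = 0; the relations
   s^2 = 1 / D and s^2 D <= 1 hold in either case. *)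
pose s : R := (Num.sqrt D)^-1.
have sE : s ^+ 2 = D^-1 by rewrite exprVn sqr_sqrtr.
have sD : s ^+ 2 * D <= 1.
  by rewrite sE; have [->|Dn] := eqVneq D 0; [rewrite mulr0|rewrite mulVf].
pose kk w := s%:C%C * k w.
have nkk : nice zeta kk (fun w => s%:C%C * dq G zeta w) := niceM (nice_cst zeta s%:C%C) nk.
have nkk' := niceM (nice_cst zeta s%:C%C) nk'.
have nT := niceM (nice_cst zeta s%:C%C) nk1.
have [dkk [Bkk _ hkk] ekk] := nkk; have [dkk' [Bkk' _ hkk'] _] := nkk'; have [dT _ _] := nT.
have kk'0 : s%:C%C * k' 0 = 0 by rewrite k'0 mulr0.
have mkk : model_space u kk := class_model du dkk dkk' hM hkk hkk' (bdryZ s bk) kk'0.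
have nmkk : (hardy_norm kk <= 1%:E)%E.
  apply: hardy_norm_le => //; rewrite expr1n; apply: (coef_bound dkk) => e e0.
  have S : s ^+ 2 * rmean (rn R n) (fun w => cmod (k w) ^+ 2) @[n --> \oo] --> s ^+ 2 * D.
    by apply: cvgM; [exact: cvg_cst|exact: N1].
  move/cvgrPdist_le: S => /(_ _ e0); apply: filterS => n; rewrite (rmeanZ s (bmk n)).
  by rewrite distrC => h; move: (le_trans (ler_norm _) h) sD; lra.
(* The continuation chosen for [kk] is arbitrary, but its value at zeta is determined by continuity
   from inside the disk. *)
have extE : extension_at kk zeta zeta = s%:C%C * dq G zeta zeta.
  apply: (ext_value z1 _ ekk); apply: analytic_extb.
  exact: (xgetPex kk (ex_intro _ _ (extb_analytic ekk))).
have TE : diff_quotient zeta kk = (fun w => s%:C%C * k1 w).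
  by apply/funext => w; rewrite /diff_quotient extE /kk /k1 -mulrBr mulrA.
apply: (@le_trans _ _ (hardy_norm (diff_quotient zeta kk))); last first.
  by apply: ereal_sup_ubound; exists kk; [split; [exact: mkk|exact: nmkk]|].
rewrite TE /hardy_norm -/(hardy_sum (fun w => s%:C%C * k1 w)).
(* For D = 0 the quotient E / D is 0 by convention. *)
have [D00|Dn] := eqVneq D 0; first by rewrite D00 invr0 mulr0 sqrte_ge0.
have Dp : 0 < D by rewrite lt_neqAle eq_sym Dn.
have := hardy_sum_ge0 (fun w => s%:C%C * k1 w).
case ES : (hardy_sum (fun w => s%:C%C * k1 w)) => [S| |] //= S0; last by rewrite leey.
rewrite lee_fin in S0 *.
have HS N : \sum_(n < N) cmod (taylor_coef (fun w => s%:C%C * k1 w) n) ^+ 2 <= S.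
  by have := hardy_sum_ge (fun w => s%:C%C * k1 w) N; rewrite ES lee_fin.
(* Q maps [kk] to s times [k1], so the squared norm S bounds the mean squares of [k1] by S / s^2 = D
   S. *)
have m1 n : rmean (rn R n) (fun w => cmod (k1 w) ^+ 2) <= D * S.
  have := parseval_le dT (rn_gt0 R n) (rn_lt1 R n) (ltW (rn_lt1 R n)) HS.
  by rewrite (rmeanZ s (bmk1 n)) sE ler_pdivrMl.
have ED0 : 0 <= E / D by rewrite divr_ge0.
rewrite lee_fin -[E / D]ger0_norm// -sqrtr_sqr ler_wsqrtr//.
(* Cauchy-Schwarz for [k1] against [k] on each circle, for every weight, in the limit where the
   pairing tends to E and the mean square of [k] to D. *)
apply: sqr_le_of_means => // a a0.
have C : (a * (D * S) + a^-1 * rmean (rn R n) (fun w => cmod (k w) ^+ 2)) / 2 @[n --> \oo] -->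
    (a * (D * S) + a^-1 * D) / 2.
  apply: cvgM; last exact: cvg_cst.
  by apply: cvgD; [exact: cvg_cst|apply: cvgM; [exact: cvg_cst|exact: N1]].
apply: (ler_cvg_to N2 C); apply: nearW => n.
apply: le_trans (mean_CS (bmk1 n) (bmk n) a0) _.
rewrite ler_pM2r ?invr_gt0//; rewrite lerD2r; apply: ler_wpM2l; [exact: ltW|exact: m1].
Qed.
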